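(* Let $d$ be a positive integer or $d=\infty$, and let $\varphi(s)=c_1+\sum_{j=1}^d c_{q_j}q_j^{-s}$, where $c_1,c_{q_j}\in\mathbb{C}$, the integers $q_j\ge2$ are independent, $c_{q_j}\ne0$ for all $j$ with $1\le j\le d$ (all $j\ge1$ if $d=\infty$), and $\kappa(\varphi):=\operatorname{Re}c_1-\sum_{j=1}^d|c_{q_j}|=1/2$. Let $C_\varphi$ be the composition operator on $\mathcal{H}^2$ generated by $\varphi$. (a) If $1\le d<\infty$, then there are constants $0<\delta\le C<\infty$ (independent of $n$) such that $\delta\, n^{-(d-1)/2}\le a_n(C_\varphi)\le C\,(n/\log n)^{-(d-1)/2}$ for all $n\ge2$. (b) If $d=\infty$, then $C_\varphi$ belongs to the Schatten class $S_p$ for every $p>0$.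
   Context: $\mathcal{H}^2$ is the Hilbert space of Dirichlet series $f(s)=\sum_{n\ge1} b_n n^{-s}$ with $\|f\|_{\mathcal{H}^2}^2=\sum_n |b_n|^2<\infty$; its elements are analytic in $\{\operatorname{Re}s>1/2\}$, and $C_\varphi f=f\circ\varphi$ (under the hypotheses here $C_\varphi$ is bounded on $\mathcal{H}^2$). The integers $q_j\ge2$ are independent if every positive integer $n$ can be written as $n=q^\alpha=\prod_j q_j^{\alpha_j}$ for at most one (finitely supported) multi-index $\alpha$ of nonnegative integers. The $n$th approximation number $a_n(T)$ of a bounded operator $T$ is the distance in operator norm from $T$ to the set of operators of rank $<n$. For $0<p<\infty$, $T$ belongs to $S_p$ if it is compact and $\sum_n a_n(T)^p<\infty$. *)

(* Defs.v *)
From HB Require Import structures.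
From mathcomp Require Import all_boot all_order all_algebra finmap.
From mathcomp Require Import all_classical all_reals all_analysis.
From mathcomp Require Import complex.

Set Implicit Arguments.
Unset Strict Implicit.
Unset Printing Implicit Defensive.

Import Order.TTheory GRing.Theory Num.Theory numFieldNormedType.Exports.
Import ComplexField.Normc.

Local Open Scope classical_set_scope.
Local Open Scope complex_scope.
Local Open Scope ring_scope.

(* The usual topology of R[i], which real_closed leaves undeclared. *)
HB.instance Definition _ (R : realType) := NormedModule.copy R[i] R[i]^o.

Section H2.
Variable R : realType.
Local Notation C := R[i].

(* Dirichlet coefficients are shifted by one: b n is the coefficient of
   (n.+1)^(-s). *)
Definition sqnorm (b : nat -> C) : \bar R :=
  (\sum_(0 <= n <oo) (normc (b n) ^+ 2)%:E)%E.

Definition square_summable : {pred nat -> C} :=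
  [pred b | (sqnorm b < +oo)%E].

Record hardy2 := Hardy2 {
  coef :> nat -> C ;
  coefP : coef \in square_summable
}.

HB.instance Definition _ := [isSub for coef].
HB.instance Definition _ := [Choice of hardy2 by <:].

Lemma sqnorm_ge0 b : (0 <= sqnorm b)%E.
Proof. by apply: nneseries_ge0 => n _ _; rewrite lee_fin sqr_ge0. Qed.

Lemma normc_ge0 (z : C) : 0 <= normc z.
Proof. by case: z => x y /=; exact: sqrtr_ge0. Qed.

Lemma sqnormZ (a : C) b : sqnorm (a *: b) = ((normc a ^+ 2)%:E * sqnorm b)%E.
Proof.
rewrite /sqnorm -nneseriesZl ?lee_fin ?sqr_ge0//; last first.
  by move=> n _; rewrite lee_fin sqr_ge0.
by apply: eq_eseriesr => n _; rewrite -EFinM -exprMn -normcM.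
Qed.

Lemma sqnorm_Lnorm b : (sqnorm b `^ 2^-1)%E =
  Lnorm (@counting nat R) 2%:E (EFin \o (fun n => normc (b n))).
Proof.
rewrite Lnorm_counting; last by rewrite ltr0n.
congr (_ `^ _)%E; apply: eq_eseriesr => n _ /=.
by rewrite ger0_norm ?normc_ge0// -powR_mulrn ?normc_ge0.
Qed.

Lemma sqnormD_root (b c : nat -> C) :
  (sqnorm (b + c)%R `^ 2^-1 <= sqnorm b `^ 2^-1 + sqnorm c `^ 2^-1)%E.
Proof.
rewrite !sqnorm_Lnorm.
apply: le_trans (eminkowski _ _ _ _); last 3 first.
- by [].
- by [].
- by rewrite lee_fin ler1n.
rewrite !Lnorm_counting ?ltr0n//.
have ge0 (u : R^nat) : (0 <= \sum_(0 <= n <oo) (`|u n| `^ 2)%:E)%E.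
  by apply: nneseries_ge0 => n _ _; rewrite lee_fin powR_ge0.
apply: gt0_ler_poweR; rewrite ?in_itv/= ?leey ?andbT ?ge0 ?invr_ge0//.
apply: lee_nneseries => [n _ _|n _ /=]; first by rewrite lee_fin powR_ge0.
rewrite lee_fin ge0_ler_powR ?nnegrE ?ler0n//.
by rewrite ger0_norm ?normc_ge0// (le_trans (le_normcD _ _))// ler_norm.
Qed.

Lemma square_summableE b : (b \in square_summable) = (sqnorm b < +oo)%E.
Proof. by rewrite inE. Qed.

Lemma square_summable_submod : submod_closed square_summable.
Proof.
split=> [|a b c].
  rewrite square_summableE [sqnorm 0]eseries0 ?ltry// => n _ _.
  by rewrite [0 n]/(0 : C) normc0 expr0n.
rewrite !square_summableE => bfin cfin.
have abfin : (sqnorm (a *: b)%R < +oo)%E.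
  by rewrite sqnormZ lte_mul_pinfty// lee_fin sqr_ge0.
apply: (@lty_poweRy _ _ 2^-1); first by rewrite invr_eq0 pnatr_eq0.
by rewrite (le_lt_trans (sqnormD_root _ _))// lte_add_pinfty// poweR_lty.
Qed.

HB.instance Definition _ :=
  GRing.isSubmodClosed.Build C (nat -> C) square_summable square_summable_submod.
HB.instance Definition _ := [SubChoice_isSubLmodule of hardy2 by <:].

Definition h2norm (f : hardy2) : R := Num.sqrt (fine (sqnorm f)).

Lemma sqnorm_fin (f : hardy2) : sqnorm f \is a fin_num.
Proof.
rewrite ge0_fin_numE ?sqnorm_ge0//.
by rewrite -square_summableE coefP.
Qed.

Lemma h2norm_EFin (f : hardy2) : ((h2norm f)%:E = sqnorm f `^ 2^-1)%E.
Proof.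
rewrite /h2norm -(fineK (sqnorm_fin f)) poweR_EFin /= powR12_sqrt//.
by rewrite fine_ge0 ?sqnorm_ge0.
Qed.

Lemma h2normD f g : (h2norm (f + g))%:C <= (h2norm f)%:C + (h2norm g)%:C.
Proof.
rewrite -rmorphD lecR -lee_fin EFinD !h2norm_EFin; exact: sqnormD_root.
Qed.

Lemma h2normZ (a : C) f : (h2norm (a *: f))%:C = `|a| * (h2norm f)%:C.
Proof.
rewrite -[Num.norm a]/((normc a)%:C) -rmorphM/=; congr (_ %:C).
rewrite /h2norm [sqnorm _]sqnormZ fineM ?sqnorm_fin//= sqrtrM ?sqr_ge0//.
by rewrite sqrtr_sqr ger0_norm ?normc_ge0.
Qed.

Lemma h2norm_eq0 f : (h2norm f)%:C = 0 -> f = 0.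
Proof.
move=> /complexI/eqP; rewrite sqrtr_eq0 => f0; apply/val_inj/funext => n /=.
apply/eq0_normc/eqP; rewrite -[_ == 0](@expf_eq0 _ _ 2) eq_le sqr_ge0 andbT.
rewrite -lee_fin; apply: le_trans (_ : _ <= sqnorm f)%E _; last first.
  by rewrite -(fineK (sqnorm_fin f)) lee_fin.
rewrite /sqnorm (@nneseriesD1 _ _ n)// => [|k _]; last by rewrite lee_fin sqr_ge0.
by rewrite leeDl// nneseries_ge0// => k _ _; rewrite lee_fin sqr_ge0.
Qed.

(* The factory wants a norm valued in the scalars, hence the %:C. *)
HB.instance Definition _ :=
  Lmodule_isNormed.Build C hardy2 h2normD h2normZ h2norm_eq0.

Lemma h2_normE (f : hardy2) : `|f| = (h2norm f)%:C.
Proof. by []. Qed.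

End H2.

Section composition.
Variable R : realType.
Local Notation C := R[i].
Local Notation H2 := (hardy2 R).

Definition cexp (z : C) : C :=
  (expR (complex.Re z))%:C * (cos (complex.Im z) +i* sin (complex.Im z)).

Definition npow (n : nat) (s : C) : C := cexp (s * (ln n%:R)%:C).

Definition dirichlet (f : H2) (s : C) : C :=
  \big[+%R/0]_(0 <= n <oo) (coef f n * npow n.+1 (- s)).

(* f \o phi is identified with the g in H2 having the same values on
   Re s > 1/2; such a g is unique, and 0 is a junk value for when there is
   none. *)
Definition composition_operator (phi : C -> C) (f : H2) : H2 :=
  xget 0 [set g : H2 | forall s : C, 2^-1 < complex.Re s ->
                         dirichlet g s = dirichlet f (phi s)].

(* d : option nat stands for an element of {0, 1, ...} together with
   infinity, encoded as None; the terms j = 1, ..., d are indexed from 0. *)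
Definition below (d : option nat) (j : nat) : bool :=
  if d is Some m then (j < m)%N else true.

Definition symbol (d : option nat) (c1 : C) (q : nat -> nat) (c : nat -> C)
    (s : C) : C :=
  c1 + \big[+%R/0]_(0 <= j <oo | below d j) (c j * npow (q j) (- s)).

Definition kappa (d : option nat) (c1 : C) (c : nat -> C) : \bar R :=
  ((complex.Re c1)%:E - \sum_(0 <= j <oo | below d j) (normc (c j))%:E)%E.

Definition multi_index (d : option nat) (alpha : {fsfun nat -> nat with 0%N}) :=
  forall j, ~~ below d j -> alpha j = 0%N.

Definition multi_pow (q : nat -> nat) (alpha : {fsfun nat -> nat with 0%N}) :=
  (\prod_(j <- finsupp alpha) q j ^ alpha j)%N.

Definition independent (d : option nat) (q : nat -> nat) : Prop :=
  forall n : nat, (0 < n)%N ->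
  forall alpha beta, multi_index d alpha -> multi_index d beta ->
    n = multi_pow q alpha -> n = multi_pow q beta -> alpha = beta.

Implicit Type T : H2 -> H2.

Definition bounded_operator T := linear T /\ continuous T.

Definition opnorm T : \bar R :=
  ereal_sup [set (h2norm (T f))%:E | f in [set f | h2norm f <= 1]].

Definition rank_lt (n : nat) T := exists2 k, (k < n)%N &
  exists v : 'I_k -> H2, forall f, exists a : 'I_k -> C,
    T f = \sum_(i < k) a i *: v i.

Definition approx_number T (n : nat) : \bar R :=
  ereal_inf [set opnorm (fun f => T f - S f) |
             S in [set S | bounded_operator S /\ rank_lt n S]].

Definition compact_operator T :=
  bounded_operator T /\ precompact (T @` [set f | h2norm f <= 1]).

Definition schatten (p : R) T := compact_operator T /\
  (\sum_(1 <= n <oo) (approx_number T n `^ p) < +oo)%E.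

End composition.

(* Main.v *)
(* Write c1 = 1/2 + r + i tau, r = \sum_j |c_j|, and w(s) = \sum_j c_j q_j^(-s).
   Taylor expansion at c1 gives f(c1 + w(s)) = \sum_m T_m(f) (w(s)/r)^m with
   T_m(f) = r^m f^(m)(c1) / m!, and up to a unimodular factor the matrix entries of T
   are n^(-1/2) P_m(r ln n), with Poisson weights P_m(x) = e^(-x) x^m / m!. As the q_j
   are independent, the Dirichlet series (w/r)^m have disjoint supports, and the
   square D_m of the norm of (w/r)^m is the sum of the squares of the multinomial
   probabilities, of order m^(-(d-1)/2); so C_phi is T followed by the diagonal
   operator with weights D_m^(1/2).

   Upper bound: the n with sqrt(r ln n) >= J are harmless because D_m is small near
   m = r ln n; the remaining n fall into J blocks of unit length in the variable
   sqrt(r ln n), and on each block the Charlier expansion approximates the Poisson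
   weights to order K by a rank K kernel, with an error superexponentially small
   in K. This gives a_(JK+1) << J^(-(d-1)/2) + J e^(-bK) for every b, and K is taken
   of the order of ln n for finite d, of the order of sqrt n for d infinite.

   Lower bound: functions supported on J well-separated blocks are mapped by T to
   almost orthogonal vectors, because the Hellinger affinity of Poisson laws with
   means x and y is exp(-(sqrt x - sqrt y)^2 / 2); the degrees involved are of order
   J^2, where D_m is at least of order J^(-(d-1)). *)
Require Import Defs.
From mathcomp Require Import all_boot all_order all_algebra finmap.
From mathcomp Require Import all_classical all_reals all_analysis.
From mathcomp Require Import complex ring lra zify.
Set Implicit Arguments.
Unset Strict Implicit.
Unset Printing Implicit Defensive.
Import Order.TTheory GRing.Theory Num.Theory numFieldNormedType.Exports.
Import ComplexField.Normc.
Local Open Scope classical_set_scope.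
Local Open Scope complex_scope.
Local Open Scope ring_scope.

(** The factor n^(-1/2) is just what T needs to be bounded: with x = r ln n, the sum over n of P_m(r
    ln n)/n behaves like the integral of P_m divided by r, so it is bounded uniformly in m. In the
    norm estimates Cauchy-Schwarz splits n^(-1/2) P_m into P_m^(1/2) and (P_m/n)^(1/2); what remains
    is the mean of D_m under the Poisson law of mean r ln n, for n in the support of f. The scale
    sqrt x is dictated by the Poisson laws: the square root of a Poisson variable has bounded
    variance whatever its mean, so on a block of unit length the chi-square distance to the center
    is bounded and one K serves all blocks. The rank is JK; as e^(-bK) has to beat a power of n, K
    is of order ln n, and this is the logarithm in (a). In (b) D_m decays faster than any power of
    m, and J = K costs nothing. The lower bound uses no expansion, hence has no logarithm: J blocks
    give a space of dimension J. Since [composition_operator] is defined by a choice, its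
    identification with the model rests on the uniqueness of Dirichlet coefficients. *)

(** * Series of nonnegative terms, through bounds on their partial sums *)

Section nonneg_series.
Variable R : realType.
Implicit Types (u v w : nat -> R) (A B : R).

(* Meant for u >= 0, where it says that the series of u converges, with sum at
   most A. *)
Definition sum_le u A := forall N, \sum_(0 <= i < N) u i <= A.

Definition nsum u : \bar R := (\sum_(0 <= n <oo) (u n)%:E)%E.

Lemma nsum_leP u A : (forall i, 0 <= u i) ->
  (nsum u <= A%:E)%E <-> sum_le u A.
Proof.
move=> u0; split=> [uA N|uA].
  rewrite -lee_fin (le_trans _ uA)// -sumEFin.
  by apply: nneseries_lim_ge => i _ _; rewrite lee_fin.
apply: lime_le; first by apply: is_cvg_nneseries => i _ _; rewrite lee_fin.
by apply: nearW => N /=; rewrite sumEFin lee_fin.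
Qed.

Lemma nsum_ge0 u : (forall i, 0 <= u i) -> (0 <= nsum u)%E.
Proof. by move=> u0; apply: nneseries_ge0 => i _ _; rewrite lee_fin. Qed.

Lemma sum_le_ge0 u A : sum_le u A -> 0 <= A.
Proof. by move=> /(_ 0%N); rewrite big_geq. Qed.

Lemma sum_le_fine u : (forall i, 0 <= u i) -> (nsum u < +oo)%E ->
  sum_le u (fine (nsum u)).
Proof.
move=> u0 uoo; apply/nsum_leP => //.
by rewrite fineK// ge0_fin_numE// nsum_ge0.
Qed.

Lemma le_sum_le u v A : (forall i, u i <= v i) -> sum_le v A -> sum_le u A.
Proof. by move=> uv vA N; apply: le_trans (vA N); apply: ler_sum. Qed.

Lemma sum_le_trans u A B : A <= B -> sum_le u A -> sum_le u B.
Proof. by move=> AB uA N; apply: le_trans (uA N) AB. Qed.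

Lemma sum_leD u v A B : sum_le u A -> sum_le v B ->
  sum_le (fun i => u i + v i) (A + B).
Proof. by move=> uA vB N; rewrite big_split /= lerD. Qed.

Lemma sum_leZ u A (k : R) : 0 <= k -> sum_le u A ->
  sum_le (fun i => k * u i) (k * A).
Proof. by move=> k0 uA N; rewrite -mulr_sumr ler_wpM2l. Qed.

Lemma le_term_sum_le u A i : (forall i, 0 <= u i) -> sum_le u A -> u i <= A.
Proof.
move=> u0 /(_ i.+1); rewrite big_nat_recr//= => /(le_trans _); apply.
by rewrite lerDr sumr_ge0.
Qed.

Lemma sum_le_fin u N : (forall i, 0 <= u i) -> (forall i, (N <= i)%N -> u i = 0) ->
  sum_le u (\sum_(0 <= i < N) u i).
Proof.
move=> u0 uN M; have [MN|/ltnW NM] := leqP M N.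
  by rewrite [leRHS](big_cat_nat (n := M))//= lerDl sumr_ge0.
rewrite (big_cat_nat (n := N))//= [X in _ + X]big_nat_cond.
by rewrite [X in _ + X]big1 ?addr0// => i /andP[/andP[+ _] _]; exact: uN.
Qed.

(** Tonelli's theorem, obtained from the interchange of extended nonnegative sums: the total is at
    most A, and this rules out an infinite column sum. The row bounds may depend on the number N of
    rows considered. *)
Lemma sum_le_exch (a : nat -> nat -> R) A :
  (forall i j, 0 <= a i j) ->
  (forall N, exists2 b : nat -> R,
    (forall i, (i < N)%N -> sum_le (a i) (b i)) & \sum_(0 <= i < N) b i <= A) ->
  (forall j, exists2 b : R, sum_le (a ^~ j) b & True) /\
  forall N, exists2 b : nat -> R,
    (forall j, sum_le (a ^~ j) (b j)) & \sum_(0 <= j < N) b j <= A.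
Proof.
move=> a0 aA.
have tot : (\sum_(0 <= j <oo) nsum (a ^~ j) <= A%:E)%E.
  rewrite /nsum -nneseries_interchange; last by move=> i j; rewrite lee_fin.
  apply: lime_le.
    apply: is_cvg_nneseries => i _ _; exact: nsum_ge0.
  apply: nearW => N; have [b bN bA] := aA N.
  apply: (@le_trans _ _ (\sum_(0 <= i < N) (b i)%:E)%E).
    rewrite big_nat_cond [leRHS]big_nat_cond.
    apply: lee_sum => i /andP[/andP[_ iN] _]; apply/nsum_leP => //; exact: bN.
  by rewrite sumEFin lee_fin.
have fin j : (nsum (a ^~ j) < +oo)%E.
  apply: (@le_lt_trans _ _ A%:E); last exact: ltry.
  apply: le_trans tot; rewrite (nneseriesD1 (n := j))//=.
    by rewrite leeDl// nneseries_ge0// => i _ _; exact: nsum_ge0.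
  by move=> k _; exact: nsum_ge0.
split=> [j|N].
  exists (fine (nsum (a ^~ j))) => //; exact: sum_le_fine.
exists (fun j => fine (nsum (a ^~ j))); first by move=> j; exact: sum_le_fine.
rewrite -lee_fin; apply: le_trans tot; rewrite -sumEFin.
rewrite (eq_bigr (fun j => nsum (a ^~ j))); last first.
  by move=> j _; rewrite fineK// ge0_fin_numE ?nsum_ge0.
by apply: nneseries_lim_ge => i _ _; exact: nsum_ge0.
Qed.

Lemma sum_le_fubini (a : nat -> nat -> R) (b : nat -> R) A :
  (forall i j, 0 <= a i j) -> (forall i, sum_le (a i) (b i)) -> sum_le b A ->
  exists2 b' : nat -> R, (forall j, sum_le (a ^~ j) (b' j)) & sum_le b' A.
Proof.
move=> a0 ab bA; exists (fun j => fine (nsum (a ^~ j))).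
  move=> j; apply: sum_le_fine => //.
  have [|/(_ j)[b' b'j _] _] := @sum_le_exch a A a0.
    by move=> N; exists b.
  by apply: le_lt_trans (ltry b'); apply/nsum_leP.
move=> N.
have [|_ /(_ N)[b' b'j b'A]] := @sum_le_exch a A a0; first by move=> M; exists b.
apply: le_trans b'A; apply: ler_sum => j _.
rewrite -lee_fin fineK.
  exact/nsum_leP.
rewrite ge0_fin_numE ?nsum_ge0//.
by apply: le_lt_trans (ltry (b' j)); apply/nsum_leP.
Qed.

(** Cauchy-Schwarz, with a sequence w majorized by the geometric mean of u and v in place of
    products, so that no square roots of terms appear. *)
Lemma sum_le_CS u v w A B : (forall i, 0 <= u i) -> (forall i, 0 <= v i) ->
  (forall i, 0 <= w i) -> (forall i, w i ^+ 2 <= u i * v i) ->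
  sum_le u A -> sum_le v B -> forall N, (\sum_(0 <= i < N) w i) ^+ 2 <= A * B.
Proof.
move=> u0 v0 w0 wuv uA vB N.
apply: (@le_trans _ _ ((\sum_(0 <= i < N) u i) * \sum_(0 <= i < N) v i)); last first.
  by apply: ler_pM; rewrite ?sumr_ge0.
elim: N => [|N IH]; first by rewrite !big_geq// mulr0 expr0n.
rewrite !big_nat_recr//=.
set S := \sum_(_ <= _ < _) w _; set U := \sum_(_ <= _ < _) u _ in IH *.
set V := \sum_(_ <= _ < _) v _ in IH *.
have S0 : 0 <= S by rewrite sumr_ge0.
have U0 : 0 <= U by rewrite sumr_ge0.
have V0 : 0 <= V by rewrite sumr_ge0.
(* Arithmetic and geometric means of U v_N and u_N V, whose product bounds (S w_N)^2. *)
have H : 2 * (S * w N) <= U * v N + u N * V.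
  rewrite -ler_sqr ?nnegrE ?mulr_ge0 ?addr_ge0 ?mulr_ge0//.
  have H1 : (S * w N) ^+ 2 <= (U * V) * (u N * v N).
    by rewrite exprMn; apply: ler_pM; rewrite ?sqr_ge0.
  have -> : (U * v N + u N * V) ^+ 2 =
    (U * v N - u N * V) ^+ 2 + 4 * ((U * V) * (u N * v N)) by ring.
  rewrite exprMn -natrX.
  have := sqr_ge0 (U * v N - u N * V); lra.
have -> : (S + w N) ^+ 2 = S ^+ 2 + 2 * (S * w N) + w N ^+ 2 by ring.
have -> : (U + u N) * (V + v N) = U * V + (U * v N + u N * V) + u N * v N by ring.
by rewrite !lerD.
Qed.

Lemma sum_le_sqrt u v w A B : (forall i, 0 <= u i) -> (forall i, 0 <= v i) ->
  (forall i, 0 <= w i) -> (forall i, w i ^+ 2 <= u i * v i) ->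
  sum_le u A -> sum_le v B -> sum_le w (Num.sqrt (A * B)).
Proof.
move=> u0 v0 w0 wuv uA vB N; rewrite -(ger0_norm (sumr_ge0 _ _)); last first.
  by move=> i _; exact: w0.
by rewrite -sqrtr_sqr ler_wsqrtr// (sum_le_CS (u:=u) (v:=v)).
Qed.

Lemma sum_le_shift u A : (forall i, 0 <= u i) -> sum_le u A -> sum_le (fun i => u i.+1) A.
Proof.
move=> u0 uA N; apply: le_trans (uA N.+1).
by rewrite [leRHS]big_nat_recl//= lerDr.
Qed.

End nonneg_series.

(** * Absolutely convergent complex series *)

Section complex_series.
Variable R : realType.
Local Notation C := R[i].
Implicit Types (u v : nat -> C) (z : C).

Lemma normcE z : (normc z)%:C = `|z|.
Proof. by []. Qed.

Lemma normc_real (x : R) : normc x%:C = `|x|.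
Proof. by rewrite /normc/= expr0n/= addr0 sqrtr_sqr. Qed.

Lemma normc_sum I (r : seq I) (P : pred I) (F : I -> C) :
  normc (\sum_(i <- r | P i) F i) <= \sum_(i <- r | P i) normc (F i).
Proof.
elim/big_rec2: _ => [|i x y _ yx]; first by rewrite normc0.
by rewrite (le_trans (le_normcD _ _))// lerD2l.
Qed.

Lemma normcX z n : normc (z ^+ n) = normc z ^+ n.
Proof. by elim: n => [|n IH]; rewrite ?normc1// !exprS normcM IH. Qed.

Lemma le_Re_normc z : `|complex.Re z| <= normc z.
Proof.
by case: z => a b; rewrite /= -sqrtr_sqr ler_wsqrtr// lerDl sqr_ge0.
Qed.

Lemma le_Im_normc z : `|complex.Im z| <= normc z.
Proof.
by case: z => a b; rewrite /= -sqrtr_sqr ler_wsqrtr// lerDr sqr_ge0.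
Qed.

Lemma normc_le_ReIm z : normc z <= `|complex.Re z| + `|complex.Im z|.
Proof.
case: z => a b; rewrite /= -[leRHS]ger0_norm ?addr_ge0//.
rewrite -sqrtr_sqr ler_wsqrtr// sqrrD !real_normK ?num_real//.
by rewrite lerD2r lerDl mulrn_wge0// mulr_ge0.
Qed.

(** The norm of [R[i]] takes its values in [R[i]], where 0 < e forces e to be real; convergence is
    restated here with real tolerances. *)
Lemma cvgCP (s : nat -> C) z : s @ \oo --> z <->
  forall e : R, 0 < e -> exists N, forall n, (N <= n)%N -> normc (z - s n) <= e.
Proof.
split=> [/cvgrPdist_le cs e e0|cs].
  have /cs[N _ NP] : 0 < e%:C by rewrite ltcR.
  by exists N => n Nn; rewrite -lecR normcE; exact: NP.
apply/cvgrPdist_le => e e0.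
have eE : e = (complex.Re e)%:C.
  by apply/esym/eqP; rewrite eq_complex/= eqxx/= eq_sym; case: e e0 => a b /=;
    rewrite ltcE/= => /andP[/eqP->].
have [N NP] : exists N, forall n, (N <= n)%N -> normc (z - s n) <= complex.Re e.
  by apply: cs; rewrite -ltcR -eE.
exists N => // n /= Nn; rewrite eE -normcE lecR; exact: NP.
Qed.

Lemma cvgC_lim (s : nat -> C) z : s @ \oo --> z -> limn s = z.
Proof. by apply: cvg_lim; exact: norm_hausdorff. Qed.

Definition csum u : C := \big[+%R/0]_(0 <= n <oo) u n.

Definition abs_le u (B : R) := sum_le (fun i => normc (u i)) B.

Lemma csum_lim u z : (fun N => \sum_(0 <= i < N) u i) @ \oo --> z -> csum u = z.
Proof. by move=> /cvgC_lim. Qed.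

Lemma eq_csum u v : u =1 v -> csum u = csum v.
Proof. by move=> /funext ->. Qed.

Lemma eq_abs_le u v B : u =1 v -> abs_le u B -> abs_le v B.
Proof. by move=> /funext ->. Qed.

Lemma real_series_cvg (f : nat -> R) (B : R) : sum_le (fun i => `|f i|) B ->
  cvgn (series f).
Proof.
move=> fB; apply: normed_cvg; apply: nondecreasing_is_cvgn.
  by apply: nondecreasing_series => n _ _ /=; exact: normr_ge0.
exists B => _ [N _ <-]; exact: fB.
Qed.

Lemma Re_sum I (r : seq I) (P : pred I) (F : I -> C) :
  complex.Re (\sum_(i <- r | P i) F i) = \sum_(i <- r | P i) complex.Re (F i).
Proof. exact: (raddf_sum (@complex.Re R)). Qed.

Lemma Im_sum I (r : seq I) (P : pred I) (F : I -> C) :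
  complex.Im (\sum_(i <- r | P i) F i) = \sum_(i <- r | P i) complex.Im (F i).
Proof. exact: (raddf_sum (@complex.Im R)). Qed.

Lemma csum_cvg u B : abs_le u B ->
  (fun N => \sum_(0 <= i < N) u i) @ \oo --> csum u.
Proof.
move=> uB.
have cRe : cvgn (series (fun i => complex.Re (u i))).
  by apply: (@real_series_cvg _ B); apply: le_sum_le uB => i; exact: le_Re_normc.
have cIm : cvgn (series (fun i => complex.Im (u i))).
  by apply: (@real_series_cvg _ B); apply: le_sum_le uB => i; exact: le_Im_normc.
set a := limn _ in cRe; set b := limn _ in cIm.
suff cz : (fun N => \sum_(0 <= i < N) u i) @ \oo --> a +i* b.
  by rewrite (csum_lim cz).
apply/cvgCP => e e0; have e20 : 0 < e / 2 by rewrite divr_gt0.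
move/cvgrPdist_le : cRe => /(_ _ e20)[N1 _ N1P].
move/cvgrPdist_le : cIm => /(_ _ e20)[N2 _ N2P].
exists (maxn N1 N2) => n; rewrite geq_max => /andP[n1 n2].
rewrite (le_trans (normc_le_ReIm _))// [leRHS]splitr.
have := N1P _ n1; have := N2P _ n2; rewrite !seriesEnat/= => h2 h1.
have -> : complex.Re (a +i* b - \sum_(0 <= i < n) u i) =
  a - \sum_(0 <= i < n) complex.Re (u i).
  by rewrite -Re_sum; case: (\sum_(0 <= i < n) u i).
have -> : complex.Im (a +i* b - \sum_(0 <= i < n) u i) =
  b - \sum_(0 <= i < n) complex.Im (u i).
  by rewrite -Im_sum; case: (\sum_(0 <= i < n) u i).
exact: lerD.
Qed.

Lemma cvgC_norm_le (s : nat -> C) z B (N0 : nat) : s @ \oo --> z ->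
  (forall n, (N0 <= n)%N -> normc (s n) <= B) -> normc z <= B.
Proof.
move=> /cvgCP sz sB; apply/ler_addgt0Pr => e e0.
have [N NP] := sz _ e0.
rewrite -(subrK (s (maxn N0 N)) z) (le_trans (le_normcD _ _))// addrC lerD//.
  by rewrite sB// leq_maxl.
by rewrite NP// leq_maxr.
Qed.

Lemma norm_csum u B : abs_le u B -> normc (csum u) <= B.
Proof.
move=> uB; apply: (cvgC_norm_le (N0 := 0%N) (csum_cvg uB)) => n _.
exact: le_trans (normc_sum _ _ _) (uB n).
Qed.

Lemma abs_leD u v A B : abs_le u A -> abs_le v B ->
  abs_le (fun i => u i + v i) (A + B).
Proof.
move=> uA vB; apply: le_sum_le (sum_leD uA vB) => i; exact: le_normcD.
Qed.

Lemma abs_leZ u B z : abs_le u B -> abs_le (fun i => z * u i) (normc z * B).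
Proof.
move=> uB; apply: le_sum_le (sum_leZ (normc_ge0 z) uB) => i.
by rewrite normcM.
Qed.

Lemma csumD u v A B : abs_le u A -> abs_le v B ->
  csum (fun i => u i + v i) = csum u + csum v.
Proof.
move=> uA vB; apply: csum_lim.
rewrite (_ : (fun _ => _) = (fun N => \sum_(0 <= i < N) u i) \+
   (fun N => \sum_(0 <= i < N) v i)).
  by apply: cvgD; apply: csum_cvg; eassumption.
by apply/funext => N /=; rewrite big_split.
Qed.

Lemma csumZ u B z : abs_le u B -> csum (fun i => z * u i) = z * csum u.
Proof.
move=> uB; apply: csum_lim.
apply/cvgCP => e e0.
have /cvgCP cu := csum_cvg uB.
have [|N NP] := cu (e / (normc z + 1)).
  by rewrite divr_gt0// ltr_wpDl// normc_ge0.
exists N => n Nn; rewrite -mulr_sumr -mulrBr normcM.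
have h : 0 < normc z + 1 by rewrite ltr_wpDl// normc_ge0.
apply: le_trans (_ : (normc z + 1) * (e / (normc z + 1)) <= _).
  by apply: ler_pM; rewrite ?normc_ge0// ?NP// lerDl.
by rewrite mulrC divfK// gt_eqF.
Qed.

Lemma abs_le0 : abs_le (fun=> 0) 0.
Proof. by move=> N; rewrite big1// => i _; rewrite normc0. Qed.

Lemma csum_fin u N : (forall i, (N <= i)%N -> u i = 0) ->
  csum u = \sum_(0 <= i < N) u i.
Proof.
move=> uN; apply: csum_lim; apply/cvgCP => e e0; exists N => n Nn.
have -> : \sum_(0 <= i < n) u i = \sum_(0 <= i < N) u i.
  rewrite (big_cat_nat (n := N))//= [X in _ + X]big_nat_cond.
  by rewrite [X in _ + X]big1 ?addr0// => i /andP[/andP[+ _] _]; exact: uN.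
by rewrite subrr normc0 ltW.
Qed.

Lemma csum1 u k : (forall i, i != k -> u i = 0) -> csum u = u k.
Proof.
move=> uk; rewrite (@csum_fin _ k.+1); last first.
  by move=> i ki; rewrite uk// gtn_eqF.
rewrite big_nat_recr//= big_nat_cond big1 ?add0r// => i /andP[/andP[_ ik] _].
by rewrite uk// ltn_eqF.
Qed.

Lemma csum0 : csum (fun=> 0) = 0.
Proof. by rewrite (@csum_fin _ 0%N)// big_geq. Qed.

Lemma abs_le_fin u N : (forall i, (N <= i)%N -> u i = 0) ->
  abs_le u (\sum_(0 <= i < N) normc (u i)).
Proof.
by move=> uN; apply: sum_le_fin => i; rewrite ?normc_ge0// => /uN ->; rewrite normc0.
Qed.

Lemma abs_le1 u k : (forall i, i != k -> u i = 0) -> abs_le u (normc (u k)).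
Proof.
move=> uk; have := @abs_le_fin u k.+1; rewrite big_nat_recr//= big_nat_cond.
rewrite big1 ?add0r; last first.
  by move=> i /andP[/andP[_ ik] _]; rewrite uk ?normc0// ltn_eqF.
by apply=> i ki; rewrite uk// gtn_eqF.
Qed.

Lemma csum_sum (I : Type) (r : seq I) (F : I -> nat -> C) :
  (forall i, exists B, abs_le (F i) B) ->
  csum (fun n => \sum_(i <- r) F i n) = \sum_(i <- r) csum (F i).
Proof.
move=> FB; elim: r => [|i r IH].
  by rewrite big_nil -[RHS]csum0; apply: eq_csum => n; rewrite big_nil.
have [A FA] := FB i.
have [B FrB] : exists B, abs_le (fun n => \sum_(i <- r) F i n) B.
  elim: r {IH} => [|j r [B IH]].
    by exists 0; apply: eq_abs_le abs_le0 => n; rewrite big_nil.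
  have [B' FB'] := FB j; exists (B' + B).
  by apply: eq_abs_le (abs_leD FB' IH) => n; rewrite big_cons.
rewrite big_cons -IH -(csumD FA FrB); apply: eq_csum => n.
by rewrite big_cons.
Qed.

Lemma le_abs_le u v B : (forall i, normc (u i) <= normc (v i)) ->
  abs_le v B -> abs_le u B.
Proof. by move=> uv; exact: le_sum_le. Qed.

Lemma sum_le_tail (b : nat -> R) A (e : R) : (forall i, 0 <= b i) ->
  sum_le b A -> 0 < e -> exists N0, forall N M, (N0 <= N)%N ->
  \sum_(N <= i < M) b i <= e.
Proof.
move=> b0 bA e0.
have cb : cvgn (series b).
  by apply: (@real_series_cvg _ A); apply: le_sum_le bA => i; rewrite ger0_norm.
move/cauchy_cvgP/cauchy_seriesP : cb => /(_ _ e0)[[X Y] /= [[a _ aX] [c _ cY]] XY].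
exists (maxn a c) => N M; rewrite geq_max => /andP[aN cN].
have [NM|/ltnW MN] := leqP N M; last by rewrite big_geq// ltW.
have := XY (N, M); rewrite /= => /(_ _)/ltW h.
apply: le_trans (h _); first by rewrite ler_norm.
split; [exact: aX|exact/cY/(leq_trans cN)].
Qed.

(** After n rows the error is the double sum of the remaining rows, whose absolute mass is at most a
    tail of the series of b. *)
Lemma csum_fubini (a : nat -> nat -> C) (b : nat -> R) A :
  (forall i, abs_le (a i) (b i)) -> sum_le b A ->
  [/\ csum (fun i => csum (a i)) = csum (fun j => csum (a ^~ j)),
      abs_le (fun i => csum (a i)) A &
      exists2 b', (forall j, abs_le (a ^~ j) (b' j)) & sum_le b' A].
Proof.
move=> ab bA.
have [b' ab' b'A] := @sum_le_fubini R (fun i j => normc (a i j)) b A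
  (fun i j => normc_ge0 _) ab bA.
have rA : abs_le (fun i => csum (a i)) A.
  by apply: le_sum_le bA => i; exact: norm_csum.
have cA : abs_le (fun j => csum (a ^~ j)) A.
  by apply: le_sum_le b'A => j; apply: norm_csum; exact: ab'.
split => //; last by exists b'.
apply: csum_lim; apply/cvgCP => e e0.
have b0 i : 0 <= b i by exact: sum_le_ge0 (ab i).
have [N NP] := sum_le_tail b0 bA e0.
exists N => n Nn.
have -> : \sum_(0 <= i < n) csum (a i) = csum (fun j => \sum_(0 <= i < n) a i j).
  by rewrite csum_sum// => i; exists (b i).
(* The rows from n on; their absolute sums are bounded by [b1], of total at most e. *)
pose a' i j := if (i < n)%N then 0 else a i j.
pose b1 i := if (i < n)%N then 0 else b i.
have a'b1 i : abs_le (a' i) (b1 i).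
  by rewrite /a' /b1; case: ifP => // _; exact: abs_le0.
have b1e : sum_le b1 e.
  move=> M; apply: le_trans (NP n M Nn); have [nM|/ltnW Mn] := leqP n M.
    rewrite (big_cat_nat (n := n))//= big_nat_cond big1 ?add0r.
      by rewrite big_nat_cond [leRHS]big_nat_cond; apply: ler_sum => i
        /andP[/andP[ni _] _]; rewrite /b1 ltnNge ni.
    by move=> i /andP[/andP[_ ni] _]; rewrite /b1 ni.
  rewrite big_nat_cond big1 ?sumr_ge0// => i /andP[/andP[_ ni] _].
  by rewrite /b1 (leq_trans ni Mn).
have [b2 a'b2 b2e] := @sum_le_fubini R (fun i j => normc (a' i j)) b1 e
  (fun i j => normc_ge0 _) a'b1 b1e.
have -> : csum (fun j => csum (a ^~ j)) - csum (fun j => \sum_(0 <= i < n) a i j) =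
    csum (fun j => csum (a' ^~ j)).
  have absn : abs_le (fun j => csum (a' ^~ j)) e.
    by apply: le_sum_le b2e => j; apply: norm_csum; exact: a'b2.
  have absn' : abs_le (fun j => \sum_(0 <= i < n) a i j) (\sum_(0 <= i < n) b i).
    move=> M.
    apply: le_trans (_ : \sum_(0 <= j < M) \sum_(0 <= i < n) normc (a i j) <= _).
      by apply: ler_sum => j _; exact: normc_sum.
    by rewrite exchange_big/=; apply: ler_sum => i _; exact: ab.
  apply/eqP; rewrite subr_eq -(csumD absn absn'); apply/eqP/eq_csum => j.
  rewrite (_ : \sum_(0 <= i < n) a i j =
      csum (fun i => if (i < n)%N then a i j else 0)); last first.
    rewrite (@csum_fin _ n); last by move=> i; rewrite leqNgt => /negbTE ->.
    by rewrite big_nat_cond [RHS]big_nat_cond; apply: eq_bigr => i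
      /andP[/andP[_ ->] _].
  rewrite -(csumD (a'b2 j) (le_abs_le _ (ab' j))); last first.
    by move=> i; case: ifP; rewrite ?normc0 ?normc_ge0.
  by apply: eq_csum => i; rewrite /a'; case: ifP; rewrite ?add0r ?addr0.
apply: norm_csum; apply: le_sum_le b2e => j; apply: norm_csum; exact: a'b2.
Qed.

End complex_series.

(** * The complex exponential as a power series *)

Section complex_exponential.
Variable R : realType.
Local Notation C := R[i].
Implicit Types (u v : nat -> C) (z w : C) (x y : R).

Lemma csum_ReIm (f g : nat -> R) x y :
  series f @ \oo --> x -> series g @ \oo --> y ->
  csum (fun k => f k +i* g k) = x +i* y.
Proof.
move=> /cvgrPdist_le fx /cvgrPdist_le gy; apply: csum_lim; apply/cvgCP => e e0.
have e20 : 0 < e / 2 by rewrite divr_gt0.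
have [N1 _ N1P] := fx _ e20; have [N2 _ N2P] := gy _ e20.
exists (maxn N1 N2) => n; rewrite geq_max => /andP[n1 n2].
rewrite (le_trans (normc_le_ReIm _))// [leRHS]splitr.
have := N1P _ n1; have := N2P _ n2; rewrite !seriesEnat/= => h2 h1.
have -> : complex.Re (x +i* y - \sum_(0 <= i < n) (f i +i* g i)) =
  x - \sum_(0 <= i < n) f i.
  have := Re_sum (index_iota 0 n) xpredT (fun i => f i +i* g i).
  by case: (\sum_(0 <= i < n) (f i +i* g i)) => a b /= ->.
have -> : complex.Im (x +i* y - \sum_(0 <= i < n) (f i +i* g i)) =
  y - \sum_(0 <= i < n) g i.
  have := Im_sum (index_iota 0 n) xpredT (fun i => f i +i* g i).
  by case: (\sum_(0 <= i < n) (f i +i* g i)) => a b /= ->.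
exact: lerD.
Qed.

Lemma csum_real (f : nat -> R) x : series f @ \oo --> x ->
  csum (fun k => (f k)%:C) = x%:C.
Proof.
move=> fx; apply: (@csum_ReIm f (fun=> 0)) => //.
rewrite (_ : series _ = fun=> 0); first exact: cvg_cst.
by apply/funext => n; rewrite /series/= big1.
Qed.

Lemma shift_sum (V : nmodType) (f : nat -> V) i n :
  \sum_(0 <= k < n) (if (i <= k)%N then f (k - i)%N else 0) =
  \sum_(0 <= k < n - i) f k.
Proof.
have [ni|/ltnW ni] := leqP n i.
  rewrite (eqP ni) [RHS]big_geq// big_nat_cond big1// => k /andP[/andP[_ kn] _].
  by rewrite leqNgt (leq_trans kn ni).
rewrite (big_cat_nat (n := i))//= big_nat_cond big1 ?add0r; last first.
  by move=> k /andP[/andP[_ ki] _]; rewrite leqNgt ki.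
rewrite -{1}(add0n i) big_addn; apply: eq_bigr => k _.
by rewrite leq_addl addnK.
Qed.

Lemma csum_shift v B i : abs_le v B ->
  csum (fun k => if (i <= k)%N then v (k - i)%N else 0) = csum v /\
  abs_le (fun k => if (i <= k)%N then v (k - i)%N else 0) B.
Proof.
move=> vB; split; last first.
  move=> N; apply: le_trans (vB (N - i)%N); rewrite -shift_sum.
  by apply: ler_sum => k _; case: ifP => //; rewrite normc0.
apply: csum_lim; apply/cvgCP => e e0; have /cvgCP/(_ _ e0)[N NP] := csum_cvg vB.
exists (N + i)%N => n Nn; rewrite shift_sum; apply: NP.
by rewrite leq_subRL ?(leq_trans _ Nn) ?leq_addl// addnC.
Qed.

Definition cexp_coeff z k : C := z ^+ k / k`!%:R.

Lemma normc_nat n : normc (n%:R : C) = n%:R.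
Proof. by rewrite -(rmorph_nat (real_complex R)) normc_real ger0_norm. Qed.

Lemma normc_cexp_coeff z k : normc (cexp_coeff z k) = exp_coeff (normc z) k.
Proof. by rewrite /cexp_coeff normcM normcX normcV normc_nat. Qed.

Lemma sum_le_expR x : 0 <= x -> sum_le (exp_coeff x) (expR x).
Proof.
move=> x0 N; have := nondecreasing_cvgn_le (u_ := series (exp_coeff x)).
move=> /(_ _ (is_cvg_series_exp_coeff x) N); apply.
by apply: nondecreasing_series => n _ _; exact: exp_coeff_ge0.
Qed.

Lemma abs_le_cexp_coeff z : abs_le (cexp_coeff z) (expR (normc z)).
Proof.
apply: (le_sum_le _ (sum_le_expR (normc_ge0 z))) => i.
by rewrite normc_cexp_coeff.
Qed.

(** Cauchy product as a double series: row i is the series of w shifted by i and multiplied by z^i /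
    i!, and the columns are binomial expansions. *)
Lemma csum_cexpD z w :
  csum (cexp_coeff (z + w)) = csum (cexp_coeff z) * csum (cexp_coeff w).
Proof.
pose a i k : C := if (i <= k)%N then cexp_coeff z i * cexp_coeff w (k - i)%N else 0.
have aE i : a i = (fun k => cexp_coeff z i *
    (if (i <= k)%N then cexp_coeff w (k - i)%N else 0)).
  by apply/funext => k; rewrite /a; case: ifP; rewrite ?mulr0.
have ab i : abs_le (a i) (normc (cexp_coeff z i) * expR (normc w)).
  rewrite aE; apply: abs_leZ.
  by have [] := csum_shift i (abs_le_cexp_coeff w).
have [|+ _ _] := csum_fubini (A := expR (normc w) * expR (normc z)) ab.
  apply: (le_sum_le _ (sum_leZ (expR_ge0 _) (abs_le_cexp_coeff z))) => i.
  by rewrite mulrC.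
rewrite (_ : (fun i => csum (a i)) = fun i => csum (cexp_coeff w) * cexp_coeff z i).
  rewrite (csumZ _ (abs_le_cexp_coeff z)) mulrC => ->; apply: eq_csum => k.
  rewrite (@csum_fin _ _ k.+1); last by move=> i ki; rewrite /a leqNgt ki.
  rewrite /cexp_coeff addrC exprDn mulr_suml big_mkord; apply: eq_bigr => i _.
  rewrite /a -ltnS ltn_ord /cexp_coeff -mulr_natl.
  have ik : (i <= k)%N by rewrite -ltnS.
  have fk : (k`!%:R : C) != 0 by rewrite pnatr_eq0 -lt0n fact_gt0.
  have fi : (i`!%:R : C) != 0 by rewrite pnatr_eq0 -lt0n fact_gt0.
  have fki : ((k - i)`!%:R : C) != 0 by rewrite pnatr_eq0 -lt0n fact_gt0.
  have := bin_fact ik => /(congr1 (fun n => n%:R : C)); rewrite !natrM => H.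
  apply: (mulIf fk); rewrite divfK// -H; field.
  by rewrite fi fki.
apply/funext => i; rewrite aE.
have [H1 H2] := csum_shift i (abs_le_cexp_coeff w).
by rewrite (csumZ _ H2) H1 mulrC.
Qed.

(** The two components have the shape of the coefficients that define [cos] and [sin]. *)
Lemma imaginary_expr n : ('i%C : C) ^+ n =
  ((~~ odd n)%:R * (-1) ^+ n./2) +i* ((odd n)%:R * (-1) ^+ n.-1./2).
Proof.
rewrite -{1}(odd_double_half n) -muln2 mulnC exprD exprM sqr_i.
have -> : (-1 : C) ^+ n./2 = ((-1) ^+ n./2)%:C.
  by rewrite rmorphXn/= rmorphN1.
case: (boolP (odd n)) => on.
  have -> : n.-1./2 = n./2.
    by rewrite -[in LHS](odd_double_half n) on add1n/= doubleK.
  by rewrite expr1; apply/eqP; rewrite eq_complex/= !mul0r !mul1r subr0 add0r !eqxx.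
by rewrite expr0 mul1r /real_complex_def !mul1r !mul0r.
Qed.

(** Besides the addition formula for [cexp], this provides the expansion of n^(-w(s)) in powers of
    w(s). *)
Lemma cexp_csum z : csum (cexp_coeff z) = cexp z.
Proof.
have -> : z = (complex.Re z)%:C + 'i%C * (complex.Im z)%:C.
  by case: z => a b; apply/eqP; rewrite eq_complex/= !mul0r !mulr0 !mul1r !subr0 !(addr0, add0r) !eqxx.
rewrite csum_cexpD.
set x := complex.Re z; set y := complex.Im z.
have -> : csum (cexp_coeff x%:C) = (expR x)%:C.
  rewrite -(csum_real (is_cvg_series_exp_coeff x)); apply: eq_csum => k.
  by rewrite /cexp_coeff /exp_coeff/= rmorphM rmorphXn/= fmorphV rmorph_nat.
have -> : csum (cexp_coeff ('i%C * y%:C)) = cos y +i* sin y.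
  have -> : cos y = limn (series (cos_coeff y)) by rewrite unlock.
  have -> : sin y = limn (series (sin_coeff y)) by rewrite unlock.
  rewrite -(csum_ReIm (@is_cvg_series_cos_coeff R y) (@is_cvg_series_sin_coeff R y)).
  apply: eq_csum => k.
  rewrite /cexp_coeff exprMn imaginary_expr -rmorphXn/= -(rmorph_nat (real_complex R)).
  rewrite -fmorphV/= -mulrA -rmorphM/= /cos_coeff /sin_coeff/=.
  by apply/eqP; rewrite eq_complex/= !mulr0 subr0 add0r !mulrA !eqxx.
by rewrite /cexp/=; congr ((expR _)%:C * (cos _ +i* sin _));
  rewrite !(mul0r, mulr0, mul1r, subr0, addr0, add0r).
Qed.

Lemma cexpD z w : cexp (z + w) = cexp z * cexp w.
Proof. by rewrite -!cexp_csum csum_cexpD. Qed.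

Lemma normc_cexp z : normc (cexp z) = expR (complex.Re z).
Proof.
rewrite /cexp normcM normc_real (ger0_norm (expR_ge0 _)) /=.
by rewrite cos2Dsin2 sqrtr1 mulr1.
Qed.

Lemma cexp0 : cexp (0 : C) = 1.
Proof. by rewrite /cexp/= expR0 cos0 sin0 mul1r. Qed.

Lemma cexp_real x : cexp x%:C = (expR x)%:C.
Proof. by rewrite /cexp/= cos0 sin0 mulr1. Qed.

Lemma npow1 z : npow 1 z = 1.
Proof. by rewrite /npow ln1 mulr0 cexp0. Qed.

Lemma npowM m n z : (0 < m)%N -> (0 < n)%N ->
  npow (m * n) z = npow m z * npow n z.
Proof.
by move=> m0 n0; rewrite /npow natrM lnM ?posrE ?ltr0n// rmorphD mulrDr cexpD.
Qed.

Lemma normc_npow n z : normc (npow n z) = expR (complex.Re z * ln n%:R).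
Proof. by rewrite normc_cexp; case: z => a b /=; rewrite mulr0 subr0. Qed.

End complex_exponential.

(** * Poisson weights: sums over ln n, negative moments, local bounds, Hellinger affinity *)

Section poisson.
Variable R : realType.
Implicit Types (x y h r : R) (m k n e : nat).

Definition pois m x : R := expR (- x) * x ^+ m / m`!%:R.

Lemma fact_neq0 n : n`!%:R != 0 :> R.
Proof. by rewrite pnatr_eq0 -lt0n fact_gt0. Qed.

Lemma pois_ge0 m x : 0 <= x -> 0 <= pois m x.
Proof. by move=> x0; rewrite /pois divr_ge0// mulr_ge0 ?expR_ge0 ?exprn_ge0. Qed.

Lemma poisE m x : pois m x = expR (- x) * exp_coeff x m.
Proof. by rewrite /pois -mulrA. Qed.

Lemma sum_le_pois x : 0 <= x -> sum_le (pois ^~ x) 1.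
Proof.
move=> x0; apply: (le_sum_le _ (sum_le_trans _ (sum_leZ (expR_ge0 (- x)) (sum_le_expR x0)))).
  by move=> i; rewrite poisE.
by rewrite mulrC expRxMexpNx_1.
Qed.

Lemma pois_le1 m x : 0 <= x -> pois m x <= 1.
Proof.
by move=> x0; apply: (le_term_sum_le _ _ (sum_le_pois x0)) => i; exact: pois_ge0.
Qed.

Lemma poisS m x : pois m.+1 x * m.+1%:R = pois m x * x.
Proof.
rewrite /pois factS natrM exprSr; field.
by rewrite fact_neq0 addrC natr1 pnatr_eq0.
Qed.

Lemma poisD m x h : pois m (x + h) = \sum_(0 <= i < m.+1) pois i x * pois (m - i) h.
Proof.
rewrite /pois opprD expRD addrC exprDn big_mkord mulr_sumr mulr_suml.
apply: eq_bigr => i _.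
have im : (i <= m)%N by rewrite -ltnS.
rewrite -mulr_natl; have := bin_fact im => /(congr1 (fun n => n%:R : R)).
rewrite !natrM => H; apply: (mulIf (fact_neq0 m)); rewrite divfK ?fact_neq0//.
by rewrite -H; field; rewrite !fact_neq0.
Qed.

Lemma shift_sum_pois_le (i m : nat) h : 0 <= h ->
  \sum_(0 <= j < m) (if (i <= j)%N then pois (j - i) h else 0) <= 1.
Proof.
by move=> h0; rewrite (shift_sum (fun k => pois k h)); exact: sum_le_pois.
Qed.

(* If N_x is a Poisson process, this is P(N_x <= m < N_(x+h)) >= P(N_x = m, N_(x+h) > m). *)
Lemma pois_cdf_drop m x h : 0 <= x -> 0 <= h ->
  pois m x * (1 - expR (- h)) <=
  \sum_(0 <= j < m.+1) pois j x - \sum_(0 <= j < m.+1) pois j (x + h).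
Proof.
move=> x0 h0; rewrite lerBrDr.
have -> : \sum_(0 <= j < m.+1) pois j (x + h) = \sum_(0 <= i < m.+1) pois i x *
    \sum_(0 <= j < m.+1) (if (i <= j)%N then pois (j - i) h else 0).
  under eq_bigr do rewrite poisD.
  transitivity (\sum_(0 <= j < m.+1) \sum_(0 <= i < m.+1)
     pois i x * (if (i <= j)%N then pois (j - i) h else 0)).
    rewrite big_nat_cond [RHS]big_nat_cond; apply: eq_bigr => j /andP[/andP[_ jm] _].
    rewrite [RHS](big_cat_nat (n := j.+1))//= [X in _ = _ + X]big_nat_cond.
    rewrite [X in _ = _ + X]big1 ?addr0; last first.
      by move=> i /andP[/andP[ij _] _]; rewrite leqNgt ij mulr0.
    rewrite big_nat_cond [RHS]big_nat_cond; apply: eq_bigr => i /andP[/andP[_ ij] _].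
    by rewrite -ltnS ij.
  by rewrite exchange_big/=; apply: eq_bigr => i _; rewrite mulr_sumr.
rewrite [X in _ + X <= _]big_nat_recr//= [leRHS]big_nat_recr//=.
have -> : \sum_(0 <= j < m.+1) (if (m <= j)%N then pois (j - m) h else 0) = expR (- h).
  by rewrite (shift_sum (fun k => pois k h)) subSnn big_nat1 /pois fact0 divr1 expr0 mulr1.
rewrite [leLHS](_ : _ = \sum_(0 <= i < m) pois i x *
  (\sum_(0 <= j < m.+1) if (i <= j)%N then pois (j - i) h else 0) + pois m x); last by ring.
rewrite lerD2r; apply: ler_sum => i _; rewrite -[leRHS]mulr1 ler_wpM2l ?pois_ge0//.
exact: shift_sum_pois_le.
Qed.

(** The Poisson mean attached to the index n, which stands for the integer n.+1. *)
Definition logx r n : R := r * ln n.+1%:R.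

Lemma logx_ge0 r n : 0 <= r -> 0 <= logx r n.
Proof. by move=> r0; rewrite mulr_ge0// ln_ge0// ler1n. Qed.

Lemma ln_ratio_ge n : (n.+2%:R)^-1 <= ln n.+2%:R - ln n.+1%:R :> R.
Proof.
rewrite -ln_div ?posrE ?ltr0n// -[leLHS]opprK lerNl -lnV ?posrE ?divr_gt0 ?ltr0n//.
rewrite invf_div; apply: le_trans (_ : ln (1 + - n.+2%:R^-1) <= _).
  rewrite ler_ln ?posrE; last 2 first.
  - by rewrite divr_gt0 ?ltr0n.
  - by rewrite subr_gt0 invf_lt1 ?ltr0n// ltr1n.
  have n2 : n.+1%:R + 1 != 0 :> R by rewrite natr1 pnatr_eq0.
  by rewrite -(natr1 n.+1) le_eqVlt; apply/orP; left; apply/eqP; field; apply/lt0r_neq0;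
    have := ler0n R n; lra.
by apply: le_ln1Dx; rewrite ltrN2 invf_lt1 ?ltr0n// ltr1n.
Qed.

Lemma ln_ratio_le n : ln n.+2%:R - ln n.+1%:R <= (n.+1%:R)^-1 :> R.
Proof.
rewrite -ln_div ?posrE ?ltr0n//.
have -> : n.+2%:R / n.+1%:R = 1 + n.+1%:R^-1 :> R.
  by rewrite -(natr1 n.+1) mulrDl divff ?pnatr_eq0// mul1r.
by apply: le_ln1Dx; rewrite (lt_le_trans _ (_ : 0 <= _)) ?invr_ge0// ltrN10.
Qed.

(** The factor 2 bounds (n + 2)/(n + 1). The rest comes from the increments h of [logx], which lie
    between r/(n + 2) and r, so that 1 - e^(-h) >= h/(1 + r). *)
Definition CQ r : R := 2 * (1 + r) / r.

Lemma CQ_gt0 r : 0 < r -> 0 < CQ r.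
Proof. by move=> r0; rewrite divr_gt0// mulr_gt0// addr_gt0. Qed.

(** A discrete form of the fact that P_m has integral 1: up to [CQ r], each term is at most the drop
    of the Poisson distribution function G between consecutive values of [logx], and these drops
    telescope to at most 1. *)
Lemma sum_le_pois_log m r : 0 < r ->
  sum_le (fun n => pois m (logx r n) / n.+1%:R) (CQ r).
Proof.
move=> r0.
pose G x : R := \sum_(0 <= j < m.+1) pois j x.
have step n : pois m (logx r n) / n.+1%:R <=
    CQ r * (G (logx r n) - G (logx r n.+1)).
  pose h := r * (ln n.+2%:R - ln n.+1%:R).
  have h0 : 0 <= h.
    by rewrite mulr_ge0 ?(ltW r0)//; apply: le_trans (ln_ratio_ge n); rewrite invr_ge0.
  have -> : logx r n.+1 = logx r n + h by rewrite /logx /h; ring.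
  apply: le_trans (ler_wpM2l (ltW (CQ_gt0 r0)) (pois_cdf_drop m (logx_ge0 n (ltW r0)) h0)).
  rewrite mulrCA ler_wpM2l ?pois_ge0 ?logx_ge0 ?(ltW r0)//.
  have h1 : r / n.+2%:R <= h by rewrite ler_wpM2l ?(ltW r0)// ln_ratio_ge.
  have h2 : h <= r.
    rewrite -[leRHS]mulr1 ler_wpM2l ?(ltW r0)// (le_trans (ln_ratio_le _))//.
    by rewrite invf_le1 ?ltr0n// ler1n.
  have e1 : expR (- h) <= (1 + h)^-1.
    by rewrite expRN lef_pV2 ?posrE ?expR_gt0 ?expR_ge1Dx// ltr_wpDr.
  have h3 : h / (1 + r) <= 1 - expR (- h).
    apply: (@le_trans _ _ (1 - (1 + h)^-1)); last by rewrite lerD2l lerN2.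
    have -> : 1 - (1 + h)^-1 = h / (1 + h) by field; rewrite gt_eqF// ltr_wpDr.
    have r10 : 0 < 1 + r by rewrite addr_gt0.
    have h10 : 0 < 1 + h by rewrite ltr_wpDr.
    by rewrite ler_wpM2l// lef_pV2 ?posrE// lerD2l.
  apply: le_trans (ler_wpM2l (ltW (CQ_gt0 r0)) h3).
  apply: (@le_trans _ _ (2 / n.+2%:R)).
    rewrite ler_pdivlMr ?ltr0n// mulrC ler_pdivrMr ?ltr0n//.
    by rewrite -natrM ler_nat; lia.
  have -> : CQ r * (h / (1 + r)) = 2 * (h / r).
    by rewrite /CQ; field; rewrite !gt_eqF ?addr_gt0.
  by rewrite ler_wpM2l// ler_pdivlMr// mulrC.
move=> N; apply: le_trans (_ : CQ r * (G (logx r 0) - G (logx r N)) <= _).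
  elim: N => [|N IH]; first by rewrite big_geq// subrr mulr0.
  rewrite big_nat_recr//=; apply: le_trans (lerD IH (step N)) _.
  by rewrite -mulrDr addrA subrK.
rewrite -[leRHS]mulr1 ler_wpM2l ?(ltW (CQ_gt0 r0))// lerBlDr.
rewrite (le_trans (sum_le_pois (logx_ge0 0 (ltW r0)) _))// lerDl sumr_ge0// => i _.
by rewrite pois_ge0 ?logx_ge0 ?ltW.
Qed.

Lemma rising_fact_le m e : ((m + e)`! <= e`! * m.+1 ^ e * m`!)%N.
Proof.
elim: e => [|e IH]; first by rewrite addn0 fact0 expn0 !mul1n.
rewrite addnS !factS expnS.
have -> : (e.+1 * e`! * (m.+1 * m.+1 ^ e) * m`! =
  (e.+1 * m.+1) * (e`! * m.+1 ^ e * m`!))%N by lia.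
by apply: leq_mul => //; nia.
Qed.

(** For x > 1, P_i(x) x^e = P_(i+e)(x) (i+e)!/i!, and (i+e)!/i! is at most e! (i+1)^e, so the sum
    times x^e is at most e!. For x <= 1 the total Poisson mass suffices. *)
Lemma pois_neg_moment e : exists2 K : R, 0 < K & forall x, 0 <= x ->
  sum_le (fun m => pois m x / m.+1%:R ^+ e) (K / (1 + x) ^+ e).
Proof.
exists (2 ^+ e * (1 + e`!%:R)); first by rewrite mulr_gt0 ?exprn_gt0// addr_gt0 ?ltr0n ?fact_gt0.
move=> x x0 N; rewrite ler_pdivlMr ?exprn_gt0 ?ltr_wpDr//.
set S := \sum_(_ <= _ < _) _.
have S0 : 0 <= S.
  by apply: sumr_ge0 => i _; rewrite divr_ge0 ?pois_ge0 ?exprn_ge0.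
have S1 : S <= 1.
  apply: le_trans (sum_le_pois x0 N); apply: ler_sum => i _.
  rewrite ler_pdivrMr ?exprn_gt0 ?ltr0n// ler_peMr ?pois_ge0//.
  by rewrite exprn_ege1// ler1n.
have S2 : S * x ^+ e <= e`!%:R.
  rewrite mulr_suml.
  apply: (@le_trans _ _ (e`!%:R * \sum_(0 <= i < N) pois (i + e) x)); last first.
    rewrite -[leRHS]mulr1 ler_wpM2l//; apply: le_trans (sum_le_pois x0 (N + e)).
    rewrite [leRHS](big_cat_nat (n := e)) ?leq_addl//=.
    have -> : \sum_(e <= i < N + e) pois i x = \sum_(0 <= i < N) pois (i + e) x.
      by rewrite -{1}(add0n e) big_addn addnK.
    by rewrite lerDr sumr_ge0// => i _; exact: pois_ge0.
  rewrite mulr_sumr; apply: ler_sum => i _.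
  have -> : pois i x / i.+1%:R ^+ e * x ^+ e =
    pois (i + e) x * ((i + e)`!%:R / (i`!%:R * i.+1%:R ^+ e)).
    rewrite /pois exprD; field.
    by rewrite !fact_neq0 ?expf_neq0// ?pnatr_eq0//.
  rewrite mulrC ler_wpM2r ?pois_ge0// ler_pdivrMr ?mulr_gt0 ?ltr0n ?fact_gt0 ?exprn_gt0 ?ltr0n//.
  rewrite -natrX -!natrM ler_nat (leq_trans (rising_fact_le _ _))//.
  by rewrite mulnAC mulnA.
have [x1|x1] := leP x 1.
  apply: (@le_trans _ _ (1 * 2 ^+ e)).
    apply: ler_pM => //; first by rewrite exprn_ge0// addr_ge0.
    by rewrite lerXn2r ?nnegrE ?addr_ge0//; lra.
  by rewrite mul1r ler_peMr ?exprn_ge0// lerDl.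
apply: (@le_trans _ _ (S * (2 ^+ e * x ^+ e))).
  rewrite ler_wpM2l// -exprMn lerXn2r ?nnegrE ?addr_ge0 ?mulr_ge0//; lra.
rewrite mulrCA ler_wpM2l ?exprn_ge0// (le_trans S2)// lerDr//.
Qed.

(** The weights D_m decay like (m+1)^(-e/2), with e possibly odd. The integral moment gives this
    through t <= (l t^2 + 1/l)/2 with l = (1+x)^(e/2). *)
Lemma pois_half_moment e : exists2 K : R, 0 < K & forall x, 0 <= x ->
  sum_le (fun m => pois m x / Num.sqrt m.+1%:R ^+ e) (K / Num.sqrt (1 + x) ^+ e).
Proof.
have [K K0 KP] := pois_neg_moment e.
exists ((K + 1) / 2); first by rewrite divr_gt0// addr_gt0.
move=> x x0.
pose l := Num.sqrt (1 + x) ^+ e.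
have s0 : 0 < Num.sqrt (1 + x) by rewrite sqrtr_gt0 ltr_wpDr.
have l0 : 0 < l by rewrite exprn_gt0.
have l2 : l ^+ 2 = (1 + x) ^+ e by rewrite -exprM mulnC exprM sqr_sqrtr// addr_ge0.
have H := sum_leD (sum_leZ (ltW l0) (KP x x0)) (sum_leZ (ltW (_ : 0 < l^-1)) (sum_le_pois x0)).
have {}H := sum_leZ (_ : 0 <= 2^-1) (H _).
apply: le_sum_le (sum_le_trans _ (H _ _)); rewrite ?invr_gt0 ?invr_ge0//.
- move=> m; rewrite -/(pois m x).
  have p0 := pois_ge0 m x0.
  set t := (Num.sqrt m.+1%:R ^+ e)^-1.
  have -> : (m.+1%:R ^+ e)^-1 = t ^+ 2.
    by rewrite /t exprVn -exprM mulnC exprM sqr_sqrtr.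
  have -> : 2^-1 * (l * (pois m x * t ^+ 2) + l^-1 * pois m x) =
     pois m x * (2^-1 * (l * t ^+ 2 + l^-1)) by ring.
  rewrite ler_wpM2l// -subr_ge0.
  have -> : 2^-1 * (l * t ^+ 2 + l^-1) - t = 2^-1 * l^-1 * (l * t - 1) ^+ 2.
    by field; rewrite gt_eqF.
  by rewrite mulr_ge0 ?sqr_ge0// mulr_ge0 ?invr_ge0// ltW.
- rewrite -/l -l2 le_eqVlt; apply/orP; left; apply/eqP.
  by field; rewrite gt_eqF.
Qed.

(** The right side is 1 plus twice the sum of (x/2)^k over k >= 1, which dominates the exponential
    series term by term because 2^k <= 2 k!. *)
Lemma expR_le_ratio x : 0 <= x < 2 -> expR x <= (2 + x) / (2 - x).
Proof.
move=> /andP[x0 x2].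
have h2 : 0 < 2 - x by rewrite subr_gt0.
apply: limr_le; first exact: is_cvg_series_exp_coeff.
apply: nearW => N; rewrite seriesEnat/=.
pose z := x / 2.
have z0 : 0 <= z by rewrite divr_ge0.
have z1 : z < 1 by rewrite ltr_pdivrMr// mul1r.
have fz n : \sum_(0 <= k < n.+1) exp_coeff x k <= (2 + x) / (2 - x) - 2 * z ^+ n.+1 / (1 - z).
  elim: n => [|n IH].
    rewrite big_nat1 /exp_coeff/= expr0 fact0 divr1 expr1 le_eqVlt; apply/orP; left; apply/eqP.
    by rewrite /z; field; apply/lt0r_neq0.
  rewrite big_nat_recr//=; apply: le_trans (lerD IH (lexx _)) _.
  have -> : (2 + x) / (2 - x) - 2 * z ^+ n.+2 / (1 - z) =
      (2 + x) / (2 - x) - 2 * z ^+ n.+1 / (1 - z) + 2 * z ^+ n.+1.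
    by rewrite [z ^+ n.+2]exprS; field; rewrite !gt_eqF// subr_gt0.
  rewrite lerD2l.
  rewrite /exp_coeff/= /z expr_div_n mulrCA ler_wpM2l ?exprn_ge0//.
  have h : (2 ^ n.+1 <= 2 * n.+1`!)%N.
    elim: n {IH} => [//|n IH]; rewrite expnS factS mulnCA.
    by rewrite leq_mul.
  rewrite -[leLHS]div1r ler_pdivrMr ?ltr0n ?fact_gt0// mulrAC ler_pdivlMr ?exprn_gt0//.
  by rewrite mul1r -natrX -natrM ler_nat.
case: N => [|N]; first by rewrite big_geq// divr_ge0 ?(ltW h2)// addr_ge0.
rewrite (le_trans (fz _))// gerBl divr_ge0 ?mulr_ge0 ?exprn_ge0//.
by rewrite subr_ge0 ltW.
Qed.

(** In place of Stirling's formula: m P_m(m)^2 is nondecreasing in m and equals e^(-2) at m = 1. *)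
Lemma pois_diag_ge m : (0 < m)%N -> expR (-2) <= pois m m%:R ^+ 2 * m%:R.
Proof.
case: m => // m _; elim: m => [|m IH].
  by rewrite /pois expr1 mulr1 divr1 mulr1 expr2 -expRD -opprD.
apply: (le_trans IH).
set a := m.+1%:R in IH *; have a0 : 0 < a by rewrite ltr0n.
have -> : m.+2%:R = a + 1 by rewrite natr1.
have a10 : 0 < a + 1 by rewrite addr_gt0.
have -> : pois m.+2 (a + 1) = pois m.+1 a * (expR (- 1) * ((a + 1) / a) ^+ m.+1).
  rewrite /pois opprD expRD exprSr factS natrM -[m.+2%:R]natr1 -/a expr_div_n; field.
  by rewrite fact_neq0 !gt_eqF// exprn_gt0.
move: (pois m.+1 a) IH => p _.
rewrite exprMn -[leRHS]mulrA ler_wpM2l ?sqr_ge0//.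
rewrite exprMn -expRM_natl mulrN1.
rewrite -exprM -mulrA.
suff H : expR 2 <= ((a + 1) / a) ^+ (m.+1 * 2).+1.
  have -> : (((a + 1) / a) ^+ (m.+1 * 2) * (a + 1)) = ((a + 1) / a) ^+ (m.+1 * 2).+1 * a.
    by rewrite exprSr -mulrA divfK// gt_eqF.
  rewrite mulrA ler_peMl ?(ltW a0)// expRN.
  apply: (@le_trans _ _ ((expR 2)^-1 * expR 2)); first by rewrite mulVf ?expR_eq0.
  by rewrite ler_wpM2l// invr_ge0 expR_ge0.
(* With this v, (2 + v)/(2 - v) = (a + 1)/a, so the previous bound on the exponential gives e^2 <=
   ((a + 1)/a)^(2a + 1). *)
pose v := 2 / (2 * a + 1).
have d0 : 0 < 2 * a + 1 by rewrite addr_gt0// mulr_gt0.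
have -> : expR 2 = expR v ^+ (m.+1 * 2).+1.
  rewrite -expRM_natl -(natr1 (m.+1 * 2)) natrM -/a /v; congr expR; field.
  by rewrite gt_eqF.
rewrite lerXn2r ?nnegrE ?expR_ge0 ?divr_ge0 ?(ltW a0) ?(ltW a10)//.
have a1 : 1 <= a by rewrite ler1n.
have v0 : 0 <= v < 2.
  rewrite divr_ge0 ?ltW//= ltr_pdivrMr//; lra.
apply: (le_trans (expR_le_ratio v0)); rewrite le_eqVlt; apply/orP; left; apply/eqP.
by rewrite /v; field; rewrite !gt_eqF//=; lra.
Qed.

(** From 1 + u <= e^u at u = k/y - 1 follows e^(1 - k/y) <= y/k; the k-th power of this is the
    claim. *)
Lemma pois_ge_diag k y : (0 < k)%N -> 0 < y ->
  pois k k%:R * expR (- ((y - k%:R) ^+ 2 / y)) <= pois k y.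
Proof.
move=> k0 y0; rewrite /pois.
set a := k%:R; have a0 : 0 < a by rewrite ltr0n.
rewrite mulrAC ler_wpM2r ?invr_ge0//.
have H : expR (1 - a / y) <= y / a.
  rewrite -[leRHS]invf_div -[leLHS]invrK -expRN lef_pV2 ?posrE ?expR_gt0 ?divr_gt0//.
  have := expR_ge1Dx (a / y - 1); rewrite opprB; lra.
have {}H : expR (1 - a / y) ^+ k <= (y / a) ^+ k.
  by rewrite lerXn2r ?nnegrE ?expR_ge0 ?divr_ge0 ?(ltW y0) ?(ltW a0).
have -> : y ^+ k = (y / a) ^+ k * a ^+ k by rewrite -exprMn divfK// gt_eqF.
rewrite mulrA [leLHS]mulrAC ler_wpM2r ?exprn_ge0 ?(ltW a0)//.
apply: le_trans (ler_wpM2l (expR_ge0 _) H).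
rewrite -expRM_natl -!expRD ler_expR -/a le_eqVlt; apply/orP; left; apply/eqP.
by field; rewrite gt_eqF.
Qed.

Lemma pois_mode_le k y : 0 <= y -> pois k y <= pois (Num.trunc y) y.
Proof.
move=> y0; have /andP[t1 t2] := truncn_itv y0.
have up i : (i.+1%:R <= y) -> pois i y <= pois i.+1 y.
  move=> iy; rewrite -(ler_pM2r (_ : 0 < i.+1%:R)) ?ltr0n// poisS.
  by rewrite ler_wpM2l ?pois_ge0.
have down i : (y <= i.+1%:R) -> pois i.+1 y <= pois i y.
  move=> iy; rewrite -(ler_pM2r (_ : 0 < i.+1%:R)) ?ltr0n// poisS.
  by rewrite ler_wpM2l ?pois_ge0.
have t1' : forall i, (i < Num.trunc y)%N -> i.+1%:R <= y.
  by move=> i it; apply: le_trans t1; rewrite ler_nat.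
have [kt|tk] := leqP k (Num.trunc y).
  have : forall j, (j <= Num.trunc y)%N -> pois (Num.trunc y - j) y <= pois (Num.trunc y) y.
    elim=> [|j IH] jt; first by rewrite subn0.
    apply: le_trans (IH (ltnW jt)); rewrite -[X in _ <= pois X y](subnSK jt).
    by apply/up/t1'; rewrite ltn_subrL//; lia.
  by move=> /(_ (Num.trunc y - k)%N); rewrite subKn//; apply; rewrite leq_subr.
rewrite -(subnK (ltnW tk)); elim: (k - Num.trunc y)%N => [//|j IH].
rewrite addSn; apply: le_trans IH; apply: down.
by apply: le_trans (ltW t2) _; rewrite ler_nat ltnS leq_addl.
Qed.

(** The weight at the mode t is nearly repeated: for i <= sqrt y the ratios of successive weights
    from t to t + i are at least y/(y + i) >= e^(-i/y), so P_(t+i) >= P_t / e. More than sqrt y such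
    weights have sum at most 1. *)
Lemma pois_upper k y : 0 < y -> pois k y <= expR 1 / Num.sqrt y.
Proof.
move=> y0; apply: le_trans (pois_mode_le k (ltW y0)) _.
set t := Num.trunc y; have /andP[t1 t2] := truncn_itv (ltW y0).
have s0 : 0 < Num.sqrt y by rewrite sqrtr_gt0.
set L := Num.trunc (Num.sqrt y); have /andP[L1 L2] := truncn_itv (ltW s0).
have p0 m := pois_ge0 m (ltW y0).
have ratio i : pois t y * (y / (y + i%:R)) ^+ i <= pois (t + i) y.
  have yi j : 0 < y + j%:R by rewrite ltr_wpDr.
  have : forall j, (j <= i)%N -> pois t y * (y / (y + i%:R)) ^+ j <= pois (t + j) y.
    elim=> [_|j IH ji]; first by rewrite expr0 mulr1 addn0.
    rewrite addnS.
    have nj : 0 < (t + j).+1%:R :> R by rewrite ltr0n.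
    rewrite -(ler_pM2r nj) poisS.
    have yy : 0 <= y / (y + i%:R) by rewrite divr_ge0 ?(ltW y0) ?(ltW (yi _)).
    rewrite [leLHS](_ : _ = (pois t y * (y / (y + i%:R)) ^+ j) *
      (y / (y + i%:R) * (t + j).+1%:R)); last by rewrite exprSr; ring.
    apply: ler_pM; [by rewrite mulr_ge0 ?exprn_ge0|by rewrite mulr_ge0|exact/IH/ltnW|].
    rewrite mulrAC -mulrA ger_pMr// ler_pdivrMr// mul1r -addnS natrD.
    by rewrite lerD// ler_nat.
  by apply.
have bound i : (i <= L)%N -> pois t y * expR (-1) <= pois (t + i) y.
  move=> iL; apply: le_trans (ratio i); rewrite ler_wpM2l//.
  have isq : i%:R <= Num.sqrt y by apply: le_trans L1; rewrite ler_nat.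
  have yi : 0 < y + i%:R by rewrite ltr_wpDr.
  apply: (@le_trans _ _ (expR (- (i%:R / y)) ^+ i)).
    rewrite -expRM_natl ler_expR mulrN lerN2 mulrA ler_pdivrMr// mul1r.
    by rewrite -[leRHS](sqr_sqrtr (ltW y0)) expr2 ler_pM.
  rewrite lerXn2r ?nnegrE ?expR_ge0 ?divr_ge0 ?(ltW y0) ?(ltW yi)//.
  rewrite expRN -[leRHS]invf_div lef_pV2 ?posrE ?expR_gt0 ?divr_gt0//.
  by rewrite mulrDl divff ?gt_eqF// expR_ge1Dx.
have H : pois t y * expR (-1) * L.+1%:R <= 1.
  apply: le_trans (sum_le_pois (ltW y0) (t + L.+1)).
  rewrite [leRHS](big_cat_nat (n := t)) ?leq_addr//=.
  have -> : \sum_(t <= i < t + L.+1) pois i y = \sum_(0 <= i < L.+1) pois (t + i) y.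
    rewrite -{1}(add0n t) big_addn addKn; apply: eq_bigr => i _.
    by rewrite addnC.
  rewrite ler_wpDl ?sumr_ge0//.
  rewrite mulr_natr -[X in _ *+ X]subn0 -sumr_const_nat big_nat_cond [leRHS]big_nat_cond.
  by apply: ler_sum => i /andP[/andP[_ iL] _]; apply: bound.
rewrite ler_pdivlMr// -[leRHS]mul1r.
apply: le_trans (_ : pois t y * expR (-1) * L.+1%:R * expR 1 <= _); last first.
  by rewrite ler_wpM2r ?expR_ge0.
rewrite [leRHS](_ : _ = pois t y * L.+1%:R * (expR 1 * expR (-1))); last by ring.
rewrite expRxMexpNx_1 mulr1.
by rewrite ler_wpM2l// ltW.
Qed.

Lemma pois_lower k y B : (0 < k)%N -> 0 < y -> (y - k%:R) ^+ 2 <= B * y ->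
  expR (- B - 1) / Num.sqrt k%:R <= pois k y.
Proof.
move=> k0 y0 yB; apply: le_trans (pois_ge_diag k0 y0).
have kR : 0 < k%:R :> R by rewrite ltr0n.
have sk : 0 < Num.sqrt k%:R :> R by rewrite sqrtr_gt0.
have h : expR (-1) / Num.sqrt k%:R <= pois k k%:R.
  rewrite -ler_sqr ?nnegrE ?pois_ge0 ?divr_ge0 ?expR_ge0 ?(ltW sk) ?(ltW kR)//.
  rewrite expr_div_n sqr_sqrtr ?(ltW kR)// ler_pdivrMr//.
  apply: le_trans (pois_diag_ge k0).
  by rewrite -expRM_natl mulrN1.
have -> : expR (- B - 1) / Num.sqrt k%:R = (expR (-1) / Num.sqrt k%:R) * expR (- B).
  by rewrite expRD; ring.
apply: (ler_pM _ (expR_ge0 _) h); first by rewrite divr_ge0 ?expR_ge0// (ltW sk).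
by rewrite ler_expR lerN2 ler_pdivrMr.
Qed.

(** The terms are e^(-(x+y)/2) (sqrt x sqrt y)^m / m!, those of an exponential series. *)
Lemma pois_hellinger x y : 0 <= x -> 0 <= y ->
  sum_le (fun m => Num.sqrt (pois m x * pois m y))
    (expR (- ((Num.sqrt x - Num.sqrt y) ^+ 2 / 2))).
Proof.
move=> x0 y0.
have xy0 : 0 <= Num.sqrt x * Num.sqrt y by rewrite mulr_ge0.
apply: (le_sum_le _ (sum_le_trans _ (sum_leZ (expR_ge0 (- ((x + y) / 2))) (sum_le_expR xy0)))).
  move=> m; rewrite le_eqVlt; apply/orP; left; apply/eqP.
  have c0 : 0 <= expR (- ((x + y) / 2)) * exp_coeff (Num.sqrt x * Num.sqrt y) m.
    by rewrite mulr_ge0 ?expR_ge0 ?exp_coeff_ge0.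
  rewrite -[RHS](ger0_norm c0) -sqrtr_sqr; congr Num.sqrt.
  rewrite exprMn -expRM_natl /exp_coeff/= expr_div_n.
  have -> : ((Num.sqrt x * Num.sqrt y) ^+ m) ^+ 2 = x ^+ m * y ^+ m.
    by rewrite -exprM mulnC exprM [(_ * _) ^+ 2]exprMn !sqr_sqrtr// exprMn.
  rewrite /pois.
  have -> : 2 * - ((x + y) / 2) = - x + - y by field.
  by rewrite expRD; field; rewrite fact_neq0.
rewrite -expRD ler_expR sqrrB !sqr_sqrtr// le_eqVlt; apply/orP; left; apply/eqP.
by field.
Qed.

End poisson.

(** * Charlier polynomials and the expansion of Poisson weights around a mean y *)

Section charlier.
Variables (R : realType) (y : R).
Hypothesis y0 : 0 < y.
Local Notation C := R[i].
Implicit Types (f g : nat -> R) (k m K : nat) (h : R).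

(** Norms are computed below as exact values of [csum]; this leads back to bounds on partial
    sums. *)
Lemma csum_real_sum_le (u : nat -> R) (S B : R) : (forall i, 0 <= u i) ->
  sum_le u B -> csum (fun i => (u i)%:C) = S%:C -> sum_le u S.
Proof.
move=> u0 uB uS N.
have cu : cvgn (series u).
  by apply: (@real_series_cvg _ _ B); apply: le_sum_le uB => i; rewrite ger0_norm.
have : (limn (series u))%:C = S%:C by rewrite -uS; apply/esym/csum_real.
move=> /complexI <-; apply: (nondecreasing_cvgn_le (u_ := series u)) => //.
by apply: nondecreasing_series.
Qed.

(** A class stable under sums, products and shifts on which Poisson expectations converge
    absolutely; it contains the Charlier polynomials and the likelihood ratios. *)
Definition exp_growth f := exists2 b : R, 1 <= b &
  exists2 c : R, 0 <= c & forall m, `|f m| <= c * b ^+ m.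

Lemma exp_growth_cst (c : R) : exp_growth (fun=> c).
Proof. by exists 1 => //; exists `|c| => // m; rewrite expr1n mulr1. Qed.

Lemma exp_growthX (x : R) : exp_growth (fun m => x ^+ m).
Proof.
exists (1 + `|x|); first by rewrite lerDl.
by exists 1 => // m; rewrite mul1r normrX lerXn2r ?nnegrE ?addr_ge0// lerDr.
Qed.

Lemma exp_growth_nat : exp_growth (fun m => m%:R).
Proof.
exists 2; first by rewrite ler1n.
exists 1 => // m; rewrite mul1r ger0_norm// -natrX ler_nat.
by rewrite ltnW// ltn_expl.
Qed.

Lemma exp_growthM f g : exp_growth f -> exp_growth g ->
  exp_growth (fun m => f m * g m).
Proof.
move=> [b b1 [c c0 fc]] [b' b1' [c' c0' gc]].
exists (b * b'); first by rewrite mulr_ege1.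
exists (c * c'); first exact: mulr_ge0.
by move=> m; rewrite exprMn mulrACA normrM ler_pM.
Qed.

Lemma exp_growthD f g : exp_growth f -> exp_growth g ->
  exp_growth (fun m => f m + g m).
Proof.
move=> [b b1 [c c0 fc]] [b' b1' [c' c0' gc]].
have b0 : 0 <= b by apply: le_trans b1.
have b0' : 0 <= b' by apply: le_trans b1'.
exists (b * b'); first by rewrite mulr_ege1.
exists (c + c') => [|m]; first exact: addr_ge0.
rewrite (le_trans (ler_normD _ _))// mulrDl exprMn lerD//.
  by rewrite (le_trans (fc m))// ler_wpM2l// ler_peMr ?exprn_ge0// exprn_ege1.
by rewrite (le_trans (gc m))// ler_wpM2l// ler_peMl ?exprn_ge0// exprn_ege1.
Qed.

Lemma exp_growth_pred f : exp_growth f -> exp_growth (fun m => f m.-1).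
Proof.
move=> [b b1 [c c0 fc]]; exists b => //; exists c => // m.
by rewrite (le_trans (fc _))// ler_wpM2l// ler_weXn2l// leq_pred.
Qed.

Lemma exp_growthS f : exp_growth f -> exp_growth (fun m => f m.+1).
Proof.
move=> [b b1 [c c0 fc]]; exists b => //; exists (c * b) => [|m].
  by rewrite mulr_ge0// (le_trans _ b1).
by rewrite (le_trans (fc _))// exprS mulrA.
Qed.

Definition pexp f : C := csum (fun m => (pois m y * f m)%:C).

Lemma pexp_abs_le f : exp_growth f ->
  exists2 B, sum_le (fun m => pois m y * `|f m|) B &
    abs_le (fun m => (pois m y * f m)%:C) B.
Proof.
move=> [b b1 [c c0 fc]].
have b0 : 0 <= b by apply: le_trans b1.
have yb0 : 0 <= y * b by rewrite mulr_ge0// ltW.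
have H : sum_le (fun m => pois m y * `|f m|) (expR (- y) * c * expR (y * b)).
  apply: le_sum_le (sum_leZ (mulr_ge0 (expR_ge0 _) c0) (sum_le_expR yb0)) => m.
  apply: le_trans (ler_wpM2l (pois_ge0 m (ltW y0)) (fc m)) _.
  rewrite /pois /exp_coeff/= exprMn le_eqVlt; apply/orP; left; apply/eqP; ring.
exists (expR (- y) * c * expR (y * b)) => //; apply: le_sum_le H => m.
by rewrite normc_real normrM (ger0_norm (pois_ge0 _ (ltW y0))).
Qed.

Lemma pexpD f g : exp_growth f -> exp_growth g ->
  pexp (fun m => f m + g m) = pexp f + pexp g.
Proof.
move=> /pexp_abs_le[A _ fA] /pexp_abs_le[B _ gB].
by rewrite /pexp -(csumD fA gB); apply: eq_csum => m; rewrite mulrDr rmorphD.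
Qed.

Lemma pexpZ (c : R) f : exp_growth f -> pexp (fun m => c * f m) = c%:C * pexp f.
Proof.
move=> /pexp_abs_le[A _ fA].
by rewrite /pexp -(csumZ _ fA); apply: eq_csum => m; rewrite mulrCA rmorphM.
Qed.

Lemma eq_pexp f g : f =1 g -> pexp f = pexp g.
Proof. by move=> /funext ->. Qed.

(** The adjoint of the forward difference in l^2 of the Poisson law of mean y. At m = 0 the factor m
    removes the spurious value [f 0.-1]. *)
Definition craise f m : R := m%:R / y * f m.-1 - f m.

Definition fdiff f m : R := f m.+1 - f m.

Lemma exp_growth_craise f : exp_growth f -> exp_growth (craise f).
Proof.
move=> fE; apply: (@exp_growthD (fun m => m%:R / y * f m.-1) (fun m => - f m)).
  apply: (@exp_growthM (fun m => m%:R / y)); last exact: exp_growth_pred.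
  exact: (exp_growthM exp_growth_nat (exp_growth_cst _)).
have := exp_growthM (exp_growth_cst (-1)) fE.
by rewrite (_ : (fun _ => _) = fun m => - f m)//; apply/funext => m; rewrite mulN1r.
Qed.

Lemma exp_growth_fdiff f : exp_growth f -> exp_growth (fdiff f).
Proof.
move=> fE; apply: (@exp_growthD (fun m => f m.+1) (fun m => - f m)).
  exact: exp_growthS.
have := exp_growthM (exp_growth_cst (-1)) fE.
by rewrite (_ : (fun _ => _) = fun m => - f m)//; apply/funext => m; rewrite mulN1r.
Qed.

(** Summation by parts, from m P_m(y) = y P_(m-1)(y). *)
Lemma pexp_craise f g : exp_growth f -> exp_growth g ->
  pexp (fun m => craise f m * g m) = pexp (fun m => f m * fdiff g m).
Proof.
move=> fE gE.
have gSE := exp_growthS gE.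
have fgE := exp_growthM fE gE; have fgSE := exp_growthM fE gSE.
have E1 : pexp (fun m => m%:R / y * f m.-1 * g m) = pexp (fun m => f m * g m.+1).
  have [A _ fA] := pexp_abs_le fgSE.
  have [H _] := csum_shift 1 fA.
  rewrite /pexp -H; apply: eq_csum => -[|m] /=; first by rewrite !mul0r mulr0.
  rewrite subn1/= !mulrA; congr (_%:C); congr (_ * _); congr (_ * _).
  by rewrite poisS mulfK// gt_eqF.
have G1 : exp_growth (fun m => m%:R / y * f m.-1 * g m).
  apply: exp_growthM => //; apply: exp_growthM; last exact: exp_growth_pred.
  exact: (exp_growthM exp_growth_nat (exp_growth_cst _)).
have G2 : exp_growth (fun m => -1 * (f m * g m)).
  exact: (exp_growthM (exp_growth_cst _)).
transitivity (pexp (fun m => m%:R / y * f m.-1 * g m) + pexp (fun m => -1 * (f m * g m))).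
  by rewrite -pexpD//; apply: eq_pexp => m; rewrite /craise; ring.
by rewrite E1 -pexpD//; apply: eq_pexp => m; rewrite /fdiff; ring.
Qed.

(* Charlier polynomials, normalized so that sum_k h^k/k! * charlier k m
   is the likelihood ratio pois m (y + h) / pois m y. *)
Definition charlier k : nat -> R := iter k craise (fun=> 1).

Lemma exp_growth_charlier k : exp_growth (charlier k).
Proof. by elim: k => [|k IH]; [exact: exp_growth_cst|exact: exp_growth_craise]. Qed.

(** Lowering relation: [fdiff] and [craise] commute up to multiplication by 1/y. *)
Lemma fdiff_charlier k : fdiff (charlier k.+1) =1 fun m => k.+1%:R / y * charlier k m.
Proof.
have yn0 : y != 0 by rewrite gt_eqF.
elim: k => [|k IH] m.
  by rewrite /fdiff /charlier/= /craise/= -(natr1 m); field.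
have -> : charlier k.+2 = craise (charlier k.+1) by [].
rewrite /fdiff {1 2}/craise.
have := IH m; rewrite /fdiff => /eqP; rewrite subr_eq => /eqP -> /=.
have -> : m%:R / y * charlier k.+1 m.-1 = m%:R / y * charlier k.+1 m -
    m%:R / y * (k.+1%:R / y * charlier k m.-1).
  case: m => [|m]; first by rewrite !mul0r subr0.
  by rewrite -mulrBr -(IH m) /fdiff/= subKr.
have -> : m.+1%:R / y * charlier k.+1 m - (k.+1%:R / y * charlier k m + charlier k.+1 m) -
    (m%:R / y * charlier k.+1 m - m%:R / y * (k.+1%:R / y * charlier k m.-1) -
     charlier k.+1 m) =
    1 / y * charlier k.+1 m + k.+1%:R / y * craise (charlier k) m.
  by rewrite /craise -(natr1 m); field.
have -> : craise (charlier k) m = charlier k.+1 m by [].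
by rewrite -(natr1 k.+1); field.
Qed.

Lemma pexp_charlierM k g : exp_growth g ->
  pexp (fun m => charlier k m * g m) = pexp (iter k fdiff g).
Proof.
elim: k g => [|k IH] g gE; first by apply: eq_pexp => m; rewrite /= mul1r.
rewrite pexp_craise//; last exact: exp_growth_charlier.
by rewrite IH -?iterSr//; exact: exp_growth_fdiff.
Qed.

Lemma iter_fdiffZ k (c : R) g : iter k fdiff (fun m => c * g m) =1
  fun m => c * iter k fdiff g m.
Proof. by elim: k => [//|k IH] m; rewrite !iterS /fdiff !IH mulrBr. Qed.

Lemma pexp_charlier_sqr k : pexp (fun m => charlier k m * charlier k m) = (k`!%:R / y ^+ k)%:C.
Proof.
rewrite pexp_charlierM; last exact: exp_growth_charlier.
have -> : iter k fdiff (charlier k) = fun=> k`!%:R / y ^+ k.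
  elim: k => [|k IH]; first by rewrite fact0 expr0 divr1.
  rewrite iterSr (funext (fdiff_charlier k)); apply/funext => m.
  have yn0 : y != 0 by rewrite gt_eqF.
  by rewrite iter_fdiffZ IH factS natrM exprS; field; rewrite ?expf_neq0.
have H : csum (fun m => (pois m y)%:C) = 1%:C.
  rewrite -(mulVr (_ : expR y \is a GRing.unit)) ?unitfE ?expR_eq0// rmorphM/=.
  rewrite -expRN -[(expR y)%:C](csum_real (is_cvg_series_exp_coeff y)).
  rewrite -(csumZ (B := expR y)).
    by apply: eq_csum => m; rewrite poisE rmorphM.
  apply: le_sum_le (sum_le_expR (ltW y0)) => i.
  by rewrite normc_real ger0_norm// exp_coeff_ge0// ltW.
transitivity ((k`!%:R / y ^+ k)%:C * 1%:C); last by rewrite mulr1.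
rewrite /pexp -H -(csumZ (B := 1)).
  by apply: eq_csum => m; rewrite mulrC rmorphM.
by apply: le_sum_le (sum_le_pois (ltW y0)) => i; rewrite normc_real ger0_norm// pois_ge0// ltW.
Qed.

Lemma sum_le_charlier k : sum_le (fun m => pois m y * charlier k m ^+ 2) (k`!%:R / y ^+ k).
Proof.
have [|B HB _] := @pexp_abs_le (fun m => charlier k m * charlier k m).
  by apply: exp_growthM; exact: exp_growth_charlier.
apply: (@csum_real_sum_le _ _ B).
- by move=> m; rewrite mulr_ge0 ?sqr_ge0// pois_ge0// ltW.
- by apply: le_sum_le HB => m; rewrite -expr2 normrX real_normK ?num_real.
- by rewrite -pexp_charlier_sqr /pexp; apply: eq_csum => m; rewrite expr2.
Qed.

Lemma csum_geo_pois (a : R) : pexp (fun m => a ^+ m) = (expR (y * a - y))%:C.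
Proof.
rewrite addrC expRD rmorphM/= -[(expR (y * a))%:C](csum_real (is_cvg_series_exp_coeff (y * a))).
rewrite -(csumZ (B := expR `|y * a|)).
  apply: eq_csum => m; rewrite poisE -rmorphM/=; congr (_%:C).
  by rewrite /exp_coeff/= exprMn; ring.
apply: le_sum_le (sum_le_expR (normr_ge0 (y * a))) => i.
by rewrite normc_real /exp_coeff/= normrM normrX [X in _ * X]ger0_norm.
Qed.

Section remainder.
Variable h : R.

Definition likelihood m : R := expR (- h) * (1 + h / y) ^+ m.

Definition charlier_rem K m : R :=
  likelihood m - \sum_(0 <= k < K) h ^+ k / k`!%:R * charlier k m.

Lemma poisD_likelihood m : pois m (y + h) = pois m y * likelihood m.
Proof.
have E : y + h = y * (1 + h / y) by field; rewrite gt_eqF.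
by rewrite /pois /likelihood opprD expRD E exprMn; ring.
Qed.

Lemma exp_growth_likelihood : exp_growth likelihood.
Proof. exact: (exp_growthM (exp_growth_cst _) (exp_growthX _)). Qed.

Lemma exp_growth_rem K : exp_growth (charlier_rem K).
Proof.
apply: (@exp_growthD likelihood (fun m => - \sum_(0 <= k < K) h ^+ k / k`!%:R * charlier k m)).
  exact: exp_growth_likelihood.
elim: K => [|K IH].
  rewrite (_ : (fun _ => _) = fun=> 0); first exact: exp_growth_cst.
  by apply/funext => m; rewrite big_geq// oppr0.
have := exp_growthD IH (exp_growthM (exp_growth_cst (- (h ^+ K / K`!%:R))) (exp_growth_charlier K)).
by congr exp_growth; apply/funext => m; rewrite big_nat_recr//= opprD mulNr.
Qed.

Lemma fdiff_rem K : fdiff (charlier_rem K.+1) =1 fun m => h / y * charlier_rem K m.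
Proof.
have yn0 : y != 0 by rewrite gt_eqF.
move=> m; rewrite /fdiff /charlier_rem mulrBr mulr_sumr.
have c0 n : charlier 0 n = 1 by [].
rewrite !big_nat_recl// !c0.
have -> : \sum_(0 <= i < K) h ^+ i.+1 / i.+1`!%:R * charlier i.+1 m.+1 =
  \sum_(0 <= i < K) h ^+ i.+1 / i.+1`!%:R * charlier i.+1 m +
  \sum_(0 <= i < K) h / y * (h ^+ i / i`!%:R * charlier i m).
  rewrite -big_split/=; apply: eq_bigr => i _.
  have /eqP := fdiff_charlier i m; rewrite /fdiff subr_eq => /eqP H.
  change (craise (charlier i)) with (charlier i.+1); rewrite H.
  rewrite mulrDr addrC; congr (_ + _); rewrite factS natrM exprS; field.
  by rewrite yn0 fact_neq0 addrC natr1 pnatr_eq0.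
have -> : likelihood m.+1 = likelihood m + h / y * likelihood m.
  by rewrite /likelihood exprS; ring.
by ring.
Qed.

Lemma pexp_likelihood : pexp likelihood = 1.
Proof.
rewrite pexpZ; last exact: exp_growthX.
rewrite csum_geo_pois -rmorphM/= -expRD.
have -> : - h + (y * (1 + h / y) - y) = 0 by field; rewrite gt_eqF.
by rewrite expR0.
Qed.

Lemma pexp_charlier_rem K : pexp (fun m => charlier K m * charlier_rem K m) = ((h / y) ^+ K)%:C.
Proof.
rewrite pexp_charlierM; last exact: exp_growth_rem.
have -> : iter K fdiff (charlier_rem K) = fun m => (h / y) ^+ K * likelihood m.
  elim: K => [|K IH].
    by apply/funext => m; rewrite /= /charlier_rem big_geq// subr0 mul1r.
  rewrite iterSr (funext (fdiff_rem K)); apply/funext => m.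
  by rewrite iter_fdiffZ IH exprS mulrA.
by rewrite pexpZ ?pexp_likelihood ?mulr1//; exact: exp_growth_likelihood.
Qed.

(** The expansion is orthogonal. For K = 0 the squared norm is that of the likelihood ratio,
    e^(h^2/y), and each Charlier term removes from it its own squared norm, one term of the
    exponential series. *)
Lemma pexp_rem_sqr K : pexp (fun m => charlier_rem K m * charlier_rem K m) =
  (expR (h ^+ 2 / y) - \sum_(0 <= k < K) exp_coeff (h ^+ 2 / y) k)%:C.
Proof.
have yn0 : y != 0 by rewrite gt_eqF.
elim: K => [|K IH].
  rewrite big_geq// subr0.
  transitivity (pexp (fun m => expR (- h) ^+ 2 * ((1 + h / y) ^+ 2) ^+ m)).
    apply: eq_pexp => m; rewrite /charlier_rem big_geq// subr0 /likelihood.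
    by rewrite -exprM mulnC exprM; ring.
  rewrite pexpZ ?csum_geo_pois -?rmorphM/=; last exact: exp_growthX.
  rewrite -expRM_natl -expRD; congr ((expR _)%:C); by field.
have E K' : exp_growth (charlier_rem K') by exact: exp_growth_rem.
have EC := exp_growth_charlier K.
set a := h ^+ K / K`!%:R.
transitivity (pexp (fun m => charlier_rem K m * charlier_rem K m) +
   (pexp (fun m => (- 2 * a) * (charlier K m * charlier_rem K m)) +
    pexp (fun m => a ^+ 2 * (charlier K m * charlier K m)))).
  rewrite -!pexpD.
  - apply: eq_pexp => m.
    have -> : charlier_rem K.+1 m = charlier_rem K m - a * charlier K m.
      by rewrite /charlier_rem big_nat_recr//= opprD addrA.
    by ring.
  - by do ?apply: exp_growthM => //; exact: exp_growth_cst.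
  - by apply: exp_growthD; do ?apply: exp_growthM => //; exact: exp_growth_cst.
  - by do ?apply: exp_growthM => //; exact: exp_growth_cst.
  - by do ?apply: exp_growthM => //; exact: exp_growth_cst.
rewrite IH !pexpZ; [|by apply: exp_growthM|by apply: exp_growthM].
rewrite pexp_charlier_rem pexp_charlier_sqr -!rmorphM -!rmorphD/=; congr (_%:C).
rewrite big_nat_recr//=.
have -> : - 2 * a * (h / y) ^+ K + a ^+ 2 * (K`!%:R / y ^+ K) = - exp_coeff (h ^+ 2 / y) K.
  have e : (h ^+ 2) ^+ K = (h ^+ K) ^+ 2 by rewrite -!exprM mulnC.
  rewrite /exp_coeff/= /a !expr_div_n e; field.
  by rewrite fact_neq0 expf_neq0.
by rewrite opprD addrA.
Qed.

Lemma expR_tail (x : R) K : 0 <= x ->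
  expR x - \sum_(0 <= k < K) exp_coeff x k <= x ^+ K / K`!%:R * expR x.
Proof.
move=> x0; rewrite lerBlDr; apply: limr_le; first exact: is_cvg_series_exp_coeff.
exists K => // N /= KN; rewrite seriesEnat/= (big_cat_nat (n := K))//= addrC lerD2r.
rewrite -{1}(add0n K) big_addn.
have c0 : 0 <= x ^+ K / K`!%:R by rewrite divr_ge0 ?exprn_ge0.
have H := ler_wpM2l c0 (sum_le_expR x0 (N - K)%N); apply: (le_trans _ H).
rewrite mulr_sumr; apply: ler_sum => i _.
rewrite /exp_coeff/= exprD mulrACA [x ^+ i * _]mulrC ler_wpM2l ?mulr_ge0 ?exprn_ge0//.
rewrite -invfM lef_pV2 ?posrE ?mulr_gt0 ?ltr0n ?fact_gt0// -natrM ler_nat.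
rewrite -(bin_fact (leq_addl i K)) addnK.
by rewrite leq_pmull// bin_gt0 leq_addl.
Qed.

Lemma sum_le_charlier_rem K : sum_le (fun m => pois m y * charlier_rem K m ^+ 2)
  ((h ^+ 2 / y) ^+ K / K`!%:R * expR (h ^+ 2 / y)).
Proof.
have [|B HB _] := @pexp_abs_le (fun m => charlier_rem K m * charlier_rem K m).
  by apply: exp_growthM; exact: exp_growth_rem.
apply: (sum_le_trans (expR_tail _ _)); first by rewrite divr_ge0 ?sqr_ge0// ltW.
apply: (@csum_real_sum_le _ _ B).
- by move=> m; rewrite mulr_ge0 ?sqr_ge0// pois_ge0// ltW.
- by apply: le_sum_le HB => m; rewrite -expr2 normrX real_normK ?num_real.
- by rewrite -pexp_rem_sqr /pexp; apply: eq_csum => m; rewrite expr2.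
Qed.

End remainder.

End charlier.

(** * The space H^2, operator norms and approximation numbers *)

Section hardy_basics.
Variable R : realType.
Local Notation C := R[i].
Local Notation H2 := (hardy2 R).
Implicit Types (f g : H2) (b : nat -> C) (z : C).

Lemma h2norm_ge0 f : 0 <= h2norm f.
Proof. exact: sqrtr_ge0. Qed.

Lemma sum_le_h2norm f : sum_le (fun n => normc (f n) ^+ 2) (h2norm f ^+ 2).
Proof.
rewrite /h2norm sqr_sqrtr ?fine_ge0 ?sqnorm_ge0//.
apply: sum_le_fine => [i|]; first exact: sqr_ge0.
by rewrite -[nsum _]/(sqnorm f) -square_summableE coefP.
Qed.

Lemma h2norm_le f A : 0 <= A -> sum_le (fun n => normc (f n) ^+ 2) (A ^+ 2) ->
  h2norm f <= A.
Proof.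
move=> A0 fA; rewrite -(ger0_norm A0) -sqrtr_sqr ler_wsqrtr//.
rewrite -lee_fin fineK ?sqnorm_fin//.
by apply/nsum_leP => // i; exact: sqr_ge0.
Qed.

(** Closed by [Qed], so that [toH2] is known only through [toH2E]. Sequences that are not square
    summable are sent to 0. *)
Lemma toH2_ex : {g : (nat -> C) -> H2 | forall b A,
  sum_le (fun n => normc (b n) ^+ 2) A -> g b = b :> (nat -> C)}.
Proof.
exists (fun b => insubd 0 b) => b A bA; rewrite -[LHS]/(val _) insubdK//.
rewrite square_summableE; apply: le_lt_trans (ltry A).
by apply/(@nsum_leP R (fun n => normc (b n) ^+ 2)) => // i; exact: sqr_ge0.
Qed.

Definition toH2 : (nat -> C) -> H2 := sval toH2_ex.

Lemma toH2E b A : sum_le (fun n => normc (b n) ^+ 2) A -> toH2 b = b :> (nat -> C).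
Proof. exact: (svalP toH2_ex). Qed.

Lemma H2D f g n : (f + g) n = f n + g n.
Proof. by []. Qed.

Lemma H2Z z f n : (z *: f) n = z * f n.
Proof. by []. Qed.

Lemma H2B f g n : (f - g) n = f n - g n.
Proof. by []. Qed.

Lemma H2_sum I (s : seq I) (F : I -> H2) n :
  (\sum_(i <- s) F i) n = \sum_(i <- s) F i n.
Proof.
by elim: s => [|i s IH]; rewrite ?big_nil// !big_cons H2D IH.
Qed.

Lemma hardy2_eq f g : (forall n, f n = g n) -> f = g.
Proof. by move=> fg; apply/val_inj/funext. Qed.

Lemma h2norm_triangle f g : h2norm (f + g) <= h2norm f + h2norm g.
Proof. by have := h2normD f g; rewrite -rmorphD lecR. Qed.

Lemma h2norm_scale z f : h2norm (z *: f) = normc z * h2norm f.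
Proof. by apply: complexI; rewrite h2normZ rmorphM. Qed.

Lemma h2norm0 : h2norm (0 : H2) = 0.
Proof. by apply/eqP; rewrite eq_le h2norm_ge0 andbT; apply: h2norm_le => // N;
  rewrite big1 ?expr0n// => i _; rewrite normc0 expr0n. Qed.

Lemma linear_fun0 (T : H2 -> H2) : linear T -> T 0 = 0.
Proof.
move=> linT; have := linT 1 0 0; rewrite !scale1r addr0 => /eqP.
by rewrite -subr_eq0 opprD addrA subrr sub0r oppr_eq0 => /eqP.
Qed.

Lemma linear_funZ (T : H2 -> H2) z f : linear T -> T (z *: f) = z *: T f.
Proof. by move=> linT; have := linT z f 0; rewrite !addr0 linear_fun0// addr0. Qed.

Lemma linear_funB (T : H2 -> H2) f g : linear T -> T (f - g) = T f - T g.
Proof.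
by move=> linT; rewrite addrC -scaleN1r linT scaleN1r addrC.
Qed.

Lemma linear_fun_sum (T : H2 -> H2) I (s : seq I) (z : I -> C) (F : I -> H2) :
  linear T -> T (\sum_(i <- s) z i *: F i) = \sum_(i <- s) z i *: T (F i).
Proof.
move=> linT; elim: s => [|i s IH]; first by rewrite !big_nil linear_fun0.
by rewrite !big_cons linT IH.
Qed.

Lemma bounded_linear_continuous_h2 (T : H2 -> H2) (B : R) : linear T ->
  (forall f, h2norm (T f) <= B * h2norm f) -> continuous T.
Proof.
move=> linT TB f; apply/(@cvgrPdist_le _ _ _ _ (nbhs_filter f)) => e e0.
have eE : e = (complex.Re e)%:C.
  apply/eqP; rewrite eq_complex/= eqxx/= eq_sym; case: e e0 => a b /=.
  by rewrite ltcE/= => /andP[/eqP->].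
set e' := complex.Re e in eE; have e'0 : 0 < e' by rewrite -ltcR -eE.
have B0 : 0 < `|B| + 1 by rewrite ltr_wpDl.
have d0 : 0 < (e' / (`|B| + 1))%:C by rewrite ltcR divr_gt0.
have /(@cvgrPdist_le _ _ _ _ (nbhs_filter f))/(_ _ d0) : id x @[x --> f] --> f by exact: cvg_id.
apply: filterS => g.
rewrite !h2_normE eE !lecR => fg.
rewrite -linear_funB//; apply: le_trans (TB _) _.
apply: (@le_trans _ _ ((`|B| + 1) * h2norm (f - g))).
  by rewrite ler_wpM2r ?h2norm_ge0// (le_trans (ler_norm _))// lerDl.
by apply: le_trans (ler_wpM2l (ltW B0) fg) _; rewrite mulrC divfK// gt_eqF.
Qed.

Lemma bounded_operator_h2 (T : H2 -> H2) (B : R) : linear T ->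
  (forall f, h2norm (T f) <= B * h2norm f) -> bounded_operator T.
Proof. by move=> linT TB; split => //; exact: bounded_linear_continuous_h2 TB. Qed.

Lemma opnorm_le (T : H2 -> H2) (B : R) :
  (forall f, h2norm f <= 1 -> h2norm (T f) <= B) -> (opnorm T <= B%:E)%E.
Proof.
by move=> TB; apply: ge_ereal_sup => _ [f /= f1 <-]; rewrite lee_fin; exact: TB.
Qed.

Lemma opnorm_ge (T : H2 -> H2) f (a b : R) : 0 < a ->
  (forall z g, T (z *: g) = z *: T g) ->
  0 < h2norm f -> h2norm f <= a -> b <= h2norm (T f) -> 0 <= b ->
  ((b / a)%:E <= opnorm T)%E.
Proof.
move=> a0 TZ f0 fa bT b0.
pose g := ((h2norm f)^-1)%:C *: f.
have ni : normc ((h2norm f)^-1)%:C = (h2norm f)^-1.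
  by rewrite normc_real ger0_norm// invr_ge0 h2norm_ge0.
apply: (@le_trans _ _ (h2norm (T g))%:E).
  rewrite lee_fin /g TZ h2norm_scale ni mulrC; apply: ler_pM => //.
    by rewrite invr_ge0 ltW.
  by rewrite lef_pV2.
apply: ereal_sup_ubound; exists g => //=.
by rewrite /g h2norm_scale ni mulVf// gt_eqF.
Qed.

Lemma approx_number_le (T S : H2 -> H2) n (B : R) :
  bounded_operator S -> rank_lt n S ->
  (forall f, h2norm f <= 1 -> h2norm (T f - S f) <= B) ->
  (approx_number T n <= B%:E)%E.
Proof.
move=> Sb Sr TS; apply: (@le_trans _ _ (opnorm (fun f => T f - S f))).
  by apply: ereal_inf_lbound; exists S.
exact: opnorm_le.
Qed.

Lemma approx_number_anti (T : H2 -> H2) m n : (m <= n)%N ->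
  (approx_number T n <= approx_number T m)%E.
Proof.
move=> mn; apply: le_ereal_inf => _ [S [Sb [k km Sk]] <-].
by exists S => //; split => //; exists k => //; exact: leq_trans km mn.
Qed.

Lemma rank_lt_fin (T : finType) (S : H2 -> H2) (v : T -> H2) n : (#|T| < n)%N ->
  (forall f, exists a : T -> C, S f = \sum_t a t *: v t) -> rank_lt n S.
Proof.
move=> Tn Sv; exists #|T| => //; exists (fun i => v (enum_val i)) => f.
have [a ->] := Sv f; exists (fun i => a (enum_val i)).
by rewrite (reindex_onto enum_val enum_rank)/=; [apply: eq_bigl => i|
  move=> t _; exact: enum_rankK]; rewrite enum_valK eqxx.
Qed.

(* Bernstein numbers bound approximation numbers from below: an operator of
   rank < n kills a nonzero vector of any n-dimensional subspace. *)
Lemma approx_number_ge (T : H2 -> H2) n (F : 'I_n -> H2) (a b : R) :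
  linear T -> 0 < a -> 0 <= b ->
  (forall x : 'I_n -> C, \sum_i normc (x i) ^+ 2 = 1 ->
     h2norm (\sum_i x i *: F i) <= a) ->
  (forall x : 'I_n -> C, \sum_i normc (x i) ^+ 2 = 1 ->
     0 < h2norm (\sum_i x i *: F i)) ->
  (forall x : 'I_n -> C, \sum_i normc (x i) ^+ 2 = 1 ->
     b <= h2norm (T (\sum_i x i *: F i))) ->
  ((b / a)%:E <= approx_number T n)%E.
Proof.
move=> linT a0 b0 Fa F0 Fb; apply: le_ereal_inf_tmp => _ [S [[linS _] [k kn [v vS]]] <-].
pose A (i : 'I_n) : 'I_k -> C := xget (fun=> 0) [set c | S (F i) = \sum_j c j *: v j].
have AE i : S (F i) = \sum_j A i j *: v j.
  by have [c cS] := vS (F i); rewrite /A; case: xgetP => [d -> //|/(_ c)].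
pose M : 'M[C]_(n, k) := \matrix_(i, j) A i j.
have : kermx M != 0.
  by rewrite kermx_eq0 /row_free neq_ltn (leq_ltn_trans (rank_leq_col M) kn).
move=> /rowV0Pn[x /sub_kermxP xM x0].
pose s := \sum_i normc (x 0 i) ^+ 2.
have s0 : 0 < s.
  rewrite lt_neqAle sumr_ge0 ?andbT; last by move=> i _; exact: sqr_ge0.
  apply: contraNneq x0 => /esym/eqP; rewrite psumr_eq0; last by move=> i _; exact: sqr_ge0.
  move=> /allP xi; apply/eqP/rowP => i; rewrite mxE; apply: eq0_normc.
  by have /(_ (mem_index_enum _)) := xi i; rewrite /= sqrf_eq0 => /eqP.
pose y i := ((Num.sqrt s)^-1)%:C * x 0 i.
have y1 : \sum_i normc (y i) ^+ 2 = 1.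
  under eq_bigr do rewrite /y normcM exprMn normc_real real_normK ?num_real//.
  by rewrite -mulr_sumr exprVn sqr_sqrtr ?(ltW s0)// mulVf// gt_eqF.
pose g := \sum_i y i *: F i.
have Sg : S g = 0.
  rewrite linear_fun_sum//; under eq_bigr do rewrite AE scaler_sumr.
  rewrite exchange_big/= big1// => j _.
  under eq_bigr do rewrite scalerA.
  rewrite -scaler_suml (_ : \sum_i _ = ((Num.sqrt s)^-1)%:C * (x *m M) 0 j).
    by rewrite xM mxE mulr0 scale0r.
  rewrite mxE mulr_sumr; apply: eq_bigr => i _.
  by rewrite /y mxE mulrA.
apply: (@opnorm_ge _ g) => //.
- by move=> z h; rewrite (linear_funZ _ _ linT) (linear_funZ _ _ linS) scalerBr.
- exact: F0.
- exact: Fa.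
- by rewrite Sg subr0; exact: Fb.
Qed.

End hardy_basics.

(** * The model operator and its approximation by operators of finite rank *)

Section model_operator.
Variables (R : realType) (r tau : R).
Hypothesis r0 : 0 < r.
Local Notation C := R[i].
Local Notation H2 := (hardy2 R).
(* To be instantiated with the coefficient pi m N of (N.+1)^(-s) in (w(s)/r)^m,
   where w(s) = \sum_j c_j q_j^(-s); the supports of the pi m are disjoint because
   the q_j are independent. *)
Variable pi : nat -> nat -> C.
Hypothesis pi_disj : forall m m' N, pi m N != 0 -> pi m' N != 0 -> m = m'.
Hypothesis pi_le1 : forall m, sum_le (fun N => normc (pi m N) ^+ 2) 1.
Implicit Types (f g : H2) (y z : nat -> C) (m n N : nat) (D : nat -> R).

Lemma normcM_sqr (u v : C) : normc (u * v) ^+ 2 = normc u ^+ 2 * normc v ^+ 2.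
Proof. by rewrite normcM; ring. Qed.

Lemma normc_real_sqr (x : R) : normc x%:C ^+ 2 = x ^+ 2.
Proof. by rewrite normc_real real_normK ?num_real. Qed.

(** What is left of n^(-c1), for the integer n.+1, once n^(-r) = e^(-r ln n) has been put into the
    Poisson weight. *)
Definition wt n : C := npow n.+1 (- (2^-1 +i* tau)).

Lemma normc_wt n : normc (wt n) ^+ 2 = n.+1%:R^-1.
Proof.
rewrite /wt normc_npow/= -expRM_natl mulrA mulrN divff ?pnatr_eq0// mulN1r expRN lnK//.
by rewrite posrE ltr0n.
Qed.

(* For c1 = 1/2 + r + i tau, Tc f m below is r^m f^(m)(c1) / m!: the terms
   n^(-c1) (r ln n)^m / m! of this derivative are Poisson probabilities with
   mean r ln n, up to the weight wt. *)
Definition Tterm f m n : C := f n * (wt n * (pois m (logx r n))%:C).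

Definition Tc f m : C := (-1) ^+ m * csum (Tterm f m).

Lemma lx_ge0 n : 0 <= logx r n. Proof. exact/logx_ge0/ltW. Qed.

Lemma normc_sign m : normc ((-1) ^+ m : C) = 1.
Proof. by rewrite normcX normcN normc1 expr1n. Qed.

(** The splitting for Cauchy-Schwarz: one factor P_m goes with |f n|^2, to be summed over m, the
    other with 1/n, whose sum over n is at most [CQ r]. *)
Lemma Tterm_sqr f m n : normc (Tterm f m n) ^+ 2 <=
  (normc (f n) ^+ 2 * pois m (logx r n)) * (pois m (logx r n) / n.+1%:R).
Proof.
have p0 := pois_ge0 m (lx_ge0 n).
rewrite /Tterm normcM_sqr [normc (wt n * _) ^+ 2]normcM_sqr normc_wt normc_real_sqr.
by rewrite le_eqVlt; apply/orP; left; apply/eqP; ring.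
Qed.

Lemma abs_le_Tterm f m : abs_le (Tterm f m) (Num.sqrt (h2norm f ^+ 2 * CQ r)).
Proof.
apply: (sum_le_sqrt (u := fun n => normc (f n) ^+ 2) (v := fun n => pois m (logx r n) / n.+1%:R)).
- by move=> i; exact: sqr_ge0.
- by move=> i; rewrite divr_ge0// pois_ge0// lx_ge0.
- by move=> i; exact: normc_ge0.
- move=> i; apply: le_trans (Tterm_sqr _ _ _) _.
  have p0 := pois_ge0 m (lx_ge0 i).
  apply: ler_wpM2r; first by rewrite divr_ge0.
  by rewrite ler_piMr ?sqr_ge0// pois_le1// lx_ge0.
- exact: sum_le_h2norm.
- exact: sum_le_pois_log.
Qed.

Lemma TcD (a : C) f g m : Tc (a *: f + g) m = a * Tc f m + Tc g m.
Proof.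
rewrite /Tc mulrCA -mulrDr; congr (_ * _).
rewrite -(csumZ _ (abs_le_Tterm f m)) -(csumD (abs_leZ _ (abs_le_Tterm f m)) (abs_le_Tterm g m)).
by apply: eq_csum => n; rewrite /Tterm H2D H2Z; ring.
Qed.

(** A Schur test. The mean of D under the Poisson law is bounded only at the n with f n nonzero:
    this is how a function supported on the far blocks profits from the decay of D. *)
Lemma Tc_weighted D f (G : R) : (forall m, 0 <= D m) ->
  (forall n, f n != 0 -> sum_le (fun m => D m * pois m (logx r n)) G) -> 0 <= G ->
  sum_le (fun m => D m * normc (Tc f m) ^+ 2) (CQ r * G * h2norm f ^+ 2).
Proof.
move=> D0 DG G0.
pose a n m := normc (f n) ^+ 2 * (D m * pois m (logx r n)).
have p0 m n := pois_ge0 m (lx_ge0 n).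
have a0 n m : 0 <= a n m by rewrite mulr_ge0 ?sqr_ge0// mulr_ge0.
have [||b' ab' b'G] := @sum_le_fubini R a (fun n => normc (f n) ^+ 2 * G) (G * h2norm f ^+ 2) a0.
- move=> n; have [fn|fn] := eqVneq (f n) 0.
    by move=> M; rewrite big1 ?fn ?normc0 ?expr0n ?mul0r// => i _; rewrite /a fn normc0 expr0n mul0r.
  by apply: sum_leZ; [exact: sqr_ge0|exact: DG].
- apply: le_sum_le (sum_leZ G0 (sum_le_h2norm f)) => n.
  by rewrite mulrC.
rewrite -mulrA; apply: le_sum_le (sum_leZ (ltW (CQ_gt0 r0)) b'G) => m.
have b'0 : 0 <= b' m by exact: sum_le_ge0 (ab' m).
rewrite /Tc normcM normc_sign mul1r.
have [->|Dm] := eqVneq (D m) 0; first by rewrite mul0r mulr_ge0// ltW// CQ_gt0.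
have Dm0 : 0 < D m by rewrite lt_neqAle eq_sym Dm D0.
have H : abs_le (Tterm f m) (Num.sqrt (b' m / D m * CQ r)).
  apply: (sum_le_sqrt (u := fun n => normc (f n) ^+ 2 * pois m (logx r n))
    (v := fun n => pois m (logx r n) / n.+1%:R)).
  - by move=> i; rewrite mulr_ge0 ?sqr_ge0.
  - by move=> i; rewrite divr_ge0.
  - by move=> i; exact: normc_ge0.
  - by move=> i; exact: Tterm_sqr.
  - have i0 : 0 <= (D m)^-1 by rewrite invr_ge0.
    rewrite mulrC; apply: le_sum_le (sum_leZ i0 (ab' m)) => n.
    by rewrite /a le_eqVlt; apply/orP; left; apply/eqP; field.
  - exact: sum_le_pois_log.
rewrite mulrC -ler_pdivlMr//; apply: (@le_trans _ _ (Num.sqrt (b' m / D m * CQ r) ^+ 2)).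
  by rewrite lerXn2r ?nnegrE ?normc_ge0 ?sqrtr_ge0//; exact: norm_csum.
rewrite sqr_sqrtr; last first.
  by apply: mulr_ge0; [exact: divr_ge0|exact/ltW/CQ_gt0].
by rewrite mulrC mulrA.
Qed.

Lemma pi_single N : exists m0, forall m, m != m0 -> pi m N = 0.
Proof.
have [[m0 m0P]|nex] := pselect (exists m, pi m N != 0).
  by exists m0 => m mm0; apply: contraNeq mm0 => mN; apply/eqP; exact: pi_disj mN m0P.
by exists 0%N => m _; apply: contrapT => /eqP mN; apply: nex; exists m.
Qed.

(** The Dirichlet coefficients of the sum of y_m (w/r)^m over m; by [pi_single] at most one m
    contributes to each N. *)
Definition Uc y N : C := csum (fun m => y m * pi m N).

Lemma UcE N m0 y : (forall m, m != m0 -> pi m N = 0) -> Uc y N = y m0 * pi m0 N.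
Proof. by move=> m0P; apply: csum1 => m /m0P ->; rewrite mulr0. Qed.

Lemma Uc_upper D y (A : R) : (forall m, sum_le (fun N => normc (pi m N) ^+ 2) (D m)) ->
  sum_le (fun m => D m * normc (y m) ^+ 2) A ->
  sum_le (fun N => normc (Uc y N) ^+ 2) A.
Proof.
move=> piD yA.
pose a m N := normc (y m) ^+ 2 * normc (pi m N) ^+ 2.
have a0 m N : 0 <= a m N by rewrite mulr_ge0 ?sqr_ge0.
have [||b' ab' b'A] := @sum_le_fubini R a (fun m => normc (y m) ^+ 2 * D m) A a0.
- by move=> m; apply: sum_leZ; [exact: sqr_ge0|exact: piD].
- by apply: le_sum_le yA => m; rewrite mulrC.
apply: le_sum_le b'A => N; have [m0 m0P] := pi_single N.
rewrite (UcE _ m0P) normcM_sqr.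
exact: (le_term_sum_le (u := a ^~ N) m0).
Qed.

Lemma h2norm_Uc D y (A : R) : (forall m, sum_le (fun N => normc (pi m N) ^+ 2) (D m)) ->
  sum_le (fun m => D m * normc (y m) ^+ 2) (A ^+ 2) -> 0 <= A ->
  toH2 (Uc y) = Uc y :> (nat -> C) /\ h2norm (toH2 (Uc y)) <= A.
Proof.
move=> piD yA A0; have H := Uc_upper piD yA.
by have E := toH2E H; split => //; apply: h2norm_le => //; rewrite E.
Qed.

Definition Lop f : H2 := toH2 (Uc (Tc f)).

Lemma sum_le_Tc f : sum_le (fun m => 1 * normc (Tc f m) ^+ 2) ((Num.sqrt (CQ r) * h2norm f) ^+ 2).
Proof.
rewrite [(_ * _) ^+ 2]exprMn sqr_sqrtr ?(ltW (CQ_gt0 r0))//.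
rewrite -{1}[CQ r]mulr1; apply: (Tc_weighted (D := fun=> 1)) => // n _.
by apply: le_sum_le (sum_le_pois (lx_ge0 n)) => m; rewrite mul1r.
Qed.

Lemma LopE f N : Lop f N = Uc (Tc f) N.
Proof.
have [|-> //] := h2norm_Uc pi_le1 (sum_le_Tc f).
by rewrite mulr_ge0 ?sqrtr_ge0 ?h2norm_ge0.
Qed.

Lemma Lop_bounded f : h2norm (Lop f) <= Num.sqrt (CQ r) * h2norm f.
Proof.
have [|_ //] := h2norm_Uc pi_le1 (sum_le_Tc f).
by rewrite mulr_ge0 ?sqrtr_ge0 ?h2norm_ge0.
Qed.

Lemma Lop_weighted D f (G : R) : (forall m, sum_le (fun N => normc (pi m N) ^+ 2) (D m)) ->
  (forall n, f n != 0 -> sum_le (fun m => D m * pois m (logx r n)) G) -> 0 <= G ->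
  h2norm (Lop f) <= Num.sqrt (CQ r * G) * h2norm f.
Proof.
move=> piD DG G0.
have D0 m : 0 <= D m by exact: sum_le_ge0 (piD m).
have [||_ //] := h2norm_Uc (y := Tc f) (A := Num.sqrt (CQ r * G) * h2norm f) piD.
  rewrite [(_ * _) ^+ 2]exprMn sqr_sqrtr; last by rewrite mulr_ge0// ltW// CQ_gt0.
  exact: Tc_weighted.
by rewrite mulr_ge0 ?sqrtr_ge0 ?h2norm_ge0.
Qed.

Lemma Lop_linear : linear Lop.
Proof.
move=> a f g; apply: hardy2_eq => N; rewrite H2D H2Z.
rewrite (LopE (a *: f + g) N) (LopE f N) (LopE g N).
by have [m0 m0P] := pi_single N; rewrite !(UcE _ m0P) TcD; ring.
Qed.

(** By disjointness of supports the squared norm is a sum over m of |T_m(f)|^2 times the squared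
    norm of pi m; only the degrees of the window are kept. *)
Lemma Lop_lower f (d : R) m1 m2 : 0 <= d ->
  (forall m, (m1 <= m < m2)%N -> exists L, d <= \sum_(0 <= N < L) normc (pi m N) ^+ 2) ->
  d * \sum_(m1 <= m < m2) normc (Tc f m) ^+ 2 <= h2norm (Lop f) ^+ 2.
Proof.
move=> d0 dL.
(* One truncation serves the finitely many degrees of the window, partial sums being monotone. *)
have [L LP] : exists L, forall m, (m1 <= m < m2)%N -> d <= \sum_(0 <= N < L) normc (pi m N) ^+ 2.
  elim: m2 dL => [_|m2 IH dL]; first by exists 0%N => m; rewrite ltn0 andbF.
  have [|L LP] := IH.
    by move=> m /andP[m1m mm2]; apply: dL; rewrite m1m ltnS ltnW.
  have [m1m2|m2m1] := leqP m1 m2; last first.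
    by exists 0%N => m /andP[a b]; have := leq_trans m2m1 a; rewrite ltnNge -ltnS b.
  have [|L' L'P] := dL m2; first by rewrite m1m2 ltnS leqnn.
  have mono (m a b : nat) : (a <= b)%N -> \sum_(0 <= N < a) normc (pi m N) ^+ 2 <=
      \sum_(0 <= N < b) normc (pi m N) ^+ 2.
    by move=> ab; rewrite [leRHS](big_cat_nat (n := a))//= lerDl sumr_ge0// => i _; exact: sqr_ge0.
  exists (maxn L L') => m /andP[m1m]; rewrite ltnS leq_eqVlt => /orP[/eqP ->|mm2].
    by apply: le_trans L'P _; apply: mono; rewrite leq_maxr.
  by apply: le_trans (LP m _) _; rewrite ?m1m// mono// leq_maxl.
apply: le_trans (sum_le_h2norm (Lop f) L).
rewrite mulr_sumr.
apply: (@le_trans _ _ (\sum_(m1 <= m < m2) \sum_(0 <= N < L) normc (Tc f m) ^+ 2 * normc (pi m N) ^+ 2)).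
  rewrite big_nat_cond [leRHS]big_nat_cond; apply: ler_sum => m; rewrite andbT => mm.
  by rewrite -mulr_sumr mulrC ler_wpM2l ?sqr_ge0// LP.
rewrite exchange_big/=; apply: ler_sum => N _.
rewrite LopE; have [m0 m0P] := pi_single N; rewrite (UcE _ m0P) normcM_sqr.
have [m0i|m0n] := boolP (m0 \in index_iota m1 m2).
  rewrite (bigD1_seq m0) ?iota_uniq//= big1 ?addr0// => m mm0.
  by rewrite m0P// normc0 expr0n mulr0.
rewrite big_seq_cond big1; first by rewrite mulr_ge0 ?sqr_ge0.
move=> m /andP[mi _].
by rewrite m0P ?normc0 ?expr0n ?mulr0//; apply: contraNneq m0n => <-.
Qed.

Section finite_rank_approximation.
Variables J K : nat.

(* The block length in the scale sqrt (logx n) is 1, the order of the standard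
   deviation of the square root of a Poisson variable. *)
Definition blk n : nat := Num.trunc (Num.sqrt (logx r n)).

(* The maximum only avoids the mean 0, around which there is no Charlier expansion. *)
Definition ctr j : R := (maxn j 1)%:R ^+ 2.

Definition dev n : R := logx r n - ctr (blk n).

Lemma ctr_gt0 j : 0 < ctr j.
Proof. by rewrite exprn_gt0// ltr0n leq_max orbT. Qed.

Lemma blk_itv n : (blk n)%:R ^+ 2 <= logx r n < (blk n).+1%:R ^+ 2.
Proof.
have s0 := sqrtr_ge0 (logx r n); have /andP[h1 h2] := truncn_itv s0.
rewrite -[X in _ <= X < _](sqr_sqrtr (lx_ge0 n)); apply/andP; split.
  by rewrite lerXn2r ?nnegrE.
by rewrite ltrXn2r ?nnegrE.
Qed.

(** On block j >= 1 the deviation is between 0 and 2j + 1 <= 3j while the center is j^2; on block 0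
    it is at most 1 in modulus and the center is 1. *)
Lemma dev_le n : dev n ^+ 2 / ctr (blk n) <= 9.
Proof.
rewrite ler_pdivrMr ?ctr_gt0// /dev /ctr; have /andP[] := blk_itv n.
case: (blk n) => [|j].
  rewrite /maxn/= expr1n => h1 h2; have := lx_ge0 n; move: h2; nra.
have -> : maxn j.+1 1 = j.+1 by apply/maxn_idPl.
rewrite -(natr1 j.+1); have : 1 <= j.+1%:R :> R by rewrite ler1n.
move: (j.+1%:R) => a a1 h1 h2.
have h3 : 0 <= logx r n - a ^+ 2 by rewrite subr_ge0.
have h4 : logx r n - a ^+ 2 <= 3 * a by nra.
have -> : 9 * a ^+ 2 = (3 * a) ^+ 2 by ring.
by rewrite lerXn2r ?nnegrE//; lra.
Qed.

Lemma blk_le (n n' : nat) : (n <= n')%N -> (blk n <= blk n')%N.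
Proof.
move=> nn'; apply: le_truncn; rewrite ler_wsqrtr// ler_wpM2l ?(ltW r0)//.
by rewrite ler_ln ?posrE ?ltr0n// ler_nat ltnS.
Qed.

Lemma harmonic_le N : \sum_(0 <= n < N.+1) n.+1%:R^-1 <= 1 + ln N.+1%:R :> R.
Proof.
elim: N => [|N IH]; first by rewrite big_nat1 ln1 addr0 invr1.
rewrite big_nat_recr//=; apply: le_trans (lerD IH (lexx _)) _.
rewrite -addrA lerD2l addrC -lerBrDr; exact: ln_ratio_ge.
Qed.

(** On the first J blocks r ln n < J^2, and the harmonic sum exceeds the logarithm by at most 1. *)
Lemma sum_le_blk : sum_le (fun n => (blk n < J)%N%:R / n.+1%:R) (1 + J%:R ^+ 2 / r).
Proof.
have c0 : 0 <= 1 + J%:R ^+ 2 / r by rewrite addr_ge0// divr_ge0 ?sqr_ge0// ltW.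
elim=> [|N IH]; first by rewrite big_geq.
have [NJ|NJ] := boolP (blk N < J)%N; last first.
  by rewrite big_nat_recr//= (negbTE NJ) mul0r addr0.
apply: (@le_trans _ _ (1 + ln N.+1%:R)).
  apply: le_trans (harmonic_le N); apply: ler_sum => i _.
  by rewrite ler_piMl ?invr_ge0// lern1 leq_b1.
rewrite lerD2l ler_pdivlMr// mulrC -/(logx r N).
have /andP[_ /ltW h] := blk_itv N; apply: le_trans h _.
by rewrite lerXn2r ?nnegrE// ler_nat.
Qed.

(** Beyond all indices of the first J blocks, where r ln n < J^2; sums over these blocks thus become
    finite sums. *)
Definition cutoff : nat := (Num.trunc (expR (J%:R ^+ 2 / r))).+1.

Lemma blk_cutoff n : (blk n < J)%N -> (n < cutoff)%N.
Proof.
move=> nJ; have /andP[_ h] := blk_itv n.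
have {}h : logx r n < J%:R ^+ 2.
  by apply: lt_le_trans h _; rewrite lerXn2r ?nnegrE// ler_nat.
have h2 : n.+1%:R <= expR (J%:R ^+ 2 / r).
  rewrite -[leLHS](@lnK R) ?posrE ?ltr0n// ler_expR ler_pdivlMr//.
  by rewrite mulrC ltW.
have /andP[_ h3] := truncn_itv (expR_ge0 (J%:R ^+ 2 / r)).
by have := le_lt_trans h2 h3; rewrite ltr_nat ltnS => /ltnW.
Qed.

Definition lam f j k : C :=
  \sum_(0 <= n < cutoff | blk n == j) f n * wt n * (dev n ^+ k / k`!%:R)%:C.

Definition vcoef j k m : C := (-1) ^+ m * (pois m (ctr j) * charlier (ctr j) k m)%:C.

(* On each block the Poisson weights are replaced by their Charlier expansion of
   order K around the center of the block. *)
Definition Sop f : H2 :=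
  \sum_(jk : 'I_J * 'I_K) lam f jk.1 jk.2 *: toH2 (Uc (vcoef jk.1 jk.2)).

Lemma vcoefE j k N : toH2 (Uc (vcoef j k)) N = Uc (vcoef j k) N.
Proof.
have [||-> //] := h2norm_Uc (y := vcoef j k) (A := Num.sqrt (k`!%:R / ctr j ^+ k)) pi_le1.
- rewrite sqr_sqrtr ?divr_ge0 ?exprn_ge0 ?(ltW (ctr_gt0 _))//.
  apply: le_sum_le (sum_le_charlier (ctr_gt0 j) k) => m.
  have p0 := pois_ge0 m (ltW (ctr_gt0 j)).
  rewrite mul1r /vcoef normcM_sqr normc_sign expr1n mul1r normc_real_sqr.
  by rewrite [(_ * _) ^+ 2]exprMn ler_wpM2r ?sqr_ge0// expr2 ler_piMr// pois_le1// ltW// ctr_gt0.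
- exact: sqrtr_ge0.
Qed.

Lemma Sop_rank : rank_lt (J * K).+1 Sop.
Proof.
apply: (@rank_lt_fin _ ('I_J * 'I_K)%type _ (fun jk => toH2 (Uc (vcoef jk.1 jk.2)))).
  by rewrite card_prod !card_ord.
by move=> f; exists (fun jk : 'I_J * 'I_K => lam f jk.1 jk.2).
Qed.

Lemma lamD (a : C) f g j k : lam (a *: f + g) j k = a * lam f j k + lam g j k.
Proof.
rewrite /lam mulr_sumr -big_split/=; apply: eq_bigr => n _.
transitivity ((a * f n + g n) * wt n * (dev n ^+ k / k`!%:R)%:C); first by [].
by ring.
Qed.

Lemma Sop_linear : linear Sop.
Proof.
move=> a f g; rewrite /Sop scaler_sumr -big_split/=; apply: eq_bigr => jk _.
by rewrite lamD scalerDl scalerA.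
Qed.

Definition zcoef f m : C := (-1) ^+ m * \sum_(0 <= n < cutoff) (if (blk n < J)%N then
  f n * wt n * (pois m (ctr (blk n)) * charlier_rem (ctr (blk n)) (dev n) K m)%:C else 0).

Definition tail f : H2 := toH2 (fun n => if (blk n < J)%N then 0 else f n).

Lemma sum_le_h2tail f : sum_le (fun n => normc (if (blk n < J)%N then 0 else f n) ^+ 2) (h2norm f ^+ 2).
Proof.
by apply: le_sum_le (sum_le_h2norm f) => n; case: ifP => // _; rewrite normc0 expr0n sqr_ge0.
Qed.

Lemma tailE f n : tail f n = if (blk n < J)%N then 0 else f n.
Proof. by rewrite /tail (toH2E (sum_le_h2tail f)). Qed.

Lemma h2norm_tail f : h2norm (tail f) <= h2norm f.
Proof.
apply: h2norm_le; first exact: h2norm_ge0.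
by apply: le_sum_le (sum_le_h2tail f) => n; rewrite tailE.
Qed.

(** The error comes from the blocks that [Sop] ignores and, on the first J blocks, from the Charlier
    remainders. Only one degree contributes at N, so the identity is one between scalars. *)
Lemma Lop_Sop_coef f N : (Lop f - Sop f) N = Lop (tail f) N + Uc (zcoef f) N.
Proof.
rewrite H2B (LopE f N) (LopE (tail f) N) /Sop H2_sum.
have [m0 m0P] := pi_single N; rewrite !(UcE _ m0P).
under eq_bigr do rewrite H2Z vcoefE (UcE _ m0P) mulrA.
rewrite -mulr_suml -mulrBl -mulrDl; congr (_ * _).
pose main f m n : C := if (blk n < J)%N then
  f n * wt n * (pois m (logx r n))%:C else 0.
have main0 m n : (cutoff <= n)%N -> main f m n = 0.
  by move=> cn; rewrite /main ifF//; apply: contraTF cn => /blk_cutoff; rewrite -ltnNge.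
have -> : Tc f m0 = Tc (tail f) m0 + (-1) ^+ m0 * \sum_(0 <= n < cutoff) main f m0 n.
  rewrite /Tc -mulrDr; congr (_ * _).
  rewrite -(csum_fin (main0 m0)).
  rewrite -(csumD (abs_le_Tterm _ _) (abs_le_fin (main0 m0))); apply: eq_csum => n.
  by rewrite /Tterm /main tailE; case: ifP => _; rewrite ?mul0r ?add0r ?addr0 ?mulrA.
rewrite -addrA; congr (_ + _).
(* The sum over the pairs (j, k) is regrouped by n: each n belongs to the single block j =
   [blk n]. *)
have -> : \sum_(i : 'I_J * 'I_K) lam f i.1 i.2 * vcoef i.1 i.2 m0 = (-1) ^+ m0 *
    \sum_(0 <= n < cutoff) (if (blk n < J)%N then f n * wt n *
      (\sum_(0 <= k < K) (dev n ^+ k / k`!%:R * (pois m0 (ctr (blk n)) * charlier (ctr (blk n)) k m0)))%:C else 0).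
  rewrite -(pair_bigA _ (fun (j : 'I_J) (k : 'I_K) => lam f j k * vcoef j k m0))/=.
  rewrite mulr_sumr.
  transitivity (\sum_(j < J) \sum_(0 <= n < cutoff | blk n == j) \sum_(k < K)
     f n * wt n * (dev n ^+ k / k`!%:R)%:C * vcoef j k m0).
    apply: eq_bigr => j _; rewrite exchange_big/=; apply: eq_bigr => k _.
    by rewrite /lam mulr_suml.
  rewrite (eq_bigr (fun j : 'I_J => \sum_(0 <= n < cutoff) if blk n == j then \sum_(k < K)
     f n * wt n * (dev n ^+ k / k`!%:R)%:C * vcoef j k m0 else 0)); last first.
    by move=> j _; rewrite big_mkcond.
  rewrite exchange_big/=; apply: eq_bigr => n _.
  case: ifP => nJ; last first.
    rewrite mulr0 big1// => j _; case: eqP => // nj; move: (ltn_ord j).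
    by rewrite -nj nJ.
  rewrite (bigD1 (Ordinal nJ))//= eqxx [X in _ + X]big1 ?addr0; last first.
    by move=> j jn; case: eqP => // nj; case/eqP: jn; apply/val_inj; rewrite /= nj.
  rewrite big_mkord rmorph_sum/= !mulr_sumr; apply: eq_bigr => k _.
  by rewrite /vcoef rmorphM/=; ring.
rewrite -mulrBr /zcoef; congr (_ * _); rewrite -sumrB; apply: eq_bigr => n _.
rewrite /main; case: ifP => _; last by rewrite subr0.
rewrite -mulrBr -rmorphB/=; congr (_ * _%:C).
have {1}-> : logx r n = ctr (blk n) + dev n by rewrite /dev addrC subrK.
rewrite (poisD_likelihood (ctr_gt0 _)) /charlier_rem mulrBr mulr_sumr.
by congr (_ - _); apply: eq_bigr => k _; rewrite mulrCA.
Qed.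

(** The bound of [sum_le_charlier_rem] with h^2/y replaced by its bound 9 from [dev_le]. *)
Definition rem_const : R := 9 ^+ K / K`!%:R * expR 9.

(** Cauchy-Schwarz over the indices of the first J blocks; their harmonic mass costs only a factor
    of order J^2, which K! will absorb. *)
Lemma sum_le_zcoef f : sum_le (fun m => 1 * normc (zcoef f m) ^+ 2)
  ((Num.sqrt ((1 + J%:R ^+ 2 / r) * rem_const) * h2norm f) ^+ 2).
Proof.
have c0 : 0 <= 1 + J%:R ^+ 2 / r by rewrite addr_ge0// divr_ge0 ?sqr_ge0// ltW.
have e0 : 0 <= rem_const by rewrite mulr_ge0 ?expR_ge0 ?divr_ge0 ?exprn_ge0.
rewrite [(_ * _) ^+ 2]exprMn sqr_sqrtr ?mulr_ge0//.
pose a n m := (blk n < J)%N%:R / n.+1%:R *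
  (pois m (ctr (blk n)) * charlier_rem (ctr (blk n)) (dev n) K m) ^+ 2.
have a0 n m : 0 <= a n m by rewrite mulr_ge0 ?sqr_ge0 ?divr_ge0.
have [||b' ab' b'A] := @sum_le_fubini R a (fun n => (blk n < J)%N%:R / n.+1%:R * rem_const)
   ((1 + J%:R ^+ 2 / r) * rem_const) a0.
- move=> n; apply: sum_leZ; first by rewrite divr_ge0.
  have cn := ctr_gt0 (blk n).
  apply: (@sum_le_trans _ _ _ _ _ (le_sum_le _ (sum_le_charlier_rem cn (dev n) K))).
    have d0 : 0 <= dev n ^+ 2 / ctr (blk n) by rewrite divr_ge0 ?sqr_ge0 ?(ltW cn).
    apply: ler_pM; rewrite ?divr_ge0 ?exprn_ge0 ?expR_ge0 ?ler_expR ?dev_le//.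
    rewrite ler_wpM2r ?invr_ge0//.
    by rewrite lerXn2r ?nnegrE// dev_le.
  move=> m; have p0 := pois_ge0 m (ltW cn).
  by rewrite [(_ * _) ^+ 2]exprMn ler_wpM2r ?sqr_ge0// expr2 ler_piMr// pois_le1// ltW.
- rewrite mulrC; apply: le_sum_le (sum_leZ e0 sum_le_blk) => n.
  by rewrite mulrC.
rewrite mulrC; apply: le_sum_le (sum_leZ (sqr_ge0 (h2norm f)) b'A) => m.
rewrite mul1r /zcoef normcM normc_sign mul1r.
set F := fun n => (if (blk n < J)%N then
  f n * wt n * (pois m (ctr (blk n)) * charlier_rem (ctr (blk n)) (dev n) K m)%:C else 0).
apply: (@le_trans _ _ ((\sum_(0 <= n < cutoff) normc (F n)) ^+ 2)).
  by rewrite lerXn2r ?nnegrE ?normc_ge0 ?sumr_ge0 ?normc_sum// => i _; exact: normc_ge0.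
apply: (sum_le_CS (u := fun n => normc (f n) ^+ 2) (v := a ^~ m)) => //.
- by move=> i; exact: sqr_ge0.
- by move=> i; exact: normc_ge0.
- move=> n; rewrite /F /a; case: ifP => _; last by rewrite normc0 expr0n !mul0r mulr0.
  rewrite normcM_sqr [normc (f n * _) ^+ 2]normcM_sqr normc_wt normc_real_sqr.
  by rewrite le_eqVlt; apply/orP; left; apply/eqP; rewrite mul1r; ring.
- exact: sum_le_h2norm.
Qed.

Lemma Lop_Sop_norm D f (G : R) : (forall m, sum_le (fun N => normc (pi m N) ^+ 2) (D m)) ->
  (forall n, (J <= blk n)%N -> sum_le (fun m => D m * pois m (logx r n)) G) -> 0 <= G ->
  h2norm (Lop f - Sop f) <=
    (Num.sqrt (CQ r * G) + Num.sqrt ((1 + J%:R ^+ 2 / r) * rem_const)) * h2norm f.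
Proof.
move=> piD DG G0.
have [|E zn] := h2norm_Uc pi_le1 (sum_le_zcoef f).
  by rewrite mulr_ge0 ?sqrtr_ge0 ?h2norm_ge0.
have -> : Lop f - Sop f = Lop (tail f) + toH2 (Uc (zcoef f)).
  by apply: hardy2_eq => N; rewrite Lop_Sop_coef H2D E.
apply: le_trans (h2norm_triangle _ _) _; rewrite mulrDl lerD//.
apply: le_trans (ler_wpM2l (sqrtr_ge0 _) (h2norm_tail f)).
apply: (Lop_weighted piD) => // n; rewrite tailE; case: (ltnP (blk n) J) => [_|Jn _].
  by rewrite eqxx.
exact: DG.
Qed.

Lemma Lop_approx_upper D (G : R) : (forall m, sum_le (fun N => normc (pi m N) ^+ 2) (D m)) ->
  (forall n, (J <= blk n)%N -> sum_le (fun m => D m * pois m (logx r n)) G) -> 0 <= G ->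
  (approx_number Lop (J * K).+1 <=
    (Num.sqrt (CQ r * G) + Num.sqrt ((1 + J%:R ^+ 2 / r) * rem_const))%:E)%E.
Proof.
move=> piD DG G0.
set B := Num.sqrt (CQ r * G) + _.
have B0 : 0 <= B by rewrite addr_ge0 ?sqrtr_ge0.
apply: (@approx_number_le _ _ Sop); last first.
- move=> f f1; apply: le_trans (Lop_Sop_norm f piD DG G0) _.
  by rewrite -/B ler_piMr.
- exact: Sop_rank.
(* [Sop] is bounded because [Lop] and the difference are; the functionals [lam] need no estimate. *)
- apply: (@bounded_operator_h2 _ _ (Num.sqrt (CQ r) + B)); first exact: Sop_linear.
  move=> f.
  have -> : Sop f = Lop f + (-1) *: (Lop f - Sop f).
    by rewrite scaleN1r opprB addrC subrK.
  apply: le_trans (h2norm_triangle _ _) _; rewrite mulrDl.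
  apply: lerD; first exact: Lop_bounded.
  rewrite h2norm_scale normcN normc1 mul1r.
  exact: Lop_Sop_norm.
Qed.

End finite_rank_approximation.

End model_operator.

(** * Lower bound for the model operator: test functions on separated blocks *)

Section lower_bound.
Variables (R : realType) (r tau : R).
Hypothesis r0 : 0 < r.
Local Notation C := R[i].
Local Notation H2 := (hardy2 R).
Variable pi : nat -> nat -> C.
Hypothesis pi_disj : forall m m' N, pi m N != 0 -> pi m' N != 0 -> m = m'.
Hypothesis pi_le1 : forall m, sum_le (fun N => normc (pi m N) ^+ 2) 1.
Implicit Types (f g : H2) (m n N t : nat).
Local Notation lx := (logx r).
Local Notation blk := (blk r).

Lemma blk_unbounded J : (J <= blk (cutoff r J))%N.
Proof. by rewrite leqNgt; apply/negP => /(blk_cutoff r0); rewrite ltnn. Qed.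

(** On block t, r ln n runs from t^2 to (t+1)^2, so the mass is about (2t + 1)/r. The rounding of
    the two ends loses at most 1, which r <= t absorbs. *)
Lemma block_mass t N : (0 < t)%N -> r <= t%:R ->
  (forall n, (blk n <= t)%N -> (n < N)%N) ->
  t%:R / r <= \sum_(0 <= n < N | blk n == t) n.+1%:R^-1.
Proof.
move=> t0 rt tN.
have exa : exists n, (t <= blk n)%N by exists (cutoff r t); exact: blk_unbounded.
have exb : exists n, (t < blk n)%N by exists (cutoff r t.+1); exact: blk_unbounded.
case: (ex_minnP exa) => a ta amin; case: (ex_minnP exb) => b tb bmin.
have ab : (a <= b)%N by apply: amin; exact: ltnW.
have bN : (b <= N)%N.
  rewrite leqNgt; apply/negP => Nb.
  have : (blk N <= t)%N by rewrite leqNgt; apply/negP => /bmin; rewrite leqNgt Nb.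
  by move=> /tN; rewrite ltnn.
have H1 : ln b.+1%:R - ln a.+1%:R <= \sum_(a <= n < b) n.+1%:R^-1 :> R.
  rewrite -(telescope_sumr (fun n => ln n.+1%:R) ab).
  by apply: ler_sum => n _; exact: ln_ratio_le.
have H2' : \sum_(a <= n < b) n.+1%:R^-1 <= \sum_(0 <= n < N | blk n == t) n.+1%:R^-1 :> R.
  rewrite [leRHS](big_cat_nat (n := a)) ?(leq_trans ab)//= [X in _ <= _ + X](big_cat_nat (n := b))//=.
  rewrite addrCA; apply: ler_wpDr; first by rewrite addr_ge0// sumr_ge0.
  rewrite [leRHS]big_nat_cond [leLHS]big_nat_cond le_eqVlt; apply/orP; left; apply/eqP.
  apply: eq_bigl => n; rewrite andbT; case: (boolP (a <= n < b)%N) => //= /andP[an nb].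
  apply/esym; rewrite eqn_leq (leq_trans ta (blk_le r0 an)) andbT leqNgt.
  by apply/negP => /bmin; rewrite leqNgt nb.
apply: le_trans (le_trans H1 H2').
have H3 : t.+1%:R ^+ 2 / r <= ln b.+1%:R.
  rewrite ler_pdivrMr// mulrC -/(lx b); have /andP[h _] := blk_itv r0 b.
  by apply: le_trans h; rewrite lerXn2r ?nnegrE// ler_nat.
have H4 : ln a.+1%:R <= t%:R ^+ 2 / r + 1.
  case: a {exa ta ab H1 H2'} amin => [_|a amin].
    by rewrite ln1 addr_ge0// divr_ge0 ?sqr_ge0// ltW.
  have ba : (blk a < t)%N by rewrite ltnNge; apply/negP => /amin; rewrite ltnn.
  have h1 : ln a.+1%:R <= t%:R ^+ 2 / r.
    rewrite ler_pdivlMr// mulrC -/(lx a); have /andP[_ /ltW h] := blk_itv r0 a.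
    by apply: le_trans h _; rewrite lerXn2r ?nnegrE// ler_nat.
  have h2 : ln a.+2%:R - ln a.+1%:R <= 1 :> R.
    by apply: le_trans (ln_ratio_le _ _) _; rewrite invf_le1 ?ltr0n// ler1n.
  lra.
have -> : t%:R / r = ((t%:R + 1) ^+ 2 / r - t%:R ^+ 2 / r - 1) - ((t%:R + 1 - r) / r).
  by field; rewrite gt_eqF.
have H5 : 0 <= (t%:R + 1 - r) / r.
  by rewrite divr_ge0 ?(ltW r0)//; lra.
move: H3; rewrite -(natr1 t); lra.
Qed.

(** Diagonal dominance, to be summed over degrees with h_i = [bump i m]. Moving the negative part to
    the right gives there half the sum of (u_i + u_j)^2 h_i h_j over all i, j, of which the diagonal
    is kept. *)
Lemma real_quad (n : nat) (u h : 'I_n -> R) : (forall i, 0 <= h i) ->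
  \sum_i u i ^+ 2 * (2 * h i ^+ 2 - h i * \sum_j h j) <= (\sum_i u i * h i) ^+ 2.
Proof.
move=> h0.
have E1 : (\sum_i u i * h i) ^+ 2 = \sum_i \sum_j (u i * h i) * (u j * h j).
  by rewrite expr2 mulr_suml; apply: eq_bigr => i _; rewrite mulr_sumr.
have E2 : \sum_i u i ^+ 2 * (h i * \sum_j h j) = \sum_i \sum_j u i ^+ 2 * (h i * h j).
  by apply: eq_bigr => i _; rewrite !mulr_sumr.
have E3 : \sum_i \sum_j u i ^+ 2 * (h i * h j) = \sum_i \sum_j u j ^+ 2 * (h i * h j).
  by rewrite exchange_big/=; apply: eq_bigr => i _; apply: eq_bigr => j _; rewrite (mulrC (h i)).
under eq_bigr do rewrite mulrBr; rewrite sumrB lerBlDr.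
have E4 : (\sum_i u i * h i) ^+ 2 + \sum_i u i ^+ 2 * (h i * \sum_j h j) =
   \sum_i \sum_j 2^-1 * ((u i + u j) ^+ 2 * (h i * h j)).
  have -> : \sum_i u i ^+ 2 * (h i * \sum_j h j) =
    \sum_i \sum_j (2^-1 * (u i ^+ 2 * (h i * h j)) + 2^-1 * (u j ^+ 2 * (h i * h j))).
    transitivity (2^-1 * (\sum_i \sum_j u i ^+ 2 * (h i * h j)) +
      2^-1 * (\sum_i \sum_j u j ^+ 2 * (h i * h j))); first by rewrite -E3 E2; field.
    rewrite !mulr_sumr -big_split/=; apply: eq_bigr => i _.
    by rewrite !mulr_sumr -big_split.
  rewrite E1 -big_split/=; apply: eq_bigr => i _; rewrite -big_split/=.
  by apply: eq_bigr => j _; field.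
rewrite E4; apply: ler_sum => i _; rewrite (bigD1 i)//=.
have -> : 2^-1 * ((u i + u i) ^+ 2 * (h i * h i)) = u i ^+ 2 * (2 * h i ^+ 2) by field.
rewrite lerDl sumr_ge0// => j _.
by rewrite mulr_ge0// mulr_ge0 ?sqr_ge0// mulr_ge0.
Qed.

Lemma normc_sqrE (x : C) : normc x ^+ 2 = complex.Re x ^+ 2 + complex.Im x ^+ 2.
Proof. by case: x => a b; rewrite /= sqr_sqrtr// addr_ge0 ?sqr_ge0. Qed.

Lemma complex_quad (n : nat) (x : 'I_n -> C) (h : 'I_n -> R) : (forall i, 0 <= h i) ->
  \sum_i normc (x i) ^+ 2 * (2 * h i ^+ 2 - h i * \sum_j h j) <=
  normc (\sum_i x i * (h i)%:C) ^+ 2.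
Proof.
move=> h0; rewrite [leRHS]normc_sqrE Re_sum Im_sum.
have -> : \sum_i complex.Re (x i * (h i)%:C) = \sum_i complex.Re (x i) * h i.
  by apply: eq_bigr => i _; case: (x i) => a b /=; rewrite mulr0 subr0.
have -> : \sum_i complex.Im (x i * (h i)%:C) = \sum_i complex.Im (x i) * h i.
  by apply: eq_bigr => i _; case: (x i) => a b /=; rewrite mulr0 add0r.
under eq_bigr do rewrite normc_sqrE mulrDl.
by rewrite big_split/= lerD// real_quad.
Qed.

Lemma inv_sqr_sum n : \sum_(0 <= k < n) (k.+1%:R ^+ 2)^-1 <= 2 :> R.
Proof.
suff : \sum_(0 <= k < n.+1) (k.+1%:R ^+ 2)^-1 <= 2 - n.+1%:R^-1 :> R.
  rewrite big_nat_recr//= => h.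
  apply: (le_trans (le_trans _ h)); first by rewrite lerDl invr_ge0 sqr_ge0.
  by rewrite gerBl invr_ge0.
elim: n => [|n IH]; first by rewrite big_nat1 expr1n invr1; lra.
rewrite big_nat_recr//=; apply: le_trans (lerD IH (lexx _)) _.
rewrite -(natr1 n.+1); have : 1 <= n.+1%:R :> R by rewrite ler1n.
move: (n.+1%:R) => a a1.
rewrite -subr_ge0.
have -> : 2 - (a + 1)^-1 - (2 - a^-1 + ((a + 1) ^+ 2)^-1) = (a * (a + 1) ^+ 2)^-1.
  by field; apply/andP; split; apply/lt0r_neq0; lra.
by rewrite invr_ge0 mulr_ge0 ?sqr_ge0//; apply: le_trans a1.
Qed.

(** The two truncated differences add up to |i - j|; each side of i contributes at most the sum of
    1/k^2, bounded by 2. *)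
Lemma inv_dist_sum (J : nat) (i : 'I_J) :
  \sum_(j < J | j != i) ((i - j + (j - i))%N%:R ^+ 2)^-1 <= 4 :> R.
Proof.
have -> : 4 = 2 + 2 :> R by lra.
have iJ : (i <= J)%N by rewrite ltnW.
rewrite (eq_bigl (fun j : 'I_J => (j : nat) != i))//.
rewrite -(big_mkord (fun j => j != i :> nat) (fun j => ((i - j + (j - i))%N%:R ^+ 2)^-1)).
rewrite (big_cat_nat (n := i))//=; apply: lerD.
  rewrite big_nat_rev/= add0n; apply: le_trans (inv_sqr_sum i).
  rewrite big_mkcond big_nat_cond [leRHS]big_nat_cond.
  apply: ler_sum => j /andP[/andP[_ ji] _]; case: ifP => _; last by rewrite invr_ge0 sqr_ge0.
  have -> : (i - (i - j.+1) + (i - j.+1 - i))%N = j.+1 by lia.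
  by [].
have [J0|J0] := leqP J i; first by rewrite big_geq.
rewrite big_ltn_cond// eqxx/=; apply: le_trans (inv_sqr_sum (J - i.+1)).
rewrite big_mkcond -{1}(add0n i.+1) big_addn.
apply: ler_sum => j _; case: ifP => _; last by rewrite invr_ge0 sqr_ge0.
have -> : (i - (j + i.+1) + (j + i.+1 - i))%N = j.+1 by lia.
by [].
Qed.

Lemma window_bound (a : nat) : (0 < a)%N -> ((4 * a ^ 2).+1 <= (3 * a) ^ 2)%N.
Proof.
move=> a0; have : (0 < a ^ 2)%N by rewrite expn_gt0 a0.
by rewrite expnMn; move: (a ^ 2)%N => b; clear; lia.
Qed.

Section blocks.
Variables (A J : nat).
Hypotheses (A1 : (1 < A)%N) (J0 : (0 < J)%N).
Let T : nat := (A * J)%N.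
Hypothesis rT : r <= T%:R.
(* The blocks used are A apart, so that the overlaps expR (- A^2 (i - j)^2 / 2) of
   their Poisson distributions make the Gram matrix diagonally dominant. *)
Hypothesis A_large : 256 * expR 21 <= A.-1%:R ^+ 2 :> R.

(** For i < J these blocks lie between T = AJ and 2T, so that all degrees involved are of order
    T^2. *)
Definition tt (i : nat) : nat := (A * (J + i))%N.

Let T0 : (0 < T)%N. Proof. by rewrite muln_gt0 J0 (ltnW A1). Qed.

Let Nc : nat := cutoff r (2 * T).

Lemma tt_ge i : (T <= tt i)%N. Proof. by rewrite /T /tt leq_mul2l leq_addr orbT. Qed.

Lemma tt_lt (i : 'I_J) : (tt i < 2 * T)%N.
Proof. by rewrite /T /tt mulnCA ltn_mul2l (ltnW A1)/= mul2n -addnn ltn_add2l. Qed.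

Lemma tt_inj (i j : 'I_J) : tt i = tt j -> i = j.
Proof.
by move=> /eqP; rewrite /tt eqn_mul2l (gtn_eqF (ltnW A1))/= eqn_add2l => /eqP/val_inj.
Qed.

Lemma tt_Nc (i : 'I_J) n : (blk n <= tt i)%N -> (n < Nc)%N.
Proof. by move=> h; apply: (blk_cutoff r0); exact: leq_ltn_trans h (tt_lt i). Qed.

Definition mass (i : 'I_J) : R := \sum_(0 <= n < Nc | blk n == tt i) n.+1%:R^-1.

Lemma mass_ge i : T%:R / r <= mass i.
Proof.
have h : (T%:R <= (tt i)%:R :> R) by rewrite ler_nat tt_ge.
apply: (@le_trans _ _ ((tt i)%:R / r)); first by rewrite ler_wpM2r ?invr_ge0 ?(ltW r0).
apply: block_mass; first exact: leq_trans T0 (tt_ge i).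
  exact: le_trans rT h.
exact: tt_Nc.
Qed.

Lemma mass_gt0 i : 0 < mass i.
Proof. by apply: lt_le_trans (mass_ge i); rewrite divr_gt0// ltr0n. Qed.

(** The average of the Poisson laws over block [tt i] with respect to the normalized weights 1/n; up
    to the sign (-1)^m it is the image of the test function [ff i]. *)
Definition bump (i : 'I_J) m : R :=
  (mass i)^-1 * \sum_(0 <= n < Nc | blk n == tt i) pois m (lx n) / n.+1%:R.

Lemma bump_ge0 i m : 0 <= bump i m.
Proof.
rewrite mulr_ge0 ?invr_ge0 ?(ltW (mass_gt0 i))// sumr_ge0// => n _.
by rewrite divr_ge0// pois_ge0// logx_ge0// ltW.
Qed.

Lemma wt_neq0 n : wt tau n != 0.
Proof.
apply/eqP => w0; have := normc_wt tau n; rewrite w0 normc0 expr0n/= => /esym/eqP.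
by rewrite invr_eq0 pnatr_eq0.
Qed.

(** Division by [wt] cancels the phase of n^(-c1), so no cancellation occurs in the sum defining
    [Tc]; the modulus is n^(-1/2) divided by the mass of the block, for the integer n.+1. *)
Definition fcoef (i : 'I_J) n : C := if (blk n == tt i) then
  ((mass i)^-1 / n.+1%:R)%:C / wt tau n else 0.

Lemma fcoef_sqr i n : normc (fcoef i n) ^+ 2 =
  (if blk n == tt i then (mass i)^-1 ^+ 2 / n.+1%:R else 0).
Proof.
rewrite /fcoef; case: ifP => _; last by rewrite normc0 expr0n.
rewrite normcM_sqr normc_real_sqr normcV [(normc _)^-1 ^+ 2]exprVn normc_wt invrK.
by field; rewrite ?(gt_eqF (mass_gt0 i)) addrC natr1 pnatr_eq0.
Qed.

Lemma sum_le_fcoef i : sum_le (fun n => normc (fcoef i n) ^+ 2) (mass i)^-1.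
Proof.
have -> : (mass i)^-1 = \sum_(0 <= n < Nc) normc (fcoef i n) ^+ 2.
  under eq_bigr do rewrite fcoef_sqr; rewrite -big_mkcond/= -mulr_sumr -/(mass i).
  by rewrite expr2 mulfVK// gt_eqF// mass_gt0.
apply: sum_le_fin => [n|n nN]; first exact: sqr_ge0.
rewrite fcoef_sqr; case: eqP => // h; have := @tt_Nc i n; rewrite h leqnn => /(_ isT).
by rewrite ltnNge nN.
Qed.

Definition ff (i : 'I_J) : H2 := toH2 (fcoef i).

Lemma ffE i n : ff i n = fcoef i n.
Proof. by rewrite /ff (toH2E (@sum_le_fcoef i)). Qed.

Lemma Tc_ff i m : Tc r tau (ff i) m = (-1) ^+ m * (bump i m)%:C.
Proof.
rewrite /Tc; congr (_ * _).
rewrite (@csum_fin _ _ Nc).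
  rewrite /bump mulr_sumr rmorph_sum/= big_mkcond [RHS]big_mkcond; apply: eq_bigr => n _.
  rewrite /Tterm ffE /fcoef; case: ifP => _; last by rewrite mul0r.
  rewrite mulrA divfK ?wt_neq0// -rmorphM/=; congr (_%:C); ring.
move=> n nN; rewrite /Tterm ffE /fcoef; case: eqP => [h|]; last by rewrite mul0r.
have := @tt_Nc i n; rewrite h leqnn => /(_ isT).
by rewrite ltnNge nN.
Qed.

Lemma Tc_sum (x : 'I_J -> C) m : Tc r tau (\sum_i x i *: ff i) m =
  (-1) ^+ m * \sum_i x i * (bump i m)%:C.
Proof.
transitivity (\sum_i x i * Tc r tau (ff i) m); last first.
  by rewrite mulr_sumr; apply: eq_bigr => i _; rewrite Tc_ff; ring.
elim: (index_enum _) => [|i s IH].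
  rewrite !big_nil /Tc (_ : csum _ = 0) ?mulr0// -[RHS]csum0; apply: eq_csum => n.
  by rewrite /Tterm (_ : (0 : H2) n = 0)// mul0r.
by rewrite !big_cons TcD// IH.
Qed.

Lemma block_norm (x : 'I_J -> C) : \sum_i normc (x i) ^+ 2 = 1 ->
  h2norm (\sum_i x i *: ff i) <= Num.sqrt (r / T%:R).
Proof.
move=> x1; apply: h2norm_le; first exact: sqrtr_ge0.
rewrite sqr_sqrtr; last by rewrite divr_ge0// ltW.
have coefE n : normc ((\sum_i x i *: ff i) n) ^+ 2 = \sum_i normc (x i) ^+ 2 * normc (fcoef i n) ^+ 2.
  rewrite H2_sum (eq_bigr (fun i => x i * fcoef i n)); last by move=> i _; rewrite -ffE.
  have [[i0 i0P]|nex] := pselect (exists i : 'I_J, blk n = tt i).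
    have z j : j != i0 -> fcoef j n = 0.
      move=> ji; rewrite /fcoef ifF//; apply/eqP => h; case/eqP: ji; apply: tt_inj.
      by rewrite -h.
    rewrite (bigD1 i0)//= [X in _ + X]big1 ?addr0; last first.
      by move=> j ji; rewrite z// mulr0.
    rewrite (bigD1 i0)//= [X in _ = _ + X]big1 ?addr0; last first.
      by move=> j ji; rewrite z// normc0 expr0n mulr0.
    by rewrite normcM_sqr.
  have z j : fcoef j n = 0.
    by rewrite /fcoef ifF//; apply/eqP => h; apply: nex; exists j.
  rewrite big1 ?normc0 ?expr0n/=; last by move=> j _; rewrite z mulr0.
  by rewrite big1// => j _; rewrite z normc0 expr0n mulr0.
move=> N; under eq_bigr do rewrite coefE.
rewrite exchange_big/=.
apply: (@le_trans _ _ (\sum_i normc (x i) ^+ 2 * (r / T%:R))).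
  apply: ler_sum => i _; rewrite -mulr_sumr ler_wpM2l ?sqr_ge0//.
  apply: le_trans (sum_le_fcoef i N) _.
  rewrite -[leRHS]invf_div lef_pV2 ?posrE ?mass_gt0 ?mass_ge//.
  by rewrite divr_gt0// ltr0n.
by rewrite -mulr_suml x1 mul1r.
Qed.

(** The window from T^2 to 4 T^2 contains the degrees t^2, ..., t^2 + t for every block t =
    [tt i]. *)
Let m1 := (T ^ 2)%N.
Let m2 := (4 * T ^ 2).+1%N.

Lemma sqrt_lx_ge i n : blk n = tt i -> T%:R <= Num.sqrt (lx n).
Proof.
move=> h; have /andP[h1 _] := blk_itv r0 n.
rewrite -[leLHS]ger0_norm// -sqrtr_sqr ler_wsqrtr//; apply: le_trans h1.
by rewrite lerXn2r ?nnegrE// ler_nat h tt_ge.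
Qed.

(** For t^2 <= m <= t^2 + t, every mean x of block t satisfies (x - m)^2 <= 9x, hence P_m(x) >=
    e^(-10)/sqrt m >= e^(-10)/(4T). More than T degrees contribute the square of this. *)
Lemma bump_diag i : expR (-20) / 16 / T%:R <= \sum_(m1 <= m < m2) bump i m ^+ 2.
Proof.
set t := tt i; have Tt := tt_ge i; have tT := tt_lt i.
have TR : 0 < T%:R :> R by rewrite ltr0n.
have low m : (t ^ 2 <= m)%N -> (m < (t ^ 2 + t).+1)%N -> expR (-10) / (4 * T%:R) <= bump i m.
  move=> tm mt.
  rewrite /bump [leRHS]mulrC ler_pdivlMr ?mass_gt0// /mass mulr_sumr.
  apply: ler_sum => n /eqP bn.
  rewrite ler_wpM2r ?invr_ge0//.
  have /andP[h1 h2] := blk_itv r0 n; rewrite bn -/t in h1 h2.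
  have t0 : (0 < t)%N by exact: leq_trans T0 Tt.
  have t1 : 1 <= t%:R :> R by rewrite ler1n.
  have m0 : (0 < m)%N by apply: leq_trans tm; rewrite expn_gt0 t0.
  have tmR : t%:R ^+ 2 <= m%:R :> R by rewrite -natrX ler_nat.
  have mtR : m%:R <= t%:R ^+ 2 + t%:R :> R by rewrite -natrX -natrD ler_nat -ltnS.
  have lx0 : 0 < lx n by apply: lt_le_trans h1; rewrite exprn_gt0// ltr0n.
  have dm : (lx n - m%:R) ^+ 2 <= 9 * lx n.
    apply: (@le_trans _ _ (9 * t%:R ^+ 2)); last by rewrite ler_wpM2l.
    have -> : 9 * t%:R ^+ 2 = (3 * t%:R) ^+ 2 :> R by ring.
    rewrite -(natr1 t) in h2; move: (t%:R) (m%:R) (lx n) t1 tmR mtR h1 h2 {lx0} => a b c.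
    nra.
  apply: le_trans (pois_lower m0 lx0 dm).
  have -> : - 9 - 1 = - 10 :> R by lra.
  rewrite ler_wpM2l ?expR_ge0// lef_pV2 ?posrE ?sqrtr_gt0 ?ltr0n ?mulr_gt0//.
  have h4 : 0 <= 4 * T%:R :> R by rewrite mulr_ge0.
  rewrite -[leRHS]ger0_norm// -sqrtr_sqr ler_wsqrtr//.
  apply: (le_trans mtR).
  have h5 : t%:R <= 2 * T%:R :> R by rewrite -natrM ler_nat ltnW.
  have h6 : 1 <= T%:R :> R by rewrite ler1n.
  move: (T%:R) (t%:R) h5 h6 t1 => a b; nra.
have tm2 : ((t ^ 2 + t).+1 <= m2)%N.
  rewrite /m2 ltnS; have h : (t.+1 <= 2 * T)%N by [].
  have -> : (4 * T ^ 2 = (2 * T) * (2 * T))%N by ring.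
  have -> : (t ^ 2 + t = t * t.+1)%N by ring.
  by apply: leq_mul => //; exact: ltnW.
have m1t : (m1 <= t ^ 2)%N by rewrite leq_exp2r.
have tt2 : (t ^ 2 <= (t ^ 2 + t).+1)%N by rewrite ltnW// ltnS leq_addr.
rewrite (big_cat_nat (n := (t ^ 2)%N))//=; last exact: leq_trans tt2 tm2.
rewrite (big_cat_nat (n := (t ^ 2 + t).+1%N) (p := m2))//=.
apply: ler_wpDl; first by rewrite sumr_ge0// => m _; exact: sqr_ge0.
apply: ler_wpDr; first by rewrite sumr_ge0// => m _; exact: sqr_ge0.
apply: (@le_trans _ _ (\sum_(t ^ 2 <= m < (t ^ 2 + t).+1) (expR (-10) / (4 * T%:R)) ^+ 2)).
  rewrite sumr_const_nat -addnS addKn -[leRHS]mulr_natr.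
  apply: (@le_trans _ _ ((expR (-10) / (4 * T%:R)) ^+ 2 * T%:R)); last first.
    by rewrite ler_wpM2l ?sqr_ge0// ler_nat ltnW// ltnS.
  have -> : expR (-20) = expR (-10) ^+ 2 :> R by rewrite -expRM_natl; congr expR; lra.
  rewrite le_eqVlt; apply/orP; left; apply/eqP; field.
  by rewrite gt_eqF.
apply: ler_sum_nat => m /andP[a b].
by rewrite lerXn2r ?nnegrE ?bump_ge0 ?low// divr_ge0 ?expR_ge0// mulr_ge0.
Qed.

(** The product is s^2, with s the term of the Hellinger sum: one s is at most e/T, the other is
    summed. As the blocks are A|i - j| apart and have unit length, the gap in the scale sqrt x is at
    least (A - 1)|i - j|, and e^(-d) <= 1/d leaves a summable decay. *)
Lemma pois_overlap (i j : 'I_J) n n' (N : nat) : i != j -> blk n = tt i -> blk n' = tt j ->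
  \sum_(m1 <= m < N) pois m (lx n) * pois m (lx n') <=
  expR 1 / T%:R * (2 / A.-1%:R ^+ 2) * ((i - j + (j - i))%N%:R ^+ 2)^-1.
Proof.
move=> ij bn bn'.
have TR : 0 < T%:R :> R by rewrite ltr0n.
have l0 k : 0 <= lx k by rewrite logx_ge0// ltW.
have A0 : 0 < A.-1%:R :> R by rewrite ltr0n -ltnS prednK// ltnW.
set k := (i - j + (j - i))%N.
have k0 : (0 < k)%N.
  by rewrite /k addn_gt0 !subn_gt0 orbC -neq_ltn; apply: contraNneq ij => h; apply/eqP/val_inj.
have k0R : 0 < k%:R :> R by rewrite ltr0n.
pose s m := Num.sqrt (pois m (lx n) * pois m (lx n')).
have pu k' i' m : blk k' = tt i' -> pois m (lx k') <= expR 1 / T%:R.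
  move=> h; have sq := sqrt_lx_ge h.
  have lk : 0 < lx k' by rewrite -sqrtr_gt0 (lt_le_trans TR).
  apply: le_trans (pois_upper m lk) _.
  by rewrite ler_wpM2l ?expR_ge0// lef_pV2 ?posrE// (lt_le_trans TR).
have s0 m : 0 <= s m by exact: sqrtr_ge0.
have sE m : pois m (lx n) * pois m (lx n') = s m ^+ 2.
  by rewrite sqr_sqrtr// mulr_ge0 ?pois_ge0.
have su m : s m <= expR 1 / T%:R.
  have e0 : 0 <= expR 1 / T%:R :> R by rewrite divr_ge0 ?expR_ge0.
  rewrite -[leRHS]ger0_norm// -sqrtr_sqr ler_wsqrtr// expr2.
  by apply: ler_pM; rewrite ?pois_ge0//; [exact: pu bn|exact: pu bn'].
have hell := pois_hellinger (l0 n) (l0 n').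
set d := (Num.sqrt (lx n) - Num.sqrt (lx n')) ^+ 2 / 2 in hell.
apply: (@le_trans _ _ (expR 1 / T%:R * \sum_(0 <= m < N) s m)).
  have [mN|mN] := leqP m1 N; last first.
    rewrite big_geq ?(ltnW mN)//; apply: mulr_ge0; first by rewrite divr_ge0 ?expR_ge0.
    by apply: sumr_ge0.
  rewrite [X in _ <= _ * X](big_cat_nat (n := m1))//= mulrDr.
  apply: ler_wpDl; first by rewrite mulr_ge0 ?divr_ge0 ?expR_ge0// sumr_ge0// => m _; exact: s0.
  rewrite mulr_sumr; apply: ler_sum => m _.
  by rewrite sE expr2 ler_wpM2r.
rewrite -[leRHS]mulrA ler_wpM2l ?divr_ge0 ?expR_ge0//.
apply: le_trans (hell N) _.
have dk : (A.-1%:R * k%:R) ^+ 2 / 2 <= d.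
  rewrite ler_wpM2r ?invr_ge0//.
  have itv n0 i0 : blk n0 = tt i0 -> (tt i0)%:R <= Num.sqrt (lx n0) < (tt i0)%:R + 1.
    by move=> h; have := truncn_itv (sqrtr_ge0 (lx n0)); rewrite -/(blk n0) h natr1.
  have key (a b : nat) (x y : R) : a%:R <= x < a%:R + 1 -> b%:R <= y < b%:R + 1 ->
     forall c : nat, (b + c.+1 <= a)%N -> c%:R ^+ 2 <= (x - y) ^+ 2.
    move=> /andP[ax _] /andP[_ yb] c bca.
    have h : b%:R + (c%:R + 1) <= a%:R :> R by rewrite natr1 -natrD ler_nat.
    have c0 : 0 <= c%:R :> R by [].
    rewrite lerXn2r ?nnegrE//; lra.
  have /orP[ji|ji] : (j < i)%N || (i < j)%N.
    by rewrite -neq_ltn; apply: contraNneq ij => h; apply/eqP/val_inj.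
  - have kE : k = (i - j)%N by rewrite /k; lia.
    rewrite -natrM; apply: (key _ _ _ _ (itv _ _ bn) (itv _ _ bn')).
    rewrite kE /tt; nia.
  - have kE : k = (j - i)%N by rewrite /k; lia.
    rewrite -natrM -[leRHS]sqrrN opprB; apply: (key _ _ _ _ (itv _ _ bn') (itv _ _ bn)).
    rewrite kE /tt; nia.
have d0 : 0 < d by apply: lt_le_trans dk; rewrite divr_gt0// exprn_gt0// mulr_gt0.
apply: (@le_trans _ _ d^-1).
  rewrite expRN lef_pV2 ?posrE ?expR_gt0//.
  by apply: le_trans (expR_ge1Dx d); rewrite lerDr.
have -> : 2 / A.-1%:R ^+ 2 * (k%:R ^+ 2)^-1 = ((A.-1%:R * k%:R) ^+ 2 / 2)^-1 :> R.
  by field; rewrite !gt_eqF.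
by rewrite lef_pV2 ?posrE// divr_gt0// exprn_gt0// mulr_gt0.
Qed.

Lemma bump_overlap (i j : 'I_J) N : i != j ->
  \sum_(m1 <= m < N) bump i m * bump j m <=
  expR 1 / T%:R * (2 / A.-1%:R ^+ 2) * ((i - j + (j - i))%N%:R ^+ 2)^-1.
Proof.
move=> ij; set q := expR 1 / _ * _ * _.
pose w n : R := n.+1%:R^-1.
have -> : \sum_(m1 <= m < N) bump i m * bump j m = ((mass i)^-1 * (mass j)^-1) *
  \sum_(0 <= n < Nc | blk n == tt i) \sum_(0 <= n' < Nc | blk n' == tt j)
    w n * w n' * \sum_(m1 <= m < N) pois m (lx n) * pois m (lx n').
  transitivity ((mass i)^-1 * (mass j)^-1 * \sum_(m1 <= m < N)
    \sum_(0 <= n < Nc | blk n == tt i) \sum_(0 <= n' < Nc | blk n' == tt j)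
      w n * w n' * (pois m (lx n) * pois m (lx n'))).
    rewrite mulr_sumr; apply: eq_bigr => m _; rewrite /bump mulrACA; congr (_ * _).
    rewrite mulr_suml; apply: eq_bigr => n _; rewrite mulr_sumr; apply: eq_bigr => n' _.
    by rewrite /w; ring.
  congr (_ * _); rewrite exchange_big/=; apply: eq_bigr => n _.
  rewrite exchange_big/=; apply: eq_bigr => n' _.
  by rewrite mulr_sumr.
rewrite -invfM mulrC ler_pdivrMr ?mulr_gt0 ?mass_gt0//.
apply: (@le_trans _ _ (\sum_(0 <= n < Nc | blk n == tt i)
   \sum_(0 <= n' < Nc | blk n' == tt j) w n * w n' * q)).
  apply: ler_sum => n /eqP bn; apply: ler_sum => n' /eqP bn'.
  by rewrite ler_wpM2l ?mulr_ge0 ?invr_ge0//; exact: pois_overlap.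
rewrite le_eqVlt; apply/orP; left; apply/eqP.
rewrite /mass mulr_suml mulr_sumr; apply: eq_bigr => n _.
rewrite [RHS]mulrA mulr_sumr; apply: eq_bigr => n' _.
by rewrite /w; ring.
Qed.

(** [complex_quad] is applied in each degree; after summation over the window the diagonal term is
    at least twice the bound for the sum of the overlaps with the other blocks. *)
Lemma block_gram (x : 'I_J -> C) : \sum_i normc (x i) ^+ 2 = 1 ->
  expR (-20) / 32 / T%:R <= \sum_(m1 <= m < m2) normc (Tc r tau (\sum_i x i *: ff i) m) ^+ 2.
Proof.
move=> x1.
have TR : 0 < T%:R :> R by rewrite ltr0n.
have A0 : 0 < A.-1%:R :> R by rewrite ltr0n -ltnS prednK// ltnW.
apply: (@le_trans _ _ (\sum_(m1 <= m < m2) \sum_i normc (x i) ^+ 2 *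
   (2 * bump i m ^+ 2 - bump i m * \sum_j bump j m))); last first.
  apply: ler_sum => m _; rewrite Tc_sum normcM_sqr normc_sign expr1n mul1r.
  by apply: complex_quad => i; exact: bump_ge0.
rewrite exchange_big/=.
suff K i : expR (-20) / 32 / T%:R <=
    \sum_(m1 <= m < m2) (2 * bump i m ^+ 2 - bump i m * \sum_j bump j m).
  rewrite -[leLHS]mul1r -[X in X * _ <= _]x1 mulr_suml; apply: ler_sum => i _.
  apply: le_trans (_ : normc (x i) ^+ 2 * \sum_(m1 <= m < m2)
      (2 * bump i m ^+ 2 - bump i m * \sum_j bump j m) <= _).
    by apply: ler_wpM2l; [exact: sqr_ge0|exact: K].
  by rewrite mulr_sumr.
have -> : \sum_(m1 <= m < m2) (2 * bump i m ^+ 2 - bump i m * \sum_j bump j m) =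
  \sum_(m1 <= m < m2) bump i m ^+ 2 -
  \sum_(j < J | j != i) \sum_(m1 <= m < m2) bump i m * bump j m.
  rewrite exchange_big/= -sumrB; apply: eq_bigr => m _.
  by rewrite (bigD1 i)//= mulrDr -mulr_sumr; ring.
have D := bump_diag i.
have O : \sum_(j < J | j != i) \sum_(m1 <= m < m2) bump i m * bump j m <=
   expR 1 / T%:R * (2 / A.-1%:R ^+ 2) * 4.
  apply: (@le_trans _ _ (\sum_(j < J | j != i) expR 1 / T%:R * (2 / A.-1%:R ^+ 2) *
     ((i - j + (j - i))%N%:R ^+ 2)^-1)).
    by apply: ler_sum => j ji; apply: bump_overlap; rewrite eq_sym.
  rewrite -mulr_sumr; apply: ler_wpM2l; last exact: inv_dist_sum.
  by rewrite mulr_ge0 ?divr_ge0 ?expR_ge0 ?sqr_ge0.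
(* This requires 8e/(A-1)^2 <= e^(-20)/32, the origin of the constant 256 e^21. *)
have O2 : expR 1 / T%:R * (2 / A.-1%:R ^+ 2) * 4 <= expR (-20) / 32 / T%:R :> R.
  apply: (@le_trans _ _ ((8 * expR 1 / A.-1%:R ^+ 2) / T%:R)).
    by rewrite le_eqVlt; apply/orP; left; apply/eqP; field; rewrite !gt_eqF.
  rewrite ler_wpM2r ?invr_ge0// ler_pdivrMr ?exprn_gt0//.
  have h := ler_wpM2l (expR_ge0 (-20 : R)) A_large.
  have e1 : expR (-20) * expR 21 = expR 1 :> R by rewrite -expRD; congr expR; lra.
  move: h; rewrite mulrCA e1; lra.
have h20 := expR_ge0 (-20 : R).
move: D O O2; have -> : expR (-20) / 16 / T%:R = 2 * (expR (-20) / 32 / T%:R) :> R.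
  by field; rewrite gt_eqF.
lra.
Qed.

(** The combinations of the test functions have norm at most sqrt (r/T) and their images at least
    sqrt (d e^(-20)/(32 T)); T cancels in the quotient. *)
Lemma block_lower (d : R) : 0 < d ->
  (forall m, (m1 <= m < m2)%N -> exists L, d <= \sum_(0 <= N < L) normc (pi m N) ^+ 2) ->
  ((Num.sqrt (d * (expR (-20) / 32 / r)))%:E <= approx_number (Lop r tau pi) J)%E.
Proof.
move=> d0 dL.
have TR : 0 < T%:R :> R by rewrite ltr0n.
set b := Num.sqrt (d * (expR (-20) / 32 / T%:R)).
set a := Num.sqrt (r / T%:R).
have a0 : 0 < a by rewrite sqrtr_gt0 divr_gt0.
have b0 : 0 < b by rewrite sqrtr_gt0 mulr_gt0// divr_gt0// divr_gt0// expR_gt0.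
have -> : Num.sqrt (d * (expR (-20) / 32 / r)) = b / a.
  rewrite -sqrtrV ?divr_ge0 ?(ltW r0)// -sqrtrM ?mulr_ge0 ?divr_ge0 ?expR_ge0 ?(ltW d0)//.
  by congr Num.sqrt; field; rewrite !gt_eqF.
have L (x : 'I_J -> C) : \sum_i normc (x i) ^+ 2 = 1 ->
    b <= h2norm (Lop r tau pi (\sum_i x i *: ff i)).
  move=> x1; rewrite -[leRHS]ger0_norm ?h2norm_ge0// -sqrtr_sqr ler_wsqrtr//.
  have H := Lop_lower tau r0 pi_disj pi_le1 (\sum_i x i *: ff i) (ltW d0) dL.
  apply: (le_trans _ H).
  by rewrite ler_wpM2l ?(ltW d0)// block_gram.
apply: (@approx_number_ge R (Lop r tau pi) J ff a b) => //.
- exact: Lop_linear.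
- exact: ltW.
- exact: block_norm.
move=> x x1; have h := L x x1.
have := lt_le_trans b0 (le_trans h (Lop_bounded tau r0 pi_disj pi_le1 _)).
by rewrite pmulr_rgt0// sqrtr_gt0 CQ_gt0.
Qed.

End blocks.

Lemma Lop_approx_lower (e m0 : nat) (cD : R) : 0 < cD ->
  (forall m, (m0 <= m)%N -> exists L,
    cD / Num.sqrt m.+1%:R ^+ e <= \sum_(0 <= N < L) normc (pi m N) ^+ 2) ->
  exists2 c : R, 0 < c & exists J0, forall J, (J0 <= J)%N ->
   ((c / Num.sqrt J%:R ^+ e)%:E <= approx_number (Lop r tau pi) J)%E.
Proof.
move=> cD0 HD.
pose A := (Num.trunc (256 * expR 21 : R)).+2.
have A1 : (1 < A)%N by [].
have AL : 256 * expR 21 <= A.-1%:R ^+ 2 :> R.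
  have p0 : 0 <= 256 * expR 21 :> R by exact: mulr_ge0 (ler0n _ _) (expR_ge0 _).
  have /andP[_ /ltW h] := truncn_itv p0.
  by apply: (le_trans h); rewrite /= -natrX ler_nat leq_pmull.
pose k : R := cD * (expR (-20) / 32 / r) / (3 * A%:R) ^+ e.
have k0 : 0 < k.
  apply: divr_gt0; last by rewrite exprn_gt0// mulr_gt0// ltr0n.
  by rewrite mulr_gt0// divr_gt0// divr_gt0// expR_gt0.
exists (Num.sqrt k); first by rewrite sqrtr_gt0.
exists (maxn 1 (maxn m0 (Num.trunc r).+1)) => J; rewrite !geq_max => /and3P[J0 m0J rJ].
have TJ : (J <= A * J)%N by rewrite leq_pmull.
have rT : r <= (A * J)%:R.
  have /andP[_ /ltW h] := truncn_itv (ltW r0).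
  by apply: (le_trans h); rewrite ler_nat (leq_trans rJ).
have TR : 0 < (A * J)%:R :> R by rewrite ltr0n (leq_trans J0 TJ).
have JR : 0 < J%:R :> R by rewrite ltr0n.
(* A lower bound for D_m on the whole window, where sqrt (m + 1) <= 3AJ by [window_bound]. *)
pose d := cD / (3 * (A * J)%:R) ^+ e.
have d0 : 0 < d by rewrite divr_gt0// exprn_gt0// mulr_gt0.
have -> : Num.sqrt k / Num.sqrt J%:R ^+ e = Num.sqrt (d * (expR (-20) / 32 / r)).
  have -> : Num.sqrt J%:R ^+ e = Num.sqrt (J%:R ^+ e) :> R.
    have h : 0 <= Num.sqrt J%:R ^+ e :> R by rewrite exprn_ge0 ?sqrtr_ge0.
    by rewrite -[LHS]ger0_norm// -sqrtr_sqr -exprM mulnC exprM sqr_sqrtr.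
  rewrite -sqrtrV ?exprn_ge0// -sqrtrM ?(ltW k0)//; congr Num.sqrt.
  rewrite /k /d natrM mulrA !exprMn; field.
  by rewrite !expf_neq0 ?gt_eqF// ltr0n.
apply: (block_lower A1 J0 rT AL d0) => m /andP[h1 h2].
have [|L LP] := HD m.
  apply: leq_trans h1; apply: leq_trans m0J (leq_trans TJ _).
  by rewrite expnS expn1 leq_pmull// (leq_trans J0 TJ).
exists L; apply: le_trans LP; rewrite ler_wpM2l ?(ltW cD0)//.
have s0 : 0 < Num.sqrt m.+1%:R :> R by rewrite sqrtr_gt0 ltr0n.
rewrite lef_pV2 ?posrE ?exprn_gt0 ?mulr_gt0//.
rewrite lerXn2r ?nnegrE ?(ltW s0) ?mulr_ge0//.
have h3 : 0 <= 3 * (A * J)%:R :> R by rewrite mulr_ge0.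
rewrite -[leRHS]ger0_norm// -sqrtr_sqr ler_wsqrtr//.
rewrite -natrM -natrX ler_nat; apply: (leq_trans h2).
have : (0 < A * J)%N by exact: leq_trans J0 TJ.
exact: window_bound.
Qed.

End lower_bound.

(** * Compactness of Hilbert cubes and of the model operator *)

Section hilbert_cube.
Variable R : realType.
Local Notation C := R[i].
Local Notation H2 := (hardy2 R).

Lemma ultra_real_cvg (F : set_system H2) (u : H2 -> R) (s : R) : UltraFilter F ->
  F [set g | `|u g| <= s] ->
  exists a : R, forall e, 0 < e -> F [set g | `|a - u g| <= e].
Proof.
move=> FU Fs; have FF : ProperFilter F by exact: ultra_proper.
have Fs' : F (u @^-1` `[- s, s]).
  by apply: filterS Fs => g /= h; rewrite in_itv/= -ler_norml.
have [a [_ ua]] := @segment_compact R (- s) s (u x @[x --> F]) _ Fs'.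
exists a => e e0.
have [//|Fc] := in_ultra_setVsetC [set g | `|a - u g| <= e] FU.
have Fc' : F (u @^-1` [set x | e < `|a - x|]).
  by apply: filterS Fc => g /= h; rewrite ltNge; apply/negP => h'; exact: h.
have [x []] := ua [set x | e < `|a - x|] (ball a e) Fc' (nbhsx_ballx _ _ e0).
by rewrite /ball/= => h1 h2; have := lt_trans h1 h2; rewrite ltxx.
Qed.

(** Along an ultrafilter the coordinates converge, being bounded. Convergence in norm follows since
    the tails are dominated, uniformly on the cube, by those of c. *)
Lemma hilbert_cube_compact (c : nat -> R) (B : R) : (forall N, 0 <= c N) -> sum_le c B ->
  compact [set g : H2 | forall N, normc (g N) ^+ 2 <= c N].
Proof.
move=> c0 cB; rewrite compact_ultra => F FU FK.
have FF : ProperFilter F by exact: ultra_proper.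
have cn (g : H2) N : normc (g N) ^+ 2 <= c N -> normc (g N) <= Num.sqrt (c N).
  by move=> h; rewrite -[leLHS]ger0_norm ?normc_ge0// -sqrtr_sqr ler_wsqrtr.
have Re_ex N : exists a : R, forall e, 0 < e -> F [set g : H2 | `|a - complex.Re (g N)| <= e].
  apply: (@ultra_real_cvg _ _ (Num.sqrt (c N))) => //.
  by apply: filterS FK => g /= /(_ N)/cn; apply: le_trans; exact: le_Re_normc.
have Im_ex N : exists a : R, forall e, 0 < e -> F [set g : H2 | `|a - complex.Im (g N)| <= e].
  apply: (@ultra_real_cvg _ _ (Num.sqrt (c N))) => //.
  by apply: filterS FK => g /= /(_ N)/cn; apply: le_trans; exact: le_Im_normc.
have [a aP] := choice Re_ex; have [b bP] := choice Im_ex.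
pose p N : C := a N +i* b N.
have pF N e : 0 < e -> F [set g : H2 | normc (p N - g N) <= e].
  move=> e0; have e20 : 0 < e / 2 by rewrite divr_gt0.
  apply: filterS (filterI (aP N _ e20) (bP N _ e20)) => g /= [h1 h2].
  apply: le_trans (normc_le_ReIm _) _; rewrite [leRHS]splitr /p.
  by move: h1 h2; case: (g N) => x y /= h1 h2; exact: lerD.
have pc N : normc (p N) ^+ 2 <= c N.
  rewrite -[leRHS](sqr_sqrtr (c0 N)) lerXn2r ?nnegrE ?normc_ge0 ?sqrtr_ge0//.
  apply/ler_addgt0Pr => e e0.
  have [g [/= gK gp]] := filter_ex (filterI FK (pF N e e0)).
  rewrite -[leLHS]/(normc (p N)).
  have -> : p N = g N + (p N - g N) by rewrite addrC subrK.
  by apply: le_trans (le_normcD _ _) _; apply: lerD => //; exact/cn/gK.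
have pE : toH2 p = p :> (nat -> C) by apply: (@toH2E _ _ B); exact: le_sum_le pc cB.
exists (toH2 p); split; first by move=> N /=; rewrite pE.
apply/(@cvgrPdist_le _ _ _ F _ id) => e e0.
have eE : e = (complex.Re e)%:C.
  apply/eqP; rewrite eq_complex/= eqxx/= eq_sym; case: e e0 => x y /=.
  by rewrite ltcE/= => /andP[/eqP->].
set e' := complex.Re e in eE; have e'0 : 0 < e' by rewrite -ltcR -eE.
(* The tail terms are at most 4 c_N, so a tail e'^2/8 of c accounts for e'^2/2; the first N0
   coordinates account for the other half. *)
have d0 : 0 < e' ^+ 2 / 8 by rewrite divr_gt0// exprn_gt0.
have [N0 N0P] := sum_le_tail c0 cB d0.
have n0 : 0 < e' / (2 * N0.+1%:R) by rewrite divr_gt0// mulr_gt0// ltr0n.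
have Ffin : F [set g : H2 | forall N : 'I_N0, normc (p N - g N) <= e' / (2 * N0.+1%:R)].
  by apply: filter_forall => N; exact: pF.
apply: filterS (filterI FK Ffin) => g /= [gK gN].
rewrite h2_normE eE lecR; apply: h2norm_le; first exact: ltW.
have term N : normc (p N - g N) ^+ 2 <= 4 * c N.
  have h := le_normcD (p N) (- g N); rewrite normcN in h.
  have h1 := pc N; have h2 := gK N.
  have p0 := normc_ge0 (p N); have q0 := normc_ge0 (g N); have r0 := normc_ge0 (p N - g N).
  apply: (@le_trans _ _ ((normc (p N) + normc (g N)) ^+ 2)).
    by rewrite lerXn2r ?nnegrE ?addr_ge0.
  have := sqr_ge0 (normc (p N) - normc (g N)); nra.
have termE N : normc ((toH2 p - g) N) ^+ 2 = normc (p N - g N) ^+ 2.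
  by transitivity (normc (toH2 p N - g N) ^+ 2); [|rewrite pE].
move=> M; under eq_bigr do rewrite termE.
apply: (@le_trans _ _ (e' ^+ 2 / 2 + e' ^+ 2 / 2)); last by rewrite -splitr.
apply: (@le_trans _ _ (\sum_(0 <= N < N0) normc (p N - g N) ^+ 2 +
    \sum_(N0 <= N < maxn M N0) normc (p N - g N) ^+ 2)).
  rewrite -big_cat_nat ?leq_maxr//= [leRHS](big_cat_nat (n := M)) ?leq_maxl//=.
  by rewrite lerDl sumr_ge0// => i _; exact: sqr_ge0.
apply: lerD.
  apply: (@le_trans _ _ (\sum_(0 <= N < N0) (e' / (2 * N0.+1%:R)) ^+ 2)).
    apply: ler_sum_nat => N /= NN0.
    by rewrite lerXn2r ?nnegrE ?normc_ge0 ?(ltW n0)//; exact: (gN (Ordinal NN0)).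
  rewrite sumr_const_nat subn0 -[leLHS]mulr_natr expr_div_n mulrAC ler_pdivrMr; last first.
    by rewrite exprn_gt0// mulr_gt0// ltr0n.
  rewrite -[leRHS]mulrA ler_wpM2l ?sqr_ge0//.
  rewrite exprMn.
  apply: (@le_trans _ _ N0.+1%:R); first by rewrite ler_nat.
  have : 1 <= N0.+1%:R :> R by rewrite ler1n.
  move: (N0.+1%:R) => x x1; nra.
apply: (@le_trans _ _ (\sum_(N0 <= N < maxn M N0) 4 * c N)).
  by apply: ler_sum_nat => N _; exact: term.
rewrite -mulr_sumr; have := N0P N0 (maxn M N0) (leqnn _); lra.
Qed.

Section Lop_compact.
Variables (r tau : R).
Hypothesis r0 : 0 < r.
Variable pi : nat -> nat -> C.
Hypothesis pi_disj : forall m m' N, pi m N != 0 -> pi m' N != 0 -> m = m'.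
Hypothesis pi_le1 : forall m, sum_le (fun N => normc (pi m N) ^+ 2) 1.

Lemma Lop_bounded_operator : bounded_operator (Lop r tau pi).
Proof.
apply: (@bounded_operator_h2 _ _ (Num.sqrt (CQ r))); first exact: Lop_linear.
exact: Lop_bounded.
Qed.

(** The N-th coordinate of an image involves a single degree, so the unit ball is mapped into a
    Hilbert cube whose squared sides are summable because D is. *)
Lemma Lop_compact (D : nat -> R) (A : R) :
  (forall m, sum_le (fun N => normc (pi m N) ^+ 2) (D m)) -> sum_le D A ->
  compact_operator (Lop r tau pi).
Proof.
move=> piD DA; split; first exact: Lop_bounded_operator.
have [b' piN b'A] := @sum_le_fubini R (fun m N => normc (pi m N) ^+ 2) D A
  (fun m N => sqr_ge0 _) piD DA.
have Q0 := ltW (CQ_gt0 r0).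
have c0 N : 0 <= CQ r * b' N by rewrite mulr_ge0//; exact: sum_le_ge0 (piN N).
have K := hilbert_cube_compact c0 (sum_leZ Q0 b'A).
exists [set g : H2 | forall N, normc (g N) ^+ 2 <= CQ r * b' N]; last first.
  by split => //; apply: compact_closed => //; exact: norm_hausdorff.
move=> _ [f /= f1 <-] N.
rewrite (LopE tau r0 pi_disj pi_le1); have [m0 m0P] := pi_single pi_disj N.
rewrite (UcE _ m0P) normcM_sqr; apply: ler_pM; rewrite ?sqr_ge0//.
  have H := sum_le_Tc tau r0 f.
  have := le_term_sum_le m0 (fun i => mulr_ge0 ler01 (sqr_ge0 _)) H.
  rewrite mul1r => h; apply: (le_trans h).
  rewrite [(_ * _) ^+ 2]exprMn sqr_sqrtr// ler_piMr//.
  by rewrite expr_le1 ?h2norm_ge0.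
exact: (le_term_sum_le (u := fun m => normc (pi m N) ^+ 2) m0 (fun i => sqr_ge0 _) (piN N)).
Qed.

End Lop_compact.
End hilbert_cube.

(** * The Dirichlet coefficients of the powers of w(s) *)

Section kappa_coefficients.
Variables (R : realType) (d : option nat) (q : nat -> nat) (c : nat -> R[i]) (r : R).
Local Notation C := R[i].
Hypothesis q_ge2 : forall j, below d j -> (2 <= q j)%N.
Hypothesis q_indep : independent d q.
Hypothesis r0 : 0 < r.

Definition cc j : C := if below d j then c j else 0.

Hypothesis cr : sum_le (fun j => normc (cc j)) r.

Implicit Types (m n N M j l : nat) (a b : nat -> nat).

(* The coefficient of N^(-s) in (\sum_j c_j q_j^(-s))^m. *)
Fixpoint kap m N : C := if m is m'.+1 then
  csum (fun j => if below d j && (q j %| N)%N then c j * kap m' (N %/ q j)%N else 0)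
  else (N == 1%N)%:R.

Definition kterm m N j : C :=
  if below d j && (q j %| N)%N then c j * kap m (N %/ q j)%N else 0.

Lemma kapS m N : kap m.+1 N = csum (kterm m N).
Proof. by []. Qed.

Lemma q_gt0 j : below d j -> (0 < q j)%N.
Proof. by move=> /q_ge2; exact: ltnW. Qed.

Lemma sum_le_multiples (v : nat -> R) (B : R) n : (0 < n)%N -> (forall l, 0 <= v l) ->
  sum_le v B -> sum_le (fun N => if (n %| N)%N then v (N %/ n)%N else 0) B.
Proof.
move=> n0 v0 vB.
pose a l N := if N == (n * l)%N then v l else 0.
have a0 l N : 0 <= a l N by rewrite /a; case: ifP.
have [|b' ab' b'B] := @sum_le_fubini R a v B a0 _ vB.
  move=> l; have := @sum_le_fin R (a l) (n * l).+1 (a0 l).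
  have all : a l (n * l)%N = v l by rewrite /a eqxx.
  rewrite big_nat_recr//= all big_nat_cond big1 ?add0r; last first.
    by move=> i /andP[/andP[_ il] _]; rewrite /a ltn_eqF.
  by apply=> i il; rewrite /a gtn_eqF.
apply: le_sum_le b'B => N; case: ifP => [nN|_]; last exact: sum_le_ge0 (ab' N).
have := le_term_sum_le (N %/ n)%N (fun l => a0 l N) (ab' N).
by rewrite /a mulnC divnK// eqxx.
Qed.

Lemma csum_multiples (v : nat -> C) (B : R) n : (0 < n)%N -> abs_le v B ->
  csum (fun N => if (n %| N)%N then v (N %/ n)%N else 0) = csum v /\
  abs_le (fun N => if (n %| N)%N then v (N %/ n)%N else 0) B.
Proof.
move=> n0 vB; split; last first.
  apply: (le_sum_le _ (sum_le_multiples n0 (fun l => normc_ge0 (v l)) vB)) => N.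
  by case: ifP => //; rewrite normc0.
pose a l N := if N == (n * l)%N then v l else 0.
have a1 l N : N != (n * l)%N -> a l N = 0 by rewrite /a => /negbTE ->.
have ab l : abs_le (a l) (normc (v l)).
  by have := abs_le1 (a1 l); rewrite {2}/a eqxx.
have [E _ _] := csum_fubini ab vB.
transitivity (csum (fun N => csum (a ^~ N))).
  apply: eq_csum => N; case: ifP => nN.
    rewrite (@csum1 _ (a ^~ N) (N %/ n)%N); first by rewrite /a mulnC divnK// eqxx.
    move=> l ln; rewrite a1//; apply: contraNneq ln => ->; by rewrite mulKn.
  rewrite -[LHS]csum0; apply: eq_csum => l; rewrite a1//.
  by apply: contraFneq nN => ->; exact: dvdn_mulr.
rewrite -E; apply: eq_csum => l.
by rewrite (csum1 (a1 l)) /a eqxx.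
Qed.

Lemma kterm_le m N j : normc (kterm m N j) <=
  normc (cc j) * (if (q j %| N)%N then normc (kap m (N %/ q j)%N) else 0).
Proof.
rewrite /kterm /cc; case: (boolP (below d j)) => _; last first.
  by rewrite andFb normc0 mul0r.
by rewrite andTb; case: ifP => _; rewrite ?normc0 ?mulr0// normcM.
Qed.

Lemma sum_le_kap m : sum_le (fun N => normc (kap m N)) (r ^+ m).
Proof.
elim: m => [|m IH].
  have := @abs_le1 R (fun N => (N == 1%N)%:R) 1%N.
  by rewrite eqxx normc1 expr0; apply=> i /negbTE ->.
pose a j N := normc (cc j) * (if (q j %| N)%N then normc (kap m (N %/ q j)%N) else 0).
have a0 j N : 0 <= a j N by rewrite mulr_ge0 ?normc_ge0//; case: ifP => // _; exact: normc_ge0.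
have [||b' ab' b'A] := @sum_le_fubini R a (fun j => r ^+ m * normc (cc j)) (r ^+ m * r) a0.
- move=> j; rewrite /a; have [bj|bj] := boolP (below d j).
    rewrite mulrC; apply: sum_leZ; first exact: normc_ge0.
    by apply: (@sum_le_multiples (fun l => normc (kap m l))) => //;
      [exact: q_gt0|move=> l; exact: normc_ge0].
  by move=> K; rewrite big1 /cc (negbTE bj) ?normc0 ?mulr0// => i _; rewrite mul0r.
- by apply: sum_leZ => //; rewrite exprn_ge0// ltW.
rewrite exprSr; apply: le_sum_le b'A => N; rewrite kapS; apply: norm_csum.
by apply: le_sum_le (ab' N) => j; exact: kterm_le.
Qed.

Lemma kap_le m N : normc (kap m N) <= r ^+ m.
Proof. by apply: (le_term_sum_le N _ (sum_le_kap m)) => i; exact: normc_ge0. Qed.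

Lemma abs_le_kterm m N : abs_le (kterm m N) (r ^+ m * r).
Proof.
have rm0 : 0 <= r ^+ m by rewrite exprn_ge0// ltW.
apply: le_sum_le (sum_leZ rm0 cr) => j; apply: le_trans (kterm_le m N j) _.
rewrite mulrC ler_wpM2r ?normc_ge0//; case: ifP => // _; exact: kap_le.
Qed.

Lemma kap0 m : kap m 0%N = 0.
Proof.
elim: m => [//|m IH]; rewrite kapS -[RHS]csum0; apply: eq_csum => j.
by rewrite /kterm; case: ifP => // _; rewrite div0n IH mulr0.
Qed.

Lemma csum_neq0 (u : nat -> C) : csum u != 0 -> exists j, u j != 0.
Proof.
move=> u0; apply: contrapT => nex; case/eqP: u0; rewrite -[RHS]csum0; apply: eq_csum => j.
by apply: contrapT => /eqP uj; apply: nex; exists j.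
Qed.

(** N is a product of m of the integers q_j >= 2; this bounds |N^(-s)| geometrically in m. *)
Lemma kap_neq0_ge m N : kap m N != 0 -> (2 ^ m <= N)%N.
Proof.
elim: m N => [|m IH] N; first by rewrite /=; case: N => [|n]//; rewrite eqxx.
rewrite kapS => /csum_neq0[j]; rewrite /kterm.
case: ifP => [/andP[bj qN]|_]; last by rewrite eqxx.
rewrite mulf_eq0 negb_or => /andP[_ /IH h].
by rewrite expnSr -(divnK qN); apply: leq_mul => //; exact: q_ge2.
Qed.

Section dirichlet_power.
Variable s : C.
Hypothesis s0 : 0 <= complex.Re s.
Local Notation X N := (npow N (- s)).

Lemma ln_nat_ge0 N : 0 <= ln (N%:R : R).
Proof. by case: N => [|N]; [rewrite ln0|rewrite ln_ge0// ler1n]. Qed.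

Lemma normc_X_le1 N : normc (X N) <= 1.
Proof.
rewrite normc_npow -[leRHS]expR0 ler_expR.
have -> : complex.Re (- s) = - complex.Re s by case: (s).
by rewrite mulNr oppr_le0; apply: mulr_ge0 => //; exact: ln_nat_ge0.
Qed.

Definition wsum : C := csum (fun j => cc j * X (q j)).

Lemma abs_le_wsum : abs_le (fun j => cc j * X (q j)) r.
Proof.
apply: le_sum_le cr => j; rewrite normcM ler_piMr ?normc_ge0//; exact: normc_X_le1.
Qed.

Lemma abs_le_kapX m : abs_le (fun N => kap m N * X N) (r ^+ m).
Proof.
apply: le_sum_le (sum_le_kap m) => N; rewrite normcM ler_piMr ?normc_ge0//.
exact: normc_X_le1.
Qed.

Lemma csum_kap m : csum (fun N => kap m N * X N) = wsum ^+ m.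
Proof.
elim: m => [|m IH].
  rewrite (@csum1 _ _ 1%N); first by rewrite /= npow1 mulr1.
  by move=> i /negbTE i1; rewrite /= i1 mul0r.
pose v N := kap m N * X N.
pose a j N := (cc j * X (q j)) * (if (q j %| N)%N then v (N %/ q j)%N else 0).
have aE j N : a j N = X N * kterm m N j.
  rewrite /a /kterm /cc; case: (boolP (below d j)) => [bj|] /=; last by rewrite !mul0r mulr0.
  case: ifP => qN; last by rewrite !mulr0.
  have [N0|N0] := posnP N.
    by rewrite N0 div0n /v kap0 !mul0r !mulr0.
  have E : X N = X (N %/ q j)%N * X (q j).
    by rewrite -npowM ?divn_gt0 ?q_gt0 ?(dvdn_leq N0)// divnK.
  by rewrite /v E; ring.
have H j : below d j -> csum (fun N => if (q j %| N)%N then v (N %/ q j)%N else 0) = csum v /\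
  abs_le (fun N => if (q j %| N)%N then v (N %/ q j)%N else 0) (r ^+ m).
  by move=> bj; apply: csum_multiples; [exact: q_gt0|exact: abs_le_kapX].
have ab j : abs_le (a j) (r ^+ m * normc (cc j)).
  have [bj|bj] := boolP (below d j); last first.
    have z : a j = fun=> 0 by apply/funext => N; rewrite /a /cc (negbTE bj) !mul0r.
    by rewrite z /cc (negbTE bj) normc0 mulr0; exact: abs_le0.
  apply: sum_le_trans (abs_leZ _ (H j bj).2).
  rewrite mulrC ler_wpM2l ?exprn_ge0 ?(ltW r0)// normcM ler_piMr ?normc_ge0//.
  exact: normc_X_le1.
have bA : sum_le (fun j => r ^+ m * normc (cc j)) (r ^+ m * r).
  by apply: sum_leZ => //; rewrite exprn_ge0// ltW.
have [E _ _] := csum_fubini ab bA.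
transitivity (csum (fun N => csum (a ^~ N))).
  apply: eq_csum => N; rewrite kapS mulrC -(csumZ _ (abs_le_kterm m N)).
  by apply: eq_csum => j; rewrite aE.
rewrite -E exprSr -IH -/v.
rewrite (_ : (fun j => csum (a j)) = fun j => csum v * (cc j * X (q j))).
  by rewrite (csumZ _ abs_le_wsum).
apply/funext => j; have [bj|bj] := boolP (below d j).
  by rewrite /a (csumZ _ (H j bj).2) (H j bj).1 mulrC.
rewrite /cc (negbTE bj) mul0r mulr0 -[RHS]csum0; apply: eq_csum => N.
by rewrite /a /cc (negbTE bj) !mul0r.
Qed.

End dirichlet_power.

(* N = q^a with a of degree m and supported below M. *)
Definition rep m N a M := [/\ forall j, (M <= j)%N -> a j = 0%N,
  forall j, ~~ below d j -> a j = 0%N, (\sum_(0 <= j < M) a j)%N = m &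
  (\prod_(0 <= j < M) q j ^ a j)%N = N].

Lemma rep_widen m N a M M' : (M <= M')%N -> rep m N a M -> rep m N a M'.
Proof.
move=> MM' [a0 ab am aN]; split => //.
- by move=> j Mj; apply: a0; exact: leq_trans Mj.
- rewrite (big_cat_nat (n := M))//= am [X in (_ + X)%N]big_nat_cond.
  by rewrite [X in (_ + X)%N]big1 ?addn0// => j /andP[/andP[Mj _] _]; rewrite a0.
- rewrite (big_cat_nat (n := M))//= aN [X in (_ * X)%N]big_nat_cond.
  by rewrite [X in (_ * X)%N]big1 ?muln1// => j /andP[/andP[Mj _] _]; rewrite a0.
Qed.

(** Independence is stated for finitely supported functions: both multi-indices are brought to a
    common range and converted. Equal exponents have equal degrees. *)
Lemma rep_unique m m' N a a' M M' : (0 < N)%N -> rep m N a M -> rep m' N a' M' ->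
  a =1 a' /\ m = m'.
Proof.
move=> N0 ra ra'.
have [M2 [rm rm']] : exists M2, rep m N a M2 /\ rep m' N a' M2.
  exists (maxn M M'); split; [exact: rep_widen (leq_maxl _ _) ra|].
  exact: rep_widen (leq_maxr _ _) ra'.
pose al (x : nat -> nat) : {fsfun nat -> nat with 0%N} := [fsfun j in [fset i in iota 0 M2]%fset => x j | 0%N].
have alE x m0 : rep m0 N x M2 -> al x =1 x.
  move=> [x0 _ _ _] j; rewrite /al fsfunE !inE mem_iota/= add0n.
  by case: ltnP => // /x0.
have alm x m0 : rep m0 N x M2 -> multi_index d (al x).
  by move=> rx j bj; rewrite (alE _ _ rx); case: rx => _ h _ _; exact: h.
have alN x m0 : rep m0 N x M2 -> N = multi_pow q (al x).
  move=> rx; have [x0 _ _ xN] := rx; rewrite -{1}xN /multi_pow.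
  under [RHS]eq_bigr do rewrite (alE _ _ rx).
  rewrite (bigID (fun j => x j == 0%N))/= big1 ?mul1n; last by move=> j /eqP ->.
  rewrite -big_filter; apply: perm_big; apply: uniq_perm.
  - by rewrite filter_uniq// iota_uniq.
  - exact: fset_uniq.
  move=> j; rewrite mem_filter mem_index_iota/= mem_finsupp (alE _ _ rx).
  by case: eqP => //= /eqP xj; apply: contraNT xj; rewrite -leqNgt => /x0 ->.
have := q_indep N0 (alm _ _ rm) (alm _ _ rm') (alN _ _ rm) (alN _ _ rm').
move=> E; have aa' : a =1 a' by move=> j; rewrite -(alE _ _ rm) -(alE _ _ rm') E.
split => //; case: rm => _ _ <- _; case: rm' => _ _ <- _.
by apply: eq_bigr => j _.
Qed.

Lemma rep_add m N a M j : below d j -> rep m N a M ->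
  rep m.+1 (N * q j) (fun i => a i + (i == j))%N (maxn M j.+1).
Proof.
move=> bj ra; have {ra}[a0 ab am aN] := rep_widen (leq_maxl M j.+1) ra.
have jM : (j < maxn M j.+1)%N by exact: leq_maxr.
split.
- by move=> i Mi; rewrite a0// gtn_eqF//; exact: leq_trans jM Mi.
- by move=> i bi; rewrite ab// (_ : i == j = false)//; apply: contraNF bi => /eqP ->.
- rewrite big_split/= am (bigD1_seq j) ?mem_index_iota ?iota_uniq//= eqxx big1 ?addn0 ?addn1//.
  by move=> i /negbTE ->.
- under eq_bigr do rewrite expnD.
  rewrite big_split/= aN; congr muln.
  rewrite (bigD1_seq j) ?mem_index_iota ?iota_uniq//= eqxx expn1 big1 ?muln1//.
  by move=> i /negbTE ->.
Qed.

Lemma kap_rep m N : kap m N != 0 -> exists a M, rep m N a M.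
Proof.
elim: m N => [|m IH] N.
  rewrite /=; case: (N =P 1%N) => [->|_]; last by rewrite eqxx.
  by move=> _; exists (fun=> 0%N), 0%N; split; rewrite ?big_geq.
rewrite kapS => /csum_neq0[j]; rewrite /kterm.
case: ifP => [/andP[bj qN]|_]; last by rewrite eqxx.
rewrite mulf_eq0 negb_or => /andP[_ /IH[a [M ra]]].
exists (fun i => a i + (i == j))%N, (maxn M j.+1).
by rewrite -(divnK qN); exact: rep_add.
Qed.

Lemma kap_disj m m' N : kap m N != 0 -> kap m' N != 0 -> m = m'.
Proof.
have [->|N0] := posnP N; first by rewrite kap0 eqxx.
by move=> /kap_rep[a [M ra]] /kap_rep[a' [M' ra']]; have [] := rep_unique N0 ra ra'.
Qed.

Lemma rep_gt0 m N a M : rep m N a M -> (0 < N)%N.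
Proof.
move=> [_ ab _ <-]; rewrite big_seq; apply: (big_ind (fun n => 0 < n)%N) => //.
  by move=> x y; rewrite muln_gt0 => -> ->.
move=> j _; have [bj|bj] := boolP (below d j); last by rewrite ab.
by rewrite expn_gt0 q_gt0.
Qed.

Lemma rep_sub m N a M j : rep m.+1 N a M -> (j < M)%N -> (0 < a j)%N ->
  [/\ below d j, (q j %| N)%N & rep m (N %/ q j)%N (fun i => a i - (i == j))%N M].
Proof.
move=> [a0 ab am aN] jM aj.
have bj : below d j by apply: contraTT aj => /ab ->.
have E : N = (\prod_(0 <= i < M) q i ^ (a i - (i == j)) * q j)%N.
  rewrite -aN (bigD1_seq j) ?mem_index_iota ?iota_uniq//=.
  rewrite [in RHS](bigD1_seq j) ?mem_index_iota ?iota_uniq//= eqxx.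
  rewrite mulnAC -expnSr subn1 prednK//; congr muln; apply: eq_bigr => i ij.
  by rewrite (negbTE ij) subn0.
split => //; first by rewrite E dvdn_mull.
split.
- by move=> i Mi; rewrite a0.
- by move=> i bi; rewrite ab.
- apply: succn_inj; rewrite -am (bigD1_seq j) ?mem_index_iota ?iota_uniq//= eqxx.
  rewrite [in RHS](bigD1_seq j) ?mem_index_iota ?iota_uniq//= -addSn subn1 prednK//.
  by congr addn; apply: eq_bigr => i ij; rewrite (negbTE ij) subn0.
- by rewrite [in RHS]E mulnK// q_gt0.
Qed.

Definition mcoef a M : C := \prod_(0 <= j < M) (cc j ^+ a j / (a j)`!%:R).

Lemma factC_neq0 n : (n`!%:R : C) != 0.
Proof. by rewrite pnatr_eq0 -lt0n fact_gt0. Qed.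

(** Multinomial theorem. Splitting off one factor q_j with a_j > 0 leaves m! times a_j times the
    coefficient of a, and the a_j add up to m + 1. *)
Lemma kapE m N a M : rep m N a M -> kap m N = m`!%:R * mcoef a M.
Proof.
elim: m N a M => [|m IH] N a M ra.
  have [_ _ am aN] := ra.
  have az j : (j < M)%N -> a j = 0%N.
    move=> jM; apply/eqP; rewrite -leqn0 -am (bigD1_seq j) ?mem_index_iota ?iota_uniq//=.
    exact: leq_addr.
  have -> : N = 1%N.
    rewrite -aN big_nat_cond big1// => j /andP[/andP[_ jM] _].
    by rewrite az.
  rewrite /= fact0 mul1r /mcoef big_nat_cond big1// => j /andP[/andP[_ jM] _].
  by rewrite az// expr0 fact0 divr1.
have N0 := rep_gt0 ra.
rewrite kapS (@csum_fin _ _ M); last first.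
  move=> j Mj; apply/eqP; apply: contraT; rewrite /kterm.
  case: ifP => [/andP[bj qN]|_]; last by rewrite eqxx.
  rewrite mulf_eq0 negb_or => /andP[_ /kap_rep[b [M' rb]]].
  have := rep_add bj rb; rewrite (divnK qN) => rb'.
  have [/(_ j) E _] := rep_unique N0 ra rb'.
  by move: E; rewrite eqxx addn1; case: ra => -> // .
have am : (\sum_(0 <= j < M) a j)%N = m.+1 by case: ra.
rewrite factS natrM mulrAC -{1}am natr_sum mulr_suml mulr_suml.
rewrite big_nat_cond [RHS]big_nat_cond; apply: eq_bigr => j /andP[/andP[_ jM] _].
have [aj|aj] := posnP (a j).
  rewrite aj !mul0r /kterm; case: ifP => // /andP[bj qN].
  apply/eqP; apply: contraT; rewrite mulf_eq0 negb_or => /andP[_ /kap_rep[b [M' rb]]].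
  have := rep_add bj rb; rewrite (divnK qN) => rb'.
  have [/(_ j) E _] := rep_unique N0 ra rb'.
  by move: E; rewrite aj eqxx addn1.
have [bj qN ra'] := rep_sub ra jM aj.
rewrite /kterm bj qN/= (IH _ _ _ ra') /mcoef.
rewrite (bigD1_seq j) ?mem_index_iota ?iota_uniq//= eqxx.
rewrite [in RHS](bigD1_seq j) ?mem_index_iota ?iota_uniq//=.
rewrite (eq_bigr (fun i => cc i ^+ a i / (a i)`!%:R)); last first.
  by move=> i ij; rewrite (negbTE ij) subn0.
have -> : c j = cc j by rewrite /cc bj.
case: (a j) aj => // n _; rewrite subn1/= factS natrM exprS; field.
by rewrite factC_neq0 addrC natr1 pnatr_eq0.
Qed.

Definition pik m N : C := kap m N.+1 / (r ^+ m)%:C.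

Lemma normc_pik m N : normc (pik m N) = normc (kap m N.+1) / r ^+ m.
Proof.
by rewrite /pik normcM normcV normc_real ger0_norm// exprn_ge0// ltW.
Qed.

Lemma sum_le_pik m : sum_le (fun N => normc (pik m N)) 1.
Proof.
have rm : 0 < r ^+ m by rewrite exprn_gt0.
have H := sum_le_shift (fun N => normc_ge0 (kap m N)) (sum_le_kap m).
have := sum_leZ (ltW (_ : 0 < (r ^+ m)^-1)) H; rewrite invr_gt0 => /(_ rm).
rewrite mulVf ?gt_eqF//; apply: le_sum_le => N.
by rewrite normc_pik mulrC.
Qed.

Lemma pik_disj m m' N : pik m N != 0 -> pik m' N != 0 -> m = m'.
Proof.
by rewrite /pik !mulf_eq0 !negb_or => /andP[h _] /andP[h' _]; exact: kap_disj h h'.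
Qed.

(** The sum of the moduli is at most 1, so the largest multinomial probability bounds the sum of the
    squares. *)
Lemma sum_le_pik_sqr m (D : R) : (forall N, normc (pik m N) <= D) ->
  sum_le (fun N => normc (pik m N) ^+ 2) D.
Proof.
move=> piD; have D0 : 0 <= D by apply: le_trans (piD 0%N); exact: normc_ge0.
rewrite -[D]mulr1; apply: le_sum_le (sum_leZ D0 (sum_le_pik m)) => N.
by rewrite expr2 ler_wpM2r ?normc_ge0.
Qed.

Lemma normc_pik_le1 m N : normc (pik m N) <= 1.
Proof. by apply: (le_term_sum_le N _ (sum_le_pik m)) => i; exact: normc_ge0. Qed.

Lemma sum_le_pik_sqr1 m : sum_le (fun N => normc (pik m N) ^+ 2) 1.
Proof. exact/sum_le_pik_sqr/normc_pik_le1. Qed.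

End kappa_coefficients.

(** * Two-sided bounds for multinomial probabilities *)

Section multinomial_bounds.
Variables (R : realType) (d : option nat) (q : nat -> nat) (c : nat -> R[i]) (r : R).
Local Notation C := R[i].
Hypothesis q_ge2 : forall j, below d j -> (2 <= q j)%N.
Hypothesis q_indep : independent d q.
Hypothesis c_neq0 : forall j, below d j -> c j != 0.
Hypothesis r0 : 0 < r.
Hypothesis cr : sum_le (fun j => normc (cc d c j)) r.
Local Notation pik := (pik d q c r).
Local Notation rep := (rep d q).
Implicit Types (m n N M j : nat) (a : nat -> nat).

Definition prob j : R := normc (cc d c j) / r.

Lemma prob_ge0 j : 0 <= prob j.
Proof. by rewrite divr_ge0 ?normc_ge0// ltW. Qed.

Lemma prob_gt0 j : below d j -> 0 < prob j.
Proof.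
move=> bj; rewrite divr_gt0// /cc bj lt_neqAle normc_ge0 andbT eq_sym.
by apply: contra (c_neq0 bj) => /eqP/eq0_normc ->.
Qed.

Lemma sum_le_prob : sum_le prob 1.
Proof.
have ri : 0 <= r^-1 by rewrite invr_ge0 ltW.
have := sum_leZ ri cr; rewrite mulVf ?gt_eqF//; apply: le_sum_le => j.
by rewrite mulrC.
Qed.

Lemma normc_prod (s : seq nat) (F : nat -> C) :
  normc (\prod_(j <- s) F j) = \prod_(j <- s) normc (F j).
Proof.
by elim: s => [|j s IH]; rewrite ?big_nil ?normc1// !big_cons normcM IH.
Qed.

(* Multinomial probabilities are ratios of Poisson weights. *)
Lemma normc_pik_pois m N a M : rep m N.+1 a M ->
  normc (pik m N) * pois m m%:R =
  \prod_(0 <= j < M) pois (a j) (prob j * m%:R) *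
    expR (m%:R * (\sum_(0 <= j < M) prob j - 1)).
Proof.
move=> ra; have [_ _ am _] := ra.
pose Q := \prod_(0 <= j < M) (prob j ^+ a j / (a j)`!%:R).
have pE : normc (pik m N) = m`!%:R * Q.
  rewrite (normc_pik _ _ _ r0) (kapE c q_ge2 q_indep ra) normcM normc_nat -mulrA.
  congr (_ * _); rewrite /mcoef normc_prod -[in r ^+ m]am -prodrXr -prodf_div.
  apply: eq_bigr => j _; rewrite normcM normcX normcV normc_nat /prob expr_div_n.
  by rewrite mulrAC.
have -> : \prod_(0 <= j < M) pois (a j) (prob j * m%:R) =
    expR (- (m%:R * \sum_(0 <= j < M) prob j)) * m%:R ^+ m * Q.
  rewrite -[X in expR _ * _ ^+ X]am -prodrXr mulr_sumr -sumrN expR_sum /Q -!big_split/=.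
  by apply: eq_bigr => j _; rewrite /pois exprMn [prob j * _]mulrC; ring.
rewrite pE /pois mulrBr mulr1 expRD !expRN.
by field; rewrite fact_neq0 !expR_eq0.
Qed.

(** The first e + 1 Poisson factors are O(m^(-1/2)) and the others at most 1, while the denominator
    P_m(m) is at least e^(-1) m^(-1/2). Only finitely many q_j are used, so for infinite d every e
    is allowed. *)
Lemma pik_upper e : (forall j, (j <= e)%N -> below d j) ->
  exists2 K : R, 0 < K & forall m N, normc (pik m N) <= K / Num.sqrt m.+1%:R ^+ e.
Proof.
move=> be.
pose K0 := expR 1 * \prod_(0 <= j < e.+1) (expR 1 / Num.sqrt (prob j)).
have pj j : (j <= e)%N -> 0 < prob j by move=> /be/prob_gt0.
have K00 : 0 <= K0.
  apply: mulr_ge0; first exact: expR_ge0.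
  by apply: prodr_ge0 => j _; rewrite divr_ge0 ?expR_ge0 ?sqrtr_ge0.
(* The term 1 covers m = 0; the factor 2^e pays for replacing sqrt m by sqrt (m + 1). *)
exists (1 + 2 ^+ e * K0); first by rewrite ltr_pwDl// mulr_ge0// exprn_ge0.
move=> m N; have s0 k : 0 < Num.sqrt k.+1%:R :> R by rewrite sqrtr_gt0 ltr0n.
have [kz|kz] := eqVneq (kap d q c m N.+1) 0.
  rewrite (normc_pik _ _ _ r0) kz normc0 mul0r; apply: divr_ge0.
    by rewrite addr_ge0// mulr_ge0// exprn_ge0.
  by rewrite exprn_ge0// ltW.
case: m kz => [|m] kz.
  rewrite sqrtr1 expr1n divr1 (le_trans (normc_pik_le1 q_ge2 r0 cr 0 N))//.
  by rewrite lerDl mulr_ge0 ?exprn_ge0.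
have [a [M0 ra0]] := kap_rep kz.
have ra := rep_widen (leq_maxl M0 e.+1) ra0; set M := maxn M0 e.+1 in ra.
have eM : (e < M)%N by rewrite /M leq_maxr.
set y : R := m.+1%:R; have y0 : 0 < y by rewrite ltr0n.
have sy : 0 < Num.sqrt y by exact: s0.
have H := normc_pik_pois ra; rewrite -/y in H.
have pm : expR (-1) / Num.sqrt y <= pois m.+1 y.
  have := @pois_lower R m.+1 y 0 isT y0; rewrite oppr0 sub0r; apply.
  by rewrite subrr expr0n mul0r.
have py0 j : 0 <= prob j * y by rewrite mulr_ge0 ?prob_ge0// ltW.
have up : normc (pik m.+1 N) * (expR (-1) / Num.sqrt y) <=
    \prod_(0 <= j < e.+1) (expR 1 / Num.sqrt (prob j * y)).
  apply: (@le_trans _ _ (normc (pik m.+1 N) * pois m.+1 y)).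
    by rewrite ler_wpM2l ?normc_ge0.
  rewrite H; apply: (@le_trans _ _ (\prod_(0 <= j < M) pois (a j) (prob j * y))).
    rewrite ler_piMr ?prodr_ge0// => [j _|]; first exact: pois_ge0.
    rewrite -[leRHS]expR0 ler_expR mulr_ge0_le0 ?(ltW y0)// subr_le0.
    exact: sum_le_prob.
  apply: (@le_trans _ _ (\prod_(0 <= j < e.+1) pois (a j) (prob j * y))).
    rewrite (big_cat_nat (n := e.+1))//=; apply: ler_piMr.
      by apply: prodr_ge0 => j _; exact: pois_ge0.
    apply: (@le_trans _ _ (\prod_(e.+1 <= j < M) 1)); last by rewrite big1.
    by apply: ler_prod => j _; rewrite pois_ge0 ?pois_le1.
  rewrite big_nat_cond [leRHS]big_nat_cond; apply: ler_prod => j /andP[/andP[_ je] _].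
  rewrite pois_ge0//= pois_upper// mulr_gt0// pj//.
have E : \prod_(0 <= j < e.+1) (expR 1 / Num.sqrt (prob j * y)) =
    (\prod_(0 <= j < e.+1) (expR 1 / Num.sqrt (prob j))) / Num.sqrt y ^+ e.+1.
  have -> : Num.sqrt y ^+ e.+1 = \prod_(0 <= j < e.+1) Num.sqrt y.
    by rewrite prodr_const_nat subn0.
  rewrite -prodf_div; apply: eq_bigr => j _.
  by rewrite sqrtrM ?prob_ge0// invfM mulrA.
have up2 : normc (pik m.+1 N) <= K0 / Num.sqrt y ^+ e.
  move: up; rewrite E -ler_pdivlMr ?divr_gt0 ?expR_gt0// => h; apply: (le_trans h).
  rewrite /K0 exprS expRN le_eqVlt; apply/orP; left; apply/eqP; field.
  by rewrite expR_eq0 expf_neq0 ?gt_eqF.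
apply: (le_trans up2).
have h : Num.sqrt m.+2%:R <= 2 * Num.sqrt y.
  have t0 : 0 <= 2 * Num.sqrt y by rewrite mulr_ge0 ?(ltW sy).
  rewrite -[leRHS]ger0_norm// -sqrtr_sqr ler_wsqrtr// exprMn sqr_sqrtr ?(ltW y0)//.
  have : 1 <= y by rewrite ler1n.
  rewrite -(natr1 m.+1) -/y; lra.
apply: (@le_trans _ _ (2 ^+ e * K0 / Num.sqrt m.+2%:R ^+ e)); last first.
  by rewrite ler_wpM2r ?invr_ge0 ?exprn_ge0 ?(ltW (s0 _))// lerDr.
rewrite [leRHS](_ : _ = K0 * (2 ^+ e / Num.sqrt m.+2%:R ^+ e)); last by ring.
rewrite ler_wpM2l// ler_pdivlMr ?exprn_gt0//.
rewrite mulrC ler_pdivrMr ?exprn_gt0// -exprMn.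
by rewrite lerXn2r ?nnegrE ?mulr_ge0 ?(ltW sy) ?(ltW (s0 _)).
Qed.

Lemma sum_injective_le (T : finType) (Phi : T -> nat) (F : nat -> R) :
  injective Phi -> (forall n, 0 <= F n) ->
  exists L, \sum_t F (Phi t) <= \sum_(0 <= N < L) F N.
Proof.
move=> inj F0; exists (\sum_t Phi t).+1.
have PL t : (Phi t < (\sum_t Phi t).+1)%N by rewrite ltnS (bigD1 t)//= leq_addr.
apply: (@le_trans _ _ (\sum_(0 <= N < (\sum_t Phi t).+1) \sum_t (if Phi t == N then F N else 0))).
  rewrite exchange_big/= le_eqVlt; apply/orP; left; apply/eqP; apply: eq_bigr => t _.
  rewrite (bigD1_seq (Phi t)) ?mem_index_iota ?iota_uniq ?PL//= eqxx big1 ?addr0//.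
  by move=> N; rewrite eq_sym => /negbTE ->.
apply: ler_sum => N _.
have [[t tN]|nex] := pselect (exists t, Phi t = N).
  rewrite (bigD1 t)//= tN eqxx big1 ?addr0// => t' tt'.
  by rewrite ifF//; apply/eqP => h; case/eqP: tt'; apply: inj; rewrite h tN.
by rewrite big1// => t _; rewrite ifF//; apply/eqP => h; apply: nex; exists t.
Qed.

Section lower.
Variable e : nat.
Hypothesis dE : d = Some e.+1.
Hypothesis r_sum : \sum_(0 <= j < e.+1) normc (c j) = r.

Let below_e j : below d j = (j < e.+1)%N. Proof. by rewrite dE. Qed.

Lemma sum_prob : \sum_(0 <= j < e.+1) prob j = 1.
Proof.
rewrite -[RHS](@divff _ r) ?gt_eqF// -{1}r_sum mulr_suml.
rewrite big_nat_cond [RHS]big_nat_cond; apply: eq_bigr => j /andP[/andP[_ je] _].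
by rewrite /prob /cc below_e je.
Qed.

(** A lower bound for each p_j, all factors being at most 1; it stands in for the minimum. *)
Let pmin : R := \prod_(0 <= j < e.+1) prob j.

Let pmin_gt0 : 0 < pmin.
Proof.
rewrite /pmin big_seq prodr_gt0// => j; rewrite mem_index_iota => /andP[_ je].
by apply: prob_gt0; rewrite below_e.
Qed.

Lemma prob_le1 j : prob j <= 1.
Proof. exact: (le_term_sum_le j prob_ge0 sum_le_prob). Qed.

Let pmin_le j : (j < e.+1)%N -> pmin <= prob j.
Proof.
move=> je; rewrite /pmin (bigD1_seq j) ?mem_index_iota ?iota_uniq//=.
rewrite ler_piMr ?prob_ge0//.
apply: (@le_trans _ _ (\prod_(0 <= i < e.+1 | i != j) 1)); last by rewrite big1.
by apply: ler_prod => i _; rewrite prob_ge0 prob_le1.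
Qed.

Section fixed_degree.
Variable m : nat.
Let x : R := Num.sqrt m%:R.
(** Makes every mean p_j m at least (e + 1) sqrt m + 2, so that multi-indices within (e + 1) sqrt m
    of the means are positive. *)
Hypothesis x_large : (e%:R + 3) / pmin <= x.

Let pmin_le1 : pmin <= 1.
Proof. exact: le_trans (pmin_le (ltn0Sn e)) (prob_le1 0). Qed.

Let x1 : 1 <= x.
Proof.
apply: le_trans x_large; rewrite ler_pdivlMr// mul1r (le_trans pmin_le1)//.
by have := ler0n R e; lra.
Qed.

Let x2 : x ^+ 2 = m%:R. Proof. by rewrite sqr_sqrtr. Qed.

Let prob_large j : (j < e.+1)%N -> (e%:R + 1) * x + 2 <= prob j * m%:R.
Proof.
move=> je; apply: (@le_trans _ _ (pmin * m%:R)); last by rewrite ler_wpM2r// pmin_le.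
have h : e%:R + 3 <= pmin * x by move: x_large; rewrite ler_pdivrMr// mulrC.
rewrite -x2; move: x1 h; have e0 := ler0n R e; move: (pmin) (e%:R) e0 => p f f0 h1 h2.
nra.
Qed.

Let L : nat := Num.trunc x.

Let L_itv : L%:R <= x < L%:R + 1.
Proof. by rewrite natr1; apply: truncn_itv; apply: le_trans x1. Qed.

(* The multi-indices at distance at most sqrt m from the mean of the multinomial
   distribution: there are about (sqrt m)^e of them, each of probability about
   (sqrt m)^(-e). *)
Definition shift (b : {ffun 'I_e -> 'I_L}) j : nat := if insub j is Some i then b i else 0.

Definition box0 b j : nat := (Num.trunc (prob j * m%:R) + shift b j)%N.

(** The last exponent is forced by the degree m; its deviation from the mean is at most the sum of
    the e other deviations. *)
Definition box b j : nat :=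
  if (j < e)%N then box0 b j else if j == e then (m - \sum_(0 <= i < e) box0 b i)%N else 0%N.

Lemma box0_itv b j : (j < e)%N -> `|(box0 b j)%:R - prob j * m%:R| <= x.
Proof.
move=> je; have p0 : 0 <= prob j * m%:R by rewrite mulr_ge0 ?prob_ge0.
have /andP[t1 t2] := truncn_itv p0; have /andP[l1 l2] := L_itv.
have sb : (shift b j)%:R + 1 <= L%:R :> R.
  rewrite /shift; case: insubP => [i _ _|]; first by rewrite natr1 ler_nat.
  by rewrite je.
have s0 : 0 <= (shift b j)%:R :> R by [].
have h1 := x1.
rewrite /box0 natrD ler_norml; apply/andP; split.
  by move: t1 t2; rewrite -natr1; lra.
by move: t1 t2; rewrite -natr1; lra.
Qed.

Lemma sum_box0 b : `|\sum_(0 <= i < e) (box0 b i)%:R - \sum_(0 <= i < e) prob i * m%:R| <= e%:R * x.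
Proof.
rewrite -sumrB; apply: le_trans (ler_norm_sum _ _ _) _.
apply: (@le_trans _ _ (\sum_(0 <= i < e) x)).
  by apply: ler_sum_nat => i /= ie; exact: box0_itv.
by rewrite sumr_const_nat subn0 mulr_natl.
Qed.

Lemma sum_prob_e : \sum_(0 <= i < e) prob i * m%:R = m%:R - prob e * m%:R.
Proof.
have h : \sum_(0 <= i < e) prob i = 1 - prob e by rewrite -sum_prob big_nat_recr//= addrK.
by rewrite -mulr_suml h mulrBl mul1r.
Qed.

Lemma sum_box0_le b : (\sum_(0 <= i < e) box0 b i <= m)%N.
Proof.
rewrite -(ler_nat R) natr_sum; have := sum_box0 b; rewrite sum_prob_e ler_norml => /andP[_].
have := prob_large (ltnSn e); have := x1; lra.
Qed.

Lemma box_dev b j : (j < e.+1)%N -> `|(box b j)%:R - prob j * m%:R| <= (e%:R + 1) * x.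
Proof.
have e0 := ler0n R e; have h1 := x1.
have ex0 : 0 <= e%:R * x by rewrite mulr_ge0//; lra.
rewrite ltnS leq_eqVlt => /orP[/eqP ->|je]; last first.
  by rewrite /box je (le_trans (box0_itv b je))// mulrDl mul1r lerDr.
rewrite /box ltnn eqxx natrB ?sum_box0_le// natr_sum.
have := sum_box0 b; rewrite sum_prob_e !ler_norml => /andP[h2 h3]; rewrite mulrDl mul1r.
by apply/andP; split; lra.
Qed.

Lemma box_gt0 b j : (j < e.+1)%N -> (0 < box b j)%N.
Proof.
move=> je; rewrite -(ltr_nat R); have := box_dev b je; rewrite ler_norml => /andP[h _].
have := prob_large je; lra.
Qed.

Lemma box_sum b : (\sum_(0 <= j < e.+1) box b j)%N = m.
Proof.
rewrite big_nat_recr//= {2}/box ltnn eqxx.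
rewrite (_ : (\sum_(0 <= j < e) box b j)%N = (\sum_(0 <= j < e) box0 b j)%N).
  by rewrite subnKC// sum_box0_le.
by rewrite big_nat_cond [RHS]big_nat_cond; apply: eq_bigr => j /andP[/andP[_ je] _]; rewrite /box je.
Qed.

Lemma box_le b j : (j < e.+1)%N -> (box b j <= m)%N.
Proof.
move=> je; rewrite -[leqRHS](box_sum b) (bigD1_seq j) ?mem_index_iota ?iota_uniq//=.
exact: leq_addr.
Qed.

Definition boxN b : nat := (\prod_(0 <= j < e.+1) q j ^ box b j)%N.

Lemma box_rep b : rep m (boxN b) (box b) e.+1.
Proof.
split => //; last exact: box_sum.
- by move=> j ej; rewrite /box ltnNge (ltnW ej)/= gtn_eqF.
- by move=> j; rewrite below_e -leqNgt => ej; rewrite /box ltnNge (ltnW ej)/= gtn_eqF.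
Qed.

Lemma boxN_gt0 b : (0 < boxN b)%N.
Proof. exact: (rep_gt0 q_ge2 (box_rep b)). Qed.

Lemma boxN_inj : injective (fun b => (boxN b).-1).
Proof.
move=> b b' E; have {}E : boxN b = boxN b'.
  by rewrite -(prednK (boxN_gt0 b)) E prednK// boxN_gt0.
have rb := box_rep b; rewrite E in rb.
have [ee _] := rep_unique q_indep (boxN_gt0 b') rb (box_rep b').
apply/ffunP => i; apply/val_inj; have := ee i.
rewrite /box ltn_ord /box0 => /eqP; rewrite eqn_add2l /shift.
by case: insubP => [i' _ /val_inj ->|]; rewrite ?ltn_ord// => /eqP.
Qed.

(** With this B, ((e + 1) sqrt m)^2 <= B p_j m, as [pois_lower] requires. In [kp], the denominator e
    comes from the bound P_m(m) <= e/sqrt m. *)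
Let B : R := (e%:R + 1) ^+ 2 / pmin.
Let kp : R := expR (- B - 1) ^+ e.+1 / expR 1.

Lemma pik_box b : kp / x ^+ e <= normc (pik m (boxN b).-1).
Proof.
have x0 : 0 < x by apply: lt_le_trans x1.
have m0R : 0 < m%:R :> R by rewrite -x2 exprn_gt0.
have rb : rep m (boxN b).-1.+1 (box b) e.+1 by rewrite prednK ?boxN_gt0//; exact: box_rep.
have := normc_pik_pois rb; rewrite sum_prob subrr mulr0 expR0 mulr1 => H.
have lowj j : (j < e.+1)%N -> expR (- B - 1) / x <= pois (box b j) (prob j * m%:R).
  move=> je; have pj : 0 < prob j by apply: lt_le_trans (pmin_le je).
  have bj := box_gt0 b je.
  have dv : (prob j * m%:R - (box b j)%:R) ^+ 2 <= B * (prob j * m%:R).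
    apply: (@le_trans _ _ ((e%:R + 1) ^+ 2 * m%:R)).
      rewrite -[X in _ <= _ * X]x2 -exprMn -[leLHS]real_normK ?num_real// lerXn2r ?nnegrE//.
        by rewrite mulr_ge0 ?(ltW x0)// addr_ge0.
      by rewrite distrC; exact: box_dev.
    rewrite mulrA ler_wpM2r// /B mulrAC ler_pdivlMr//.
    by rewrite ler_wpM2l ?sqr_ge0// pmin_le.
  apply: le_trans (pois_lower bj (mulr_gt0 pj m0R) dv).
  rewrite ler_wpM2l ?expR_ge0// lef_pV2 ?posrE// ?sqrtr_gt0 ?ltr0n//.
  by rewrite ler_wsqrtr// ler_nat box_le.
have up : pois m m%:R <= expR 1 / x by exact: pois_upper.
have low : (expR (- B - 1) / x) ^+ e.+1 <= normc (pik m (boxN b).-1) * (expR 1 / x).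
  apply: le_trans (ler_wpM2l (normc_ge0 _) up); rewrite H.
  rewrite -[X in _ ^+ X](subn0 e.+1) -prodr_const_nat big_nat_cond [leRHS]big_nat_cond.
  apply: ler_prod => j /andP[/andP[_ je] _].
  by rewrite lowj// andbT divr_ge0 ?expR_ge0// ltW.
move: low; rewrite -ler_pdivrMr ?divr_gt0 ?expR_gt0//; apply: le_trans.
rewrite /kp expr_div_n exprS le_eqVlt; apply/orP; left; apply/eqP; rewrite [x ^+ e.+1]exprS; field.
by rewrite expR_eq0 expf_neq0 ?gt_eqF.
Qed.

(** The box has L^e elements with L >= sqrt m / 2, and they yield distinct N, each with squared
    coefficient at least kp^2 m^(-e). *)
Lemma pik_lower_at : exists L', kp ^+ 2 / 2 ^+ e / Num.sqrt m.+1%:R ^+ e <=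
  \sum_(0 <= N < L') normc (pik m N) ^+ 2.
Proof.
have x0 : 0 < x by apply: lt_le_trans x1.
have [L' L'P] := @sum_injective_le _ _ (fun N => normc (pik m N) ^+ 2) boxN_inj
  (fun N => sqr_ge0 _).
exists L'; apply: le_trans L'P.
have kp0 : 0 < kp by rewrite divr_gt0 ?exprn_gt0 ?expR_gt0.
apply: (@le_trans _ _ (\sum_(b : {ffun 'I_e -> 'I_L}) (kp / x ^+ e) ^+ 2)); last first.
  apply: ler_sum => b _; rewrite lerXn2r ?nnegrE ?normc_ge0 ?pik_box//.
  by rewrite divr_ge0 ?exprn_ge0 ?(ltW kp0) ?(ltW x0).
rewrite sumr_const card_ffun !card_ord -[leRHS]mulr_natr natrX.
have /andP[l1 l2] := L_itv; have h1 := x1.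
have L1 : 1 <= L%:R :> R.
  rewrite ler1n lt0n; apply/eqP => L0; move: l2; rewrite L0; lra.
have xL : (x / 2) ^+ e <= L%:R ^+ e.
  by rewrite lerXn2r ?nnegrE ?divr_ge0 ?(ltW x0)//; lra.
apply: (@le_trans _ _ ((kp / x ^+ e) ^+ 2 * (x / 2) ^+ e)); last first.
  by rewrite ler_wpM2l ?sqr_ge0.
have -> : (kp / x ^+ e) ^+ 2 * (x / 2) ^+ e = kp ^+ 2 / 2 ^+ e / x ^+ e.
  by rewrite !expr_div_n; field; rewrite !expf_neq0 ?gt_eqF.
have s0 : 0 < Num.sqrt m.+1%:R :> R by rewrite sqrtr_gt0 ltr0n.
rewrite ler_wpM2l ?divr_ge0 ?sqr_ge0 ?exprn_ge0//.
rewrite lef_pV2 ?posrE ?exprn_gt0// lerXn2r ?nnegrE ?(ltW x0) ?(ltW s0)//.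
by rewrite ler_wsqrtr// ler_nat.
Qed.

End fixed_degree.

Lemma pik_lower : exists2 cD : R, 0 < cD & exists m0, forall m, (m0 <= m)%N ->
  exists L, cD / Num.sqrt m.+1%:R ^+ e <= \sum_(0 <= N < L) normc (pik m N) ^+ 2.
Proof.
eexists; last first.
  exists (Num.trunc (((e%:R + 3) / pmin) ^+ 2)).+1 => m mm.
  apply: pik_lower_at.
  have p0 : 0 <= (e%:R + 3) / pmin by rewrite divr_ge0 ?addr_ge0 ?(ltW pmin_gt0).
  rewrite -[leLHS]ger0_norm// -sqrtr_sqr ler_wsqrtr//.
  have /andP[_ /ltW h] := truncn_itv (sqr_ge0 ((e%:R + 3) / pmin)).
  by apply: (le_trans h); rewrite ler_nat.
by rewrite divr_gt0 ?exprn_gt0// divr_gt0 ?exprn_gt0 ?expR_gt0.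
Qed.

End lower.
End multinomial_bounds.

(** * Uniqueness of Dirichlet coefficients *)

Section dirichlet_uniqueness.
Variable R : realType.
Local Notation C := R[i].
Local Notation H2 := (hardy2 R).

Lemma h2norm_coef_le (f : H2) n : normc (f n) <= h2norm f.
Proof.
rewrite -ler_sqr ?nnegrE ?normc_ge0 ?h2norm_ge0//.
by apply: (le_term_sum_le n _ (sum_le_h2norm f)) => i; exact: sqr_ge0.
Qed.

Lemma npow_nat n k : npow n.+1 (- (k%:R : C)) = ((n.+1%:R ^+ k)^-1)%:C.
Proof.
rewrite /npow -(rmorph_nat (real_complex R)) -rmorphN -rmorphM/= cexp_real mulNr expRN.
by rewrite expRM_natl lnK// posrE ltr0n.
Qed.

Lemma abs_le_dirichlet (f : H2) k : (2 <= k)%N ->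
  abs_le (fun n => f n * npow n.+1 (- (k%:R : C))) (h2norm f * 2).
Proof.
move=> k2.
apply: le_sum_le (sum_leZ (h2norm_ge0 f) (@inv_sqr_sum R)) => n.
rewrite npow_nat normcM normc_real ger0_norm ?invr_ge0 ?exprn_ge0//.
apply: ler_pM; rewrite ?normc_ge0 ?invr_ge0 ?exprn_ge0 ?h2norm_coef_le//.
by rewrite lef_pV2 ?posrE ?exprn_gt0 ?ltr0n// ler_weXn2l// ler1n.
Qed.

(* The first nonzero coefficient dominates at s = k as the integer k grows. *)
Lemma dirichlet_unique (g h : H2) :
  (forall s : C, 2^-1 < complex.Re s -> dirichlet g s = dirichlet h s) -> g = h.
Proof.
move=> gh; pose u := g - h.
suff uz n : u n = 0.
  by apply: hardy2_eq => n; apply/eqP; rewrite -subr_eq0; apply/eqP; exact: uz n.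
have D0 k : (2 <= k)%N -> csum (fun n => u n * npow n.+1 (- (k%:R : C))) = 0.
  move=> k2; have ks : 2^-1 < complex.Re (k%:R : C).
    have -> : complex.Re (k%:R : C) = k%:R by rewrite -(rmorph_nat (real_complex R)).
    have : 2%:R <= k%:R :> R by rewrite ler_nat.
    lra.
  have Eu : csum (fun n => u n * npow n.+1 (- (k%:R : C))) =
      csum (fun n => g n * npow n.+1 (- (k%:R : C)) + -1 * (h n * npow n.+1 (- (k%:R : C)))).
    by apply: eq_csum => n'; rewrite /u H2B; ring.
  rewrite Eu (csumD (abs_le_dirichlet g k2) (abs_leZ _ (abs_le_dirichlet h k2))).
  rewrite (csumZ _ (abs_le_dirichlet h k2)).
  have -> : csum (fun n => g n * npow n.+1 (- (k%:R : C))) =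
    csum (fun n => h n * npow n.+1 (- (k%:R : C))) := gh _ ks.
  by rewrite mulN1r subrr.
apply: contrapT => /eqP un0.
have ex : exists n, u n != 0 by exists n.
case: (ex_minnP ex) => n0 un u_min {n un0 ex}.
pose a : R := n0.+1%:R; pose b : R := n0.+2%:R.
have a0 : 0 < a by rewrite ltr0n.
have b0 : 0 < b by rewrite ltr0n.
have u0 : 0 < normc (u n0).
  rewrite lt_neqAle normc_ge0 andbT eq_sym; apply: contra un => /eqP/eq0_normc ->.
  by [].
(* At s = k + 2 two powers of n.+1 are kept to make the tail converge, and the other k are at least
   b^k. *)
have key k : normc (u n0) * (b / a) ^+ k <= a ^+ 2 * (h2norm u * 2).
  have k2 : (2 <= k.+2)%N by [].
  pose t n : C := if (n <= n0)%N then 0 else u n * npow n.+1 (- (k.+2%:R : C)).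
  have tn n : normc (t n) <= (b ^+ k)^-1 * (h2norm u * (n.+1%:R ^+ 2)^-1).
    rewrite /t; case: leqP => nn0.
      by rewrite normc0 mulr_ge0 ?invr_ge0 ?exprn_ge0 ?(ltW b0)// mulr_ge0 ?h2norm_ge0 ?invr_ge0 ?exprn_ge0.
    rewrite npow_nat normcM normc_real ger0_norm ?invr_ge0 ?exprn_ge0//.
    rewrite mulrCA; apply: ler_pM; rewrite ?normc_ge0 ?invr_ge0 ?exprn_ge0 ?h2norm_coef_le//.
    rewrite -addn2 exprD invfM ler_wpM2r ?invr_ge0 ?exprn_ge0//.
    rewrite lef_pV2 ?posrE ?exprn_gt0 ?ltr0n// lerXn2r ?nnegrE ?(ltW b0)//.
    by rewrite ler_nat.
  have tB : abs_le t ((b ^+ k)^-1 * (h2norm u * 2)).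
    have i0 : 0 <= (b ^+ k)^-1 by rewrite invr_ge0 exprn_ge0 ?(ltW b0).
    apply: le_sum_le (sum_leZ i0 (sum_leZ (h2norm_ge0 u) (@inv_sqr_sum R))) => n.
    exact: tn.
  have := norm_csum tB.
  have -> : csum t = - (u n0 * npow n0.+1 (- (k.+2%:R : C))).
    apply/eqP; rewrite -addr_eq0; apply/eqP; rewrite -(D0 k.+2 k2).
    pose e n : C := if n == n0 then u n * npow n.+1 (- (k.+2%:R : C)) else 0.
    have e1 n : n != n0 -> e n = 0 by rewrite /e => /negbTE ->.
    have -> : u n0 * npow n0.+1 (- (k.+2%:R : C)) = csum e by rewrite (csum1 e1) /e eqxx.
    rewrite -(csumD tB (abs_le1 e1)); apply: eq_csum => n; rewrite /t /e.
    case: ltngtP => [nn0|nn0|->]; rewrite ?addr0 ?add0r//.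
    have -> : u n = 0 by apply/eqP; apply: contraTT nn0 => /u_min; rewrite -leqNgt.
    by rewrite mul0r.
  rewrite normcN npow_nat normcM normc_real ger0_norm ?invr_ge0 ?exprn_ge0// -/a.
  rewrite mulrC ler_pdivlMl ?exprn_gt0// => hu.
  rewrite expr_div_n [leLHS]mulrA ler_pdivrMr ?exprn_gt0//.
  have -> : normc (u n0) * b ^+ k = a ^+ k.+2 * (b ^+ k * (a ^- k.+2 * normc (u n0))).
    by field; rewrite expf_neq0// gt_eqF.
  have -> : a ^+ 2 * (h2norm u * 2) * a ^+ k = a ^+ k.+2 * (h2norm u * 2).
    by rewrite -[k.+2]addn2 exprD; move: (h2norm u) => v; ring.
  by rewrite ler_wpM2l ?exprn_ge0 ?(ltW a0).
(* Bernoulli's inequality: the left side of [key] is unbounded in k. *)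
have bern k : 1 + k%:R / a <= (b / a) ^+ k.
  have ba : b / a = 1 + a^-1.
    by rewrite /b -(natr1 n0.+1) mulrDl mul1r divff ?gt_eqF.
  have ai : 0 <= a^-1 by rewrite invr_ge0 ltW.
  rewrite ba; elim: k => [|k IH]; first by rewrite mul0r addr0 expr0.
  rewrite exprS; apply: (@le_trans _ _ ((1 + a^-1) * (1 + k%:R / a))); last first.
    by rewrite ler_wpM2l// addr_ge0.
  rewrite -(natr1 k) -subr_ge0.
  have -> : (1 + a^-1) * (1 + k%:R / a) - (1 + (k%:R + 1) / a) = k%:R * a^-1 * a^-1.
    by field; rewrite gt_eqF.
  by rewrite !mulr_ge0.
pose S := a ^+ 2 * (h2norm u * 2) / normc (u n0) * a.
have S0 : 0 <= S.
  by rewrite !mulr_ge0 ?invr_ge0 ?exprn_ge0 ?h2norm_ge0 ?(ltW a0) ?(ltW u0).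
have /andP[_ S1] := truncn_itv S0.
have := key (Num.trunc S).+1; rewrite leNgt => /negP; apply.
apply: (@lt_le_trans _ _ (normc (u n0) * (1 + (Num.trunc S).+1%:R / a))); last first.
  by rewrite ler_wpM2l ?(ltW u0).
apply: (@lt_le_trans _ _ (normc (u n0) * (1 + S / a))); last first.
  by rewrite ler_wpM2l ?(ltW u0)// lerD2l ler_wpM2r ?invr_ge0 ?(ltW a0)// ltW.
have -> : normc (u n0) * (1 + S / a) = normc (u n0) + a ^+ 2 * (h2norm u * 2).
  by rewrite /S; field; rewrite !gt_eqF.
by rewrite ltrDr.
Qed.

End dirichlet_uniqueness.

(** * Identification of the composition operator with the model operator *)

Section composition_is_model.
Variables (R : realType) (d : option nat) (c1 : R[i]) (q : nat -> nat) (c : nat -> R[i]) (r : R).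
Local Notation C := R[i].
Local Notation H2 := (hardy2 R).
Hypothesis q_ge2 : forall j, below d j -> (2 <= q j)%N.
Hypothesis q_indep : independent d q.
Hypothesis r0 : 0 < r.
Hypothesis cr : sum_le (fun j => normc (cc d c j)) r.
Hypothesis c1r : complex.Re c1 = 2^-1 + r.
Local Notation tau := (complex.Im c1).
Local Notation pi := (pik d q c r).

Lemma symbolE s : 0 <= complex.Re s -> symbol d c1 q c s = c1 + wsum d q c s.
Proof.
move=> s0; rewrite /symbol; congr (_ + _).
rewrite /wsum /csum; congr (limn _); apply/funext => n.
rewrite big_mkcond/=; apply: eq_bigr => j _.
by rewrite /cc; case: ifP; rewrite ?mul0r.
Qed.

(** This is 2^(-1/2), the supremum of |2^(-s)| on Re s > 1/2; it makes the series over m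
    geometric. *)
Definition rho : R := expR (- (ln 2 / 2)).

Lemma rho_gt0 : 0 < rho. Proof. exact: expR_gt0. Qed.

Lemma rho_lt1 : rho < 1.
Proof. by rewrite -expR0 ltr_expR oppr_lt0 divr_gt0// ln_gt0// ltr1n. Qed.

Lemma sum_le_geometric : sum_le (fun m => rho ^+ m) (1 - rho)^-1.
Proof.
have h : 0 < 1 - rho by rewrite subr_gt0 rho_lt1.
move=> N; rewrite -[leRHS]div1r ler_pdivlMr//.
have -> : (\sum_(0 <= m < N) rho ^+ m) * (1 - rho) = 1 - rho ^+ N.
  elim: N => [|N IH]; first by rewrite big_geq// mul0r expr0 subrr.
  by rewrite big_nat_recr//= mulrDl IH exprSr; ring.
by rewrite gerBl exprn_ge0// ltW// rho_gt0.
Qed.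

Section point.
Variable s : C.
Hypothesis s_gt : 2^-1 < complex.Re s.

Let s0 : 0 <= complex.Re s. Proof. by apply: ltW; apply: lt_trans s_gt; rewrite invr_gt0. Qed.

Lemma normc_X_le m N : (2 ^ m <= N)%N -> normc (npow N (- s)) <= rho ^+ m.
Proof.
move=> mN; have N0 : (0 < N)%N by apply: leq_trans mN; rewrite expn_gt0.
rewrite normc_npow /rho -expRM_natl ler_expR.
have -> : complex.Re (- s) = - complex.Re s by case: (s).
rewrite mulrN mulNr lerN2.
have lnN : m%:R * ln 2 <= ln N%:R :> R.
  rewrite mulr_natl -lnXn// ler_ln ?posrE ?exprn_gt0 ?ltr0n//.
  by rewrite -natrX ler_nat.
have l0 : 0 <= m%:R * ln 2 :> R by rewrite mulr_ge0// ln_ge0// ler1n.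
rewrite mulrA mulrC; apply: ler_pM => //; exact: ltW.
Qed.

Let w := wsum d q c s.

Lemma normc_w : normc w <= rho * r.
Proof.
apply: norm_csum; apply: le_sum_le (sum_leZ (ltW rho_gt0) cr) => j.
rewrite normcM mulrC /cc; case: (boolP (below d j)) => bj; last first.
  by rewrite normc0 !mulr0.
rewrite ler_wpM2r ?normc_ge0//; have := @normc_X_le 1 (q j); rewrite expr1 expn1.
by apply; exact: q_ge2.
Qed.

Lemma normc_w_div : normc (w / r%:C) <= rho.
Proof.
rewrite normcM normcV normc_real ger0_norm ?(ltW r0)// ler_pdivrMr//.
exact: normc_w.
Qed.

(** In the exponential series of n^(-w), the power (w ln n)^m is written (w/r)^m (r ln n)^m; with
    the factor n^(-r) this is a Poisson weight. *)
Lemma npow_term (f : H2) n : f n * npow n.+1 (- (c1 + w)) =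
  csum (fun m => (-1) ^+ m * (w / r%:C) ^+ m * Tterm r tau f m n).
Proof.
set l : R := ln n.+1%:R.
have E : npow n.+1 (- (c1 + w)) = wt tau n * (expR (- (r * l)))%:C * cexp (- (w * l%:C)).
  rewrite /wt /npow -/l -cexp_real -!cexpD; congr cexp.
  have c1E : c1 = (2^-1 +i* tau) + r%:C.
    by move: c1r; case: (c1) => x y /= ->; apply/eqP; rewrite eq_complex/= addr0 !eqxx.
  rewrite [X in - (X + w)]c1E rmorphN rmorphM/=.
  by move: (2^-1 +i* tau) => z; ring.
rewrite E -cexp_csum [LHS]mulrA -(csumZ _ (abs_le_cexp_coeff _)).
apply: eq_csum => m.
rewrite /Tterm /cexp_coeff /pois /logx -/l !rmorphM/= fmorphV rmorphXn rmorphM/= rmorph_nat.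
rewrite [(- (w * _)) ^+ m]exprNn [(w * _) ^+ m]exprMn [(w * _) ^+ m]exprMn [(r%:C * _) ^+ m]exprMn exprVn.
move: (w) (wt tau n) => w0 wt0; field.
have rC : r%:C != 0 :> C by rewrite eq_complex/= eqxx andbT gt_eqF.
by rewrite factC_neq0 expf_neq0.
Qed.

Lemma dirichlet_symbol (f : H2) : dirichlet f (c1 + w) =
  csum (fun m => (w / r%:C) ^+ m * Tc r tau f m).
Proof.
pose a m n := (-1) ^+ m * (w / r%:C) ^+ m * Tterm r tau f m n.
set B := Num.sqrt (h2norm f ^+ 2 * CQ r).
have ab m : abs_le (a m) (B * rho ^+ m).
  apply: sum_le_trans (abs_leZ _ (abs_le_Tterm tau r0 f m)).
  rewrite mulrC ler_wpM2l ?sqrtr_ge0// normcM normc_sign mul1r normcX.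
  by rewrite lerXn2r ?nnegrE ?normc_ge0 ?(ltW rho_gt0)// normc_w_div.
have bA := sum_leZ (sqrtr_ge0 _ : 0 <= B) sum_le_geometric.
have [E _ _] := csum_fubini ab bA.
rewrite [LHS](eq_csum (npow_term f)) -[LHS]E; apply: eq_csum => m.
by rewrite /a (csumZ _ (abs_le_Tterm tau r0 f m)) /Tc; ring.
Qed.

Lemma csum_pik m : csum (fun N => pi m N * npow N.+1 (- s)) = (w / r%:C) ^+ m.
Proof.
pose u N := kap d q c m N * npow N (- s).
have uB : abs_le u (r ^+ m) by exact: (abs_le_kapX q_ge2 r0 cr s0).
have uSB : abs_le (fun N => u N.+1) (r ^+ m).
  by apply: (@sum_le_shift R (fun N => normc (u N))) => // N; exact: normc_ge0.
have [E _] := csum_shift 1 uSB.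
have E2 : csum u = csum (fun N => u N.+1).
  rewrite -E; apply: eq_csum => -[|N] /=; first by rewrite /u kap0 mul0r.
  by rewrite subn1.
rewrite (_ : (fun N => _) = fun N => ((r ^+ m)%:C)^-1 * u N.+1); last first.
  by apply/funext => N; rewrite /pik /u; ring.
rewrite (csumZ _ uSB) -E2 /u (csum_kap q_ge2 r0 cr s0) expr_div_n mulrC.
by rewrite rmorphXn.
Qed.

(** The sums over m and N may be interchanged because degree m only involves integers N.+1 >= 2^m,
    which gives a factor rho^m. *)
Lemma dirichlet_Lop (f : H2) : dirichlet (Lop r tau pi f) s =
  csum (fun m => (w / r%:C) ^+ m * Tc r tau f m).
Proof.
have disj := @pik_disj R d q c r q_indep.
have le1 := sum_le_pik_sqr1 q_ge2 r0 cr.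
pose a m N := Tc r tau f m * (pi m N * npow N.+1 (- s)).
set B := Num.sqrt (h2norm f ^+ 2 * CQ r).
have TB m : normc (Tc r tau f m) <= B.
  by rewrite /Tc normcM normc_sign mul1r; exact: (norm_csum (abs_le_Tterm tau r0 f m)).
have pX m : abs_le (fun N => pi m N * npow N.+1 (- s)) (rho ^+ m).
  have rm : 0 <= rho ^+ m by rewrite exprn_ge0// ltW// rho_gt0.
  rewrite -[rho ^+ m]mulr1; apply: le_sum_le (sum_leZ rm (sum_le_pik q_ge2 r0 cr m)) => N.
  rewrite normcM mulrC; have [kz|kz] := eqVneq (kap d q c m N.+1) 0.
    by rewrite (normc_pik _ _ _ r0) kz normc0 !mul0r !mulr0.
  by rewrite ler_wpM2r ?normc_ge0// normc_X_le// (kap_neq0_ge q_ge2 kz).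
have ab m : abs_le (a m) (B * rho ^+ m).
  apply: sum_le_trans (abs_leZ _ (pX m)).
  by rewrite ler_wpM2r ?exprn_ge0 ?(ltW rho_gt0).
have bA := sum_leZ (sqrtr_ge0 _ : 0 <= B) sum_le_geometric.
have [E _ [bb bbP _]] := csum_fubini ab bA.
transitivity (csum (fun N => csum (a ^~ N))); last first.
  rewrite -E; apply: eq_csum => m.
  by rewrite /a (csumZ _ (pX m)) csum_pik mulrC.
apply: eq_csum => N; rewrite (LopE tau r0 disj le1).
have [m0 m0P] := pi_single disj N; rewrite (UcE _ m0P) (@csum1 _ (a ^~ N) m0).
  by rewrite /a mulrA.
by move=> m /m0P pz; rewrite /a pz mul0r mulr0.
Qed.

End point.

Lemma dirichlet_composition (f : H2) s : 2^-1 < complex.Re s ->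
  dirichlet (Lop r tau pi f) s = dirichlet f (symbol d c1 q c s).
Proof.
move=> s_gt; rewrite (dirichlet_Lop s_gt) -(dirichlet_symbol s_gt) symbolE//.
by apply: ltW; apply: lt_trans s_gt; rewrite invr_gt0.
Qed.

Lemma composition_operatorE : composition_operator (symbol d c1 q c) = Lop r tau pi.
Proof.
apply/funext => f; rewrite /composition_operator.
apply: xget_unique => [z z_gt|g h].
  exact: dirichlet_composition.
by apply: dirichlet_unique => z z_gt; rewrite h// dirichlet_composition.
Qed.

End composition_is_model.

(** * The choice of J and K, and the estimates in n *)

Section approximation_numbers.
Variable R : realType.

Lemma approx_number_ge0 (T : hardy2 R -> hardy2 R) n : (0 <= approx_number T n)%E.
Proof.
apply: le_ereal_inf_tmp => _ [S _ <-]; apply: (@le_trans _ _ (h2norm (T 0 - S 0))%:E).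
  by rewrite lee_fin h2norm_ge0.
by apply: ereal_sup_ubound; exists 0 => //=; rewrite h2norm0.
Qed.

(** With y = 9 e^(2b), 9^K/K! = e^(-2bK) y^K/K!, and y^K/K! <= e^y. *)
Lemma rem_const_le (b : R) : exists2 M : R, 0 < M &
  forall K, Num.sqrt (rem_const R K) <= M * expR (- (b * K%:R)).
Proof.
pose y : R := 9 * expR (2 * b).
have y0 : 0 <= y by rewrite mulr_ge0 ?expR_ge0.
exists (Num.sqrt (expR y * expR 9)); first by rewrite sqrtr_gt0 mulr_gt0 ?expR_gt0.
move=> K; rewrite -[X in _ <= _ * X]ger0_norm ?expR_ge0// -sqrtr_sqr -sqrtrM ?mulr_ge0 ?expR_ge0//.
rewrite ler_wsqrtr// /rem_const [leRHS]mulrAC ler_wpM2r ?expR_ge0//.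
have h : y ^+ K / K`!%:R <= expR y.
  by rewrite -(ler_pM2l (expR_gt0 (- y))) mulrA [leRHS]mulrC expRxMexpNx_1 pois_le1.
have E : 9 ^+ K = y ^+ K * expR (- (b * K%:R)) ^+ 2.
  rewrite /y exprMn -expRM_natl -mulrA -expRM_natl -expRD.
  by rewrite (_ : _ + _ = 0) ?expR0 ?mulr1//; ring.
by rewrite E mulrAC ler_wpM2r// sqr_ge0.
Qed.

Lemma powR_half_natE (x : R) e : 0 <= x ->
  x `^ (- ((e.+1%:R - 1) / 2)) = (Num.sqrt x ^+ e)^-1.
Proof.
move=> x0; rewrite powRN; congr (_^-1).
by rewrite -natr1 addrK mulrC powRrM powR12_sqrt// powR_mulrn ?sqrtr_ge0.
Qed.

End approximation_numbers.

Section model_bounds.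
Variables (R : realType) (d : option nat) (q : nat -> nat) (c : nat -> R[i]) (r tau : R).
Hypothesis q_ge2 : forall j, below d j -> (2 <= q j)%N.
Hypothesis q_indep : independent d q.
Hypothesis c_neq0 : forall j, below d j -> c j != 0.
Hypothesis r0 : 0 < r.
Hypothesis cr : sum_le (fun j => normc (cc d c j)) r.
Local Notation pi := (pik d q c r).
Local Notation T := (Lop r tau pi).

Let disj := @pik_disj R d q c r q_indep.
Let le1 := sum_le_pik_sqr1 q_ge2 r0 cr.

(** From block J on, the Poisson mean of D is O((J+1)^(-e)) by the half moments, and its square root
    gives the first term. The factor 2^e in [G0] comes from J + 1 <= 2 sqrt (1 + x) when J^2 <=
    x. *)
Lemma model_approx_upper e (b : R) : (forall j, (j <= e)%N -> below d j) ->
  exists2 M : R, 0 < M & forall J K,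
    (approx_number T (J * K).+1 <=
      (M * ((Num.sqrt J.+1%:R ^+ e)^-1 + J.+1%:R * expR (- (b * K%:R))))%:E)%E.
Proof.
move=> be; have [K1 K10 K1P] := pik_upper q_ge2 q_indep c_neq0 r0 cr be.
have [Kh Kh0 KhP] := pois_half_moment R e.
have [Mb Mb0 MbP] := rem_const_le b.
pose G0 := K1 * Kh * 2 ^+ e.
have G00 : 0 < G0 by rewrite !mulr_gt0// exprn_gt0.
pose M1 := Num.sqrt (CQ r * G0).
pose M2 := Num.sqrt (1 + r^-1) * Mb.
have ri : 0 < r^-1 by rewrite invr_gt0.
have M10 : 0 < M1 by rewrite sqrtr_gt0 mulr_gt0// CQ_gt0.
have M20 : 0 < M2 by rewrite mulr_gt0// sqrtr_gt0 addr_gt0.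
exists (M1 + M2); first by rewrite addr_gt0.
move=> J K; have J0 : 0 < J.+1%:R :> R by rewrite ltr0n.
have sJ0 : 0 < Num.sqrt J.+1%:R :> R by rewrite sqrtr_gt0.
pose D m : R := K1 / Num.sqrt m.+1%:R ^+ e.
have DP m : sum_le (fun N => normc (pi m N) ^+ 2) (D m).
  by apply: sum_le_pik_sqr => // N; exact: K1P.
have GP n : (J <= blk r n)%N -> sum_le (fun m => D m * pois m (logx r n)) (G0 / J.+1%:R ^+ e).
  move=> Jn; have /andP[xn _] := blk_itv r0 n.
  have x0 : 0 <= logx r n by exact: le_trans (sqr_ge0 _) xn.
  have h : sum_le (fun m => K1 * (pois m (logx r n) / Num.sqrt m.+1%:R ^+ e))
      (K1 * (Kh / Num.sqrt (1 + logx r n) ^+ e)) by apply: sum_leZ (KhP _ x0); exact: ltW.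
  apply: (@le_sum_le R _ (fun m => K1 * (pois m (logx r n) / Num.sqrt m.+1%:R ^+ e))).
    by move=> m; rewrite /D mulrAC mulrA.
  apply: sum_le_trans h; rewrite /G0 -!mulrA ler_pM2l// ler_pM2l//.
  have s0 : 0 < Num.sqrt (1 + logx r n) by rewrite sqrtr_gt0 ltr_pwDl.
  rewrite ler_pdivlMr ?exprn_gt0// mulrC ler_pdivrMr ?exprn_gt0// -exprMn.
  rewrite lerXn2r ?nnegrE ?mulr_ge0 ?(ltW s0)//.
  rewrite -[leLHS]ger0_norm// -sqrtr_sqr -[X in X * _]ger0_norm// -sqrtr_sqr -sqrtrM ?sqr_ge0//.
  rewrite ler_wsqrtr//; have : J%:R ^+ 2 <= logx r n.
    by apply: le_trans xn; rewrite lerXn2r ?nnegrE// ler_nat.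
  rewrite -natr1; move: (J%:R : R) => z; nra.
apply: (le_trans (Lop_approx_upper tau r0 disj le1 K DP GP _)).
  by rewrite divr_ge0 ?exprn_ge0 ?(ltW G00).
rewrite lee_fin mulrDr; apply: lerD.
  have -> : CQ r * (G0 / J.+1%:R ^+ e) = (CQ r * G0) * (J.+1%:R ^+ e)^-1 by rewrite mulrA.
  rewrite sqrtrM; last by rewrite mulr_ge0 ?(ltW G00) ?(ltW (CQ_gt0 r0)).
  rewrite -/M1 sqrtrV ?exprn_ge0//.
  have -> : Num.sqrt (J.+1%:R ^+ e) = Num.sqrt J.+1%:R ^+ e :> R.
    by elim: e {be K1P KhP G0 G00 M1 M10 D DP GP} => [|e IH]; rewrite ?expr0 ?sqrtr1// !exprS sqrtrM ?IH.
  by rewrite ler_wpM2r ?invr_ge0 ?exprn_ge0 ?(ltW sJ0)// lerDl ltW.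
rewrite sqrtrM; last by rewrite addr_ge0// divr_ge0 ?sqr_ge0 ?(ltW r0).
apply: (@le_trans _ _ (Num.sqrt (1 + r^-1) * J.+1%:R * (Mb * expR (- (b * K%:R))))).
  apply: ler_pM; rewrite ?sqrtr_ge0//.
  rewrite -[X in _ <= _ * X]ger0_norm// -sqrtr_sqr -sqrtrM ?addr_ge0 ?(ltW ri)//.
  rewrite ler_wsqrtr// mulrDl mul1r; apply: lerD.
    by rewrite -natrX ler1n expn_gt0.
  by rewrite mulrC ler_wpM2l ?(ltW ri)// lerXn2r ?nnegrE// ler_nat.
have -> : Num.sqrt (1 + r^-1) * J.+1%:R * (Mb * expR (- (b * K%:R))) =
    M2 * (J.+1%:R * expR (- (b * K%:R))) by rewrite /M2; ring.
by rewrite ler_wpM2r ?mulr_ge0 ?expR_ge0// lerDr ltW.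
Qed.

Lemma ln_ge_half n : (2 <= n)%N -> 2^-1 <= ln n%:R :> R.
Proof.
move=> n2; apply: (@le_trans _ _ (ln 2)); last by rewrite ler_ln ?posrE ?ltr0n ?ler_nat// ltnW.
have p2 : (0 : R) < 2 by [].
rewrite -ler_expR lnK ?posrE//; apply: le_trans (expR_le_ratio _) _.
  by apply/andP; split; lra.
by rewrite ler_pdivrMr; lra.
Qed.

Lemma model_upper_finite e : (forall j, (j <= e)%N -> below d j) ->
  exists2 M : R, 0 < M & forall n, (2 <= n)%N ->
    (approx_number T n <= (M / Num.sqrt (n%:R / ln n%:R) ^+ e)%:E)%E.
Proof.
(* With b = e + 2 and K >= ln n, e^(-bK) is at most n^(-e-2), enough to beat the factor J + 1 <= 2n
   and the target power of n / ln n. *)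
move=> be; have [M M0 MP] := model_approx_upper e.+2%:R be.
exists (M * (2 ^+ e + 2 * 2 ^+ e)); first by rewrite mulr_gt0// addr_gt0 ?mulr_gt0 ?exprn_gt0.
move=> n n2; set l : R := ln n%:R; set y : R := n%:R / l.
have l12 : 2^-1 <= l by exact: ln_ge_half.
have l0 : 0 < l by lra.
have n0 : 0 < n%:R :> R by rewrite ltr0n ltnW.
have y0 : 0 < y by rewrite divr_gt0.
have sy0 : 0 < Num.sqrt y by rewrite sqrtr_gt0.
have /andP[J1 J2] := truncn_itv (ltW (divr_gt0 y0 (ltr0n R 4))).
have /andP[K1 K2] := truncn_itv (ltW l0).
(* As ln n >= 1/2, K <= ln n + 1 <= 3 ln n, whence JK <= 3n/4 < n. *)
set J := Num.trunc (y / 4) in J1 J2; set K := (Num.trunc l).+1 in K2.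
have JKn : (J * K < n)%N.
  rewrite -(ltr_nat R) natrM; apply: (@le_lt_trans _ _ (y / 4 * (3 * l))).
    apply: ler_pM => //; rewrite /K -natr1; lra.
  have -> : y / 4 * (3 * l) = 3 / 4 * n%:R by rewrite /y; field; rewrite gt_eqF.
  lra.
apply: le_trans (approx_number_anti T JKn) _; apply: le_trans (MP J K) _.
rewrite lee_fin -mulrA ler_pM2l// [leRHS]mulrDl; apply: lerD.
  rewrite -[leLHS]div1r ler_pdivrMr ?exprn_gt0 ?sqrtr_gt0 ?ltr0n//.
  rewrite mulrAC ler_pdivlMr ?exprn_gt0// mul1r -exprMn lerXn2r ?nnegrE ?mulr_ge0 ?sqrtr_ge0//.
  have -> : 2 * Num.sqrt J.+1%:R = Num.sqrt (4 * J.+1%:R) :> R.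
    rewrite [RHS]sqrtrM//; congr (_ * _).
    by rewrite (_ : 4 = 2 ^+ 2 :> R) ?sqrtr_sqr ?ger0_norm//; ring.
  by rewrite ler_wsqrtr//; lra.
have yn : y <= 2 * n%:R.
  rewrite /y ler_pdivrMr//; apply: (@le_trans _ _ (2 * n%:R * 2^-1)); first lra.
  by rewrite ler_wpM2l// mulr_ge0.
have n1 : 1 <= n%:R :> R by rewrite ler1n ltnW.
have Jn : J.+1%:R <= 2 * n%:R :> R.
  rewrite -natr1; apply: (@le_trans _ _ (y / 4 + 1)); first by rewrite lerD2r.
  lra.
have ex : expR (- (e.+2%:R * K%:R)) <= (n%:R ^+ e.+2)^-1 :> R.
  rewrite expRN lef_pV2 ?posrE ?expR_gt0 ?exprn_gt0//.
  by rewrite -[X in X ^+ _ <= _](lnK (_ : n%:R \is Num.pos)) ?posrE// -expRM_natl ler_expR ler_wpM2l// ltW.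
apply: (@le_trans _ _ (2 * n%:R * (n%:R ^+ e.+2)^-1)).
  by apply: ler_pM; rewrite ?expR_ge0.
rewrite -[leLHS]mulrA -[leRHS]mulrA ler_pM2l// ler_pdivrMr ?exprn_gt0// mulrAC ler_pdivlMr ?exprn_gt0//.
have sn : Num.sqrt y <= 2 * n%:R.
  have t0 : 0 <= 2 * n%:R :> R by rewrite mulr_ge0.
  rewrite -[leRHS]ger0_norm// -sqrtr_sqr ler_wsqrtr//; nra.
apply: (@le_trans _ _ (n%:R * (2 * n%:R) ^+ e)).
  by rewrite ler_wpM2l// lerXn2r ?nnegrE ?(ltW sy0) ?mulr_ge0.
rewrite exprMn mulrCA ler_wpM2l ?exprn_ge0// [in leRHS]exprS exprS ler_peMl ?mulr_ge0 ?exprn_ge0//.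
Qed.

(** Taken with e = 4t, b = 2t + 1 and J = K the integer part of sqrt n: both terms are then
    O((J+1)^(-2t)), the second because J + 1 <= e^(J+1), and (J+1)^2 exceeds n. *)
Lemma model_upper_infinite t : (forall j, below d j) ->
  exists2 M : R, 0 < M & forall n, (approx_number T n.+1 <= (M / n.+1%:R ^+ t)%:E)%E.
Proof.
move=> bd; have [M M0 MP] := model_approx_upper (e := 4 * t) (2 * t).+1%:R (fun j _ => bd j).
set b := (2 * t).+1 in MP.
exists (M * (1 + expR b%:R)); first by rewrite mulr_gt0// ltr_pwDl// expR_ge0.
move=> n; have [J [J1 J2]] : exists J, (J * J <= n)%N /\ (n < J.+1 * J.+1)%N.
  elim: n => [|n [J [J1 J2]]]; first by exists 0%N.
  have [h|h] := ltnP n.+1 (J.+1 * J.+1); first by exists J; split => //; exact: leqW.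
  by exists J.+1; split=> //; nia.
apply: le_trans (approx_number_anti T (_ : (J * J).+1 <= n.+1)%N) _; first by [].
apply: le_trans (MP J J) _; rewrite lee_fin -mulrA ler_pM2l//.
have J0 : 0 < J.+1%:R :> R by rewrite ltr0n.
have Jt : (J.+1%:R ^+ (2 * t))^-1 <= (n.+1%:R ^+ t)^-1 :> R.
  rewrite lef_pV2 ?posrE ?exprn_gt0 ?ltr0n// exprM lerXn2r ?nnegrE ?exprn_ge0//.
  by rewrite expr2 -natrM ler_nat.
apply: (@le_trans _ _ ((1 + expR b%:R) * (J.+1%:R ^+ (2 * t))^-1)); last first.
  by rewrite ler_wpM2l// addr_ge0// expR_ge0.
rewrite [leRHS]mulrDl mul1r; apply: lerD.
  have -> : Num.sqrt J.+1%:R ^+ (4 * t) = J.+1%:R ^+ (2 * t) :> R.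
    have -> : (4 * t = 2 * (2 * t))%N by rewrite mulnA.
    by rewrite exprM sqr_sqrtr.
  by [].
have E : expR (- (b%:R * J%:R)) <= expR b%:R * (J.+1%:R ^+ b)^-1 :> R.
  rewrite ler_pdivlMr ?exprn_gt0// -[X in _ <= expR X]mulr1 [leRHS]expRM_natl.
  rewrite -mulrN expRM_natl -exprMn lerXn2r ?nnegrE ?mulr_ge0 ?expR_ge0//.
  rewrite expRN -ler_pdivlMl ?invr_gt0 ?expR_gt0// invrK -expRD.
  by apply: le_trans (expR_ge1Dx _); rewrite -natr1; lra.
apply: le_trans (ler_wpM2l (ltW J0) E) _.
rewrite /b exprS invfM mulrCA ler_wpM2l ?expR_ge0// mulrA divff ?mul1r// gt_eqF//.
Qed.

Lemma model_lower e : d = Some e.+1 -> \sum_(0 <= j < e.+1) normc (c j) = r ->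
  exists2 delta : R, 0 < delta & forall n, (0 < n)%N ->
    ((delta / Num.sqrt n%:R ^+ e)%:E <= approx_number T n)%E.
Proof.
move=> dE rE; have [cD cD0 [m0 m0P]] := pik_lower q_ge2 q_indep c_neq0 r0 cr dE rE.
have [c0 c00 [J0 J0P]] := Lop_approx_lower tau r0 disj le1 cD0 m0P.
have s0 k : 0 < Num.sqrt k.+1%:R :> R by rewrite sqrtr_gt0 ltr0n.
exists (c0 / Num.sqrt J0.+1%:R ^+ e); first by rewrite divr_gt0 ?exprn_gt0.
(* Small n are reached by monotonicity: max(n, J0) <= (J0 + 1) n, which the constant absorbs. *)
move=> n n0; apply: le_trans (approx_number_anti T (leq_maxl n J0)).
apply: le_trans (J0P _ (leq_maxr n J0)); rewrite lee_fin -mulrA ler_pM2l//.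
rewrite -invfM -exprMn -sqrtrM//.
have m_gt0 : (0 < maxn n J0)%N by rewrite leq_max n0.
rewrite lef_pV2 ?posrE ?exprn_gt0 ?sqrtr_gt0 ?ltr0n ?mulr_gt0 ?ltr0n//.
rewrite lerXn2r ?nnegrE ?sqrtr_ge0// ler_wsqrtr// -natrM ler_nat geq_max.
by rewrite leq_pmull//= mulSn (leq_trans (leq_pmulr J0 n0))// addnC mulnC leq_addr.
Qed.

End model_bounds.

(** If the |c_j| had an infinite sum, kappa would be -oo; so the equation itself provides the
    summability. *)
Lemma kappa_sum (R : realType) (d : option nat) (c1 : R[i]) (c : nat -> R[i]) :
  kappa d c1 c = (2^-1)%:E -> exists r : R,
    [/\ complex.Re c1 = 2^-1 + r, sum_le (fun j => normc (cc d c j)) r &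
      forall m, d = Some m -> \sum_(0 <= j < m) normc (c j) = r].
Proof.
have cc0 j : 0 <= normc (cc d c j) by exact: normc_ge0.
have -> : kappa d c1 c = ((complex.Re c1)%:E - nsum (fun j => normc (cc d c j)))%E.
  rewrite /kappa; congr (_ - _)%E; rewrite eseries_mkcond; apply: eq_eseriesr => j _.
  by rewrite /cc; case: ifP; rewrite ?normc0.
have := @sum_le_fine R _ cc0; have := nsum_ge0 cc0.
case E : (nsum _) => [r| |]//= _ /(_ (ltry _)) cr [] re; exists r; split => //.
  by rewrite -re; ring.
move=> m dE; apply/eqP; rewrite eq_le.
have <- : \sum_(0 <= j < m) normc (cc d c j) = \sum_(0 <= j < m) normc (c j).
  by apply: eq_big_nat => j /andP[_ jm]; rewrite /cc dE /= jm.
rewrite cr/= -lee_fin -E; apply/nsum_leP => //; apply: sum_le_fin => // j mj.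
by rewrite /cc dE/= ltnNge mj normc0.
Qed.

Unset Implicit Arguments.

Theorem theorem1p3 (R : realType) (d : option nat) (c1 : R[i])
    (q : nat -> nat) (c : nat -> R[i])
    (d_gt0 : d <> Some 0%N)
    (q_ge2 : forall j, below d j -> (2 <= q j)%N)
    (q_indep : independent d q)
    (c_neq0 : forall j, below d j -> c j != 0)
    (kappa_half : kappa d c1 c = (2^-1)%:E) :
  (forall m : nat, d = Some m ->
    exists delta C : R, [/\ 0 < delta, delta <= C &
      forall n : nat, (2 <= n)%N ->
        ((delta * n%:R `^ (- ((m%:R - 1) / 2)))%:E
          <= approx_number (composition_operator (symbol d c1 q c)) n)%E /\
        (approx_number (composition_operator (symbol d c1 q c)) n
          <= (C * (n%:R / ln n%:R) `^ (- ((m%:R - 1) / 2)))%:E)%E]) /\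
  (d = None ->
    forall p : R, 0 < p ->
      schatten p (composition_operator (symbol d c1 q c))).
Proof.
have [r [c1r cr rE]] := kappa_sum kappa_half.
have bd0 : below d 0 by case: d d_gt0 {q_ge2 q_indep c_neq0 kappa_half cr rE} => // -[|m].
have r0 : 0 < r.
  apply: (@lt_le_trans _ _ (normc (cc d c 0))).
    rewrite /cc bd0 lt_neqAle normc_ge0 andbT eq_sym.
    by apply: contra (c_neq0 _ bd0) => /eqP/eq0_normc ->.
  by apply: (le_term_sum_le 0 _ cr) => j; exact: normc_ge0.
rewrite (composition_operatorE q_ge2 q_indep r0 cr c1r); set tau := complex.Im c1.
split=> [[|e] dE|dE p p0]; first by rewrite dE in d_gt0.
  have be j : (j <= e)%N -> below d j by rewrite dE.
  have [M M0 MP] := model_upper_finite tau q_ge2 q_indep c_neq0 r0 cr be.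
  have [delta delta0 deltaP] := model_lower tau q_ge2 q_indep c_neq0 r0 cr dE (rE _ dE).
  exists delta, (Num.max M delta); split; rewrite ?le_max ?lexx ?orbT// => n n2.
  have l0 : 0 < ln n%:R :> R by apply: lt_le_trans (ln_ge_half R n2); rewrite invr_gt0.
  have y0 : 0 <= n%:R / ln n%:R :> R by rewrite divr_ge0// ltW.
  rewrite !powR_half_natE//; split; first by apply: deltaP; exact: ltnW.
  apply: le_trans (MP n n2) _; rewrite lee_fin ler_wpM2r ?le_max ?lexx//.
have bd j : below d j by rewrite dE.
split.
  (* With e = 4 the bound on D_m is of order (m+1)^(-2), hence summable. *)
  have [K K0 KP] := pik_upper q_ge2 q_indep c_neq0 r0 cr (e := 4) (fun j _ => bd j).
  apply: (Lop_compact tau r0 (@pik_disj R d q c r q_indep) (sum_le_pik_sqr1 q_ge2 r0 cr)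
    (D := fun m => K * (m.+1%:R ^+ 2)^-1) _ (sum_leZ (ltW K0) (@inv_sqr_sum R))) => m.
  apply: sum_le_pik_sqr => // N; rewrite -[X in X ^+ 2]sqr_sqrtr// -exprM.
  exact: KP.
(* Then tp >= 2, and the p-th powers of the approximation numbers are O(n^(-2)). *)
pose t := (Num.trunc (2 / p)).+1.
have tp : 2 <= t%:R * p.
  rewrite -ler_pdivrMr//; have /andP[_ h] := truncn_itv (ltW (divr_gt0 (ltr0n R 2) p0)).
  exact: ltW.
have [M M0 MP] := model_upper_infinite tau q_ge2 q_indep c_neq0 r0 cr t bd.
set T := Lop _ _ _ in MP *.
have aP n : (approx_number T n.+1 `^ p <= (M `^ p * (n.+1%:R ^+ 2)^-1)%:E)%E.
  have n1 : 1 <= n.+1%:R :> R by rewrite ler1n.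
  have D0 : 0 <= M / n.+1%:R ^+ t by rewrite divr_ge0 ?exprn_ge0 ?(ltW M0).
  apply: (@le_trans _ _ ((M / n.+1%:R ^+ t)%:E `^ p)%E).
    apply: gt0_ler_poweR; rewrite ?(ltW p0)// ?in_itv/= ?approx_number_ge0 ?leey ?lee_fin ?D0//.
  rewrite poweR_EFin lee_fin powRM ?(ltW M0) ?invr_ge0 ?exprn_ge0//.
  rewrite ler_wpM2l ?powR_ge0// -powR_mulrn// -powRN -powRrM -powR_mulrn// -powRN.
  by rewrite ler_powR// mulNr lerN2.
apply: (@le_lt_trans _ _ (M `^ p * 2)%:E); last exact: ltry.
apply: lime_le.
  by apply: is_cvg_nneseries => n _ _; exact: poweR_ge0.
apply: nearW => -[|N] /=; first by rewrite big_geq// lee_fin mulr_ge0 ?powR_ge0.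
rewrite big_add1/=.
apply: (@le_trans _ _ (\sum_(0 <= n < N) (M `^ p * (n.+1%:R ^+ 2)^-1)%:E)%E).
  by apply: lee_sum => n _; exact: aP.
by rewrite sumEFin lee_fin; apply: sum_leZ; [exact: powR_ge0|exact: inv_sqr_sum].
Qed.
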